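(* As $B\to\infty$, $$N_{X_2,H}(B) = \mathfrak{c}\, B\log B+O(B),$$ where $$\mathfrak{c} = \frac{1}{8}\cdot\frac{1}{\zeta(2)\zeta(3)}\cdot \left(2 \iiiint_{|a|,|c|,|z|,|(ad-z^3)/c|,|d| \le 1} \frac{1}{|c|} \,\mathrm{d} a\,\mathrm{d} c\,\mathrm{d} d\,\mathrm{d} z\right)$$ is Peyre's constant (the number $\alpha\beta\tau$ attached to the crepant resolution $\pi\colon\widetilde X_2\to X_2$ and the height $H$).
   Context: $X_2=\{ad-bc-z^3=0\}\subseteq \mathbb{P}_{\mathbb{Q}}(1,2,1,2,1)$ is the hypersurface in the weighted projective space with weighted homogeneous coordinates $(a:b:c:d:z)$ of weights $1,2,1,2,1$. The anticanonical height $H\colon X_2(\mathbb{Q})\to\mathbb{R}_{>0}$ is $$H(a:b:c:d:z)=\frac{\max\{|a^4|,|b^2|,|c^4|,|d^2|,|z^4|\}}{\gcd(a^4,b^2,c^4,d^2,z^4)}$$ for integral coordinates $a,b,c,d,z\in\mathbb{Z}$ (in weighted projective space the coordinates cannot be assumed coprime). $N_{X_2,H}(B)=\#\{x\in X_2(\mathbb{Q}): H(x)\le B\}$. The crepant resolution $\pi\colon\widetilde X_2\to X_2$ is the blow-up of the singular locus $\{a=c=z=0\}\cong\mathbb{P}^1_{\mathbb{Q}}$. Concretely, $\widetilde X_2$ is the quotient of $\{ad-bc=z^3w\}\setminus(\{a=c=z=0\}\cup\{b=d=w=0\})\subseteq\mathbb{A}^6_{\mathbb{Q}}$ (coordinates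 $a,b,c,d,z,w$) by $\mathbb{G}_m^2$ acting with degrees $\deg a=\deg c=\deg z=(1,0)$, $\deg b=\deg d=(2,1)$, $\deg w=(0,1)$ in $\mathrm{Pic}(\widetilde X_2)\cong\mathbb{Z}^2$. One has $-K_{\widetilde X_2}=\pi^*(-K_{X_2})=(4,2)$, and $\pi(a:b:c:d:z:w)=(a:b/w:c:d/w:z)$ where $w\neq0$. Peyre's constant is $\alpha\beta\tau$, where: - $\alpha=\mathrm{rk}\,\mathrm{Pic}(\widetilde X_2)\cdot\mathrm{vol}\{t\in\mathrm{Eff}(\widetilde X_2)^\vee:(t,-K_{\widetilde X_2})\le1\}$, the volume being normalized so that $\mathrm{Pic}(\widetilde X_2)^\vee$ has covolume $1$ in $\mathrm{Pic}(\widetilde X_2)^\vee_{\mathbb{R}}$; - $\beta=\#H^1(\mathrm{Gal}(\overline{\mathbb{Q}}/\mathbb{Q}),\mathrm{Pic}((\widetilde X_2)_{\overline{\mathbb{Q}}}))$; - $\tau=\omega_\infty\prod_p(1-p^{-1})^2\omega_p$ with, for $\nu=p$ prime or $\nu=\infty$, $$\omega_\nu=\iiint_{\mathbb{Q}_\nu^3}\frac{\mathrm{d}a\,\mathrm{d}d\,\mathrm{d}z}{\max\{|a^2|_\nu,|ad-z^3|_\nu,1,|d|_\nu,|z^2|_\nu\}^2},$$ where $\mathbb{Q}_\infty=\mathbb{R}$ with Lebesgue measure and $\mathbb{Q}_p$ carries the Haar measure giving $\mathbb{Z}_p$ volume $1$. *)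

(* Defs.v *)
From HB Require Import structures.
From mathcomp Require Import all_boot all_order all_algebra all_field.
From mathcomp Require Import all_classical all_reals all_analysis.
From mathcomp Require Import -(notations) mpoly.
From mathcomp Require Import finmap zify ring lra.
Import Order.TTheory GRing.Theory Num.Theory.
Import numFieldNormedType.Exports.
Set Implicit Arguments. Unset Strict Implicit. Unset Printing Implicit Defensive.
Local Open Scope classical_set_scope.
Local Open Scope ring_scope.
Local Open Scope quotient_scope.

(* For p not prime, [logn p] vanishes and this is the trivial absolute value. *)
Definition padic_abs (p : nat) (x : rat) : rat :=
  if x == 0 then 0
  else p%:R ^ ((logn p `|denq x|)%:Z - (logn p `|numq x|)%:Z).

Section PadicAbs.
Variable p : nat.
Let b : rat := p%:R.

Lemma padic_abs_frac (m n : int) : m != 0 -> n != 0 ->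
  padic_abs p (m%:Q / n%:Q) = b ^ ((logn p `|n|)%:Z - (logn p `|m|)%:Z).
Proof.
move=> m0 n0; rewrite /padic_abs mulf_eq0 invr_eq0 !intr_eq0 (negbTE m0) (negbTE n0) /=.
set x := (m%:Q / n%:Q).
have x0 : x != 0 by rewrite mulf_eq0 invr_eq0 !intr_eq0 negb_or m0 n0.
have E : (numq x * n = m * denq x)%R.
  apply: (@intr_inj rat); rewrite !rmorphM /=.
  apply/eqP; rewrite -eqr_div ?intr_eq0 ?denq_eq0 // divq_num_den //.
have := congr1 (fun z : int => logn p `|z|) E.
rewrite /= !abszM !lognM ?absz_gt0 ?denq_eq0 ?numq_eq0 //.
move=> /(congr1 Posz); rewrite !PoszD => E2.
by congr (_ ^ _); lia.
Qed.


Lemma padic_base : prime p \/ forall n, logn p n = 0%N.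
Proof.
by case: (boolP (prime p)) => pp; [left | right=> n; rewrite lognE (negbTE pp)].
Qed.

Lemma padic_base_neq0 : prime p -> b != 0.
Proof. by move=> pp; rewrite pnatr_eq0 -lt0n prime_gt0. Qed.

Lemma padic_abs0 : padic_abs p 0 = 0.
Proof. by rewrite /padic_abs eqxx. Qed.

Lemma padic_abs_gt0 x : x != 0 -> 0 < padic_abs p x.
Proof.
move=> x0; rewrite /padic_abs (negbTE x0).
case: padic_base => [pp|E]; last by rewrite !E expr0z.
by rewrite exprz_gt0 // ltr0n prime_gt0.
Qed.

Lemma padic_abs_ge0 x : 0 <= padic_abs p x.
Proof.
by have [->|/padic_abs_gt0/ltW//] := eqVneq x 0; rewrite padic_abs0.
Qed.

Lemma padic_abs_eq0 x : (padic_abs p x == 0) = (x == 0).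
Proof.
have [->|x0] := eqVneq x 0; first by rewrite padic_abs0 eqxx.
by rewrite gt_eqF // padic_abs_gt0.
Qed.

Lemma padic_abs1 : padic_abs p 1 = 1.
Proof. by rewrite /padic_abs oner_eq0 /= logn1 subrr expr0z. Qed.

Lemma padic_absM x y : padic_abs p (x * y) = padic_abs p x * padic_abs p y.
Proof.
have [->|x0] := eqVneq x 0; first by rewrite mul0r padic_abs0 mul0r.
have [->|y0] := eqVneq y 0; first by rewrite mulr0 padic_abs0 mulr0.
rewrite -{1}[x]divq_num_den -{1}[y]divq_num_den mulf_div -!rmorphM /=.
rewrite padic_abs_frac ?mulf_neq0 ?denq_eq0 ?numq_eq0 //.
rewrite /padic_abs (negbTE x0) (negbTE y0) !abszM.
rewrite !lognM ?absz_gt0 ?denq_eq0 ?numq_eq0 //.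
case: padic_base => [pp|E]; last by rewrite !E !expr0z mulr1.
by rewrite -expfzDr ?padic_base_neq0 //; congr (_ ^ _); rewrite /numq /denq; lia.
Qed.

Lemma padic_absN x : padic_abs p (- x) = padic_abs p x.
Proof. by rewrite /padic_abs oppr_eq0 denqN numqN abszN. Qed.

Lemma padic_absV x : padic_abs p x^-1 = (padic_abs p x)^-1.
Proof.
have [->|x0] := eqVneq x 0; first by rewrite !invr0 !padic_abs0.
apply: (@mulfI _ (padic_abs p x)); first by rewrite padic_abs_eq0.
by rewrite -padic_absM !divff ?padic_abs1 // padic_abs_eq0.
Qed.

Lemma padic_abs_ultra x y :
  padic_abs p (x + y) <= Num.max (padic_abs p x) (padic_abs p y).
Proof.
have [->|x0] := eqVneq x 0; first by rewrite add0r le_max lexx orbT.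
have [->|y0] := eqVneq y 0; first by rewrite addr0 le_max lexx.
have [->|xy0] := eqVneq (x + y) 0.
  by rewrite padic_abs0 le_max padic_abs_ge0.
pose n := denq x * denq y; pose k := numq x * denq y; pose l := numq y * denq x.
have n0 : n != 0 by rewrite mulf_neq0 ?denq_eq0.
have Ex : x = k%:Q / n%:Q.
  by rewrite !rmorphM -mulf_div divff ?intr_eq0 ?denq_eq0 // mulr1 divq_num_den.
have Ey : y = l%:Q / n%:Q.
  rewrite !rmorphM [(denq x)%:~R * _]mulrC -mulf_div.
  by rewrite divff ?intr_eq0 ?denq_eq0 // mulr1 divq_num_den.
have Exy : x + y = (k + l)%:Q / n%:Q by rewrite Ex Ey -mulrDl rmorphD.
have k0 : k != 0 by rewrite mulf_neq0 ?denq_eq0 ?numq_eq0.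
have l0 : l != 0 by rewrite mulf_neq0 ?denq_eq0 ?numq_eq0.
have kl0 : k + l != 0.
  by apply: contraNneq xy0 => E; rewrite Exy E mul0r.
rewrite Exy {1}Ex {1}Ey !padic_abs_frac //.
case: padic_base => [pp|E]; last by rewrite !E !expr0z le_max lexx.
have b1 : 1 <= b by rewrite ler1n prime_gt0.
suff [H|H] : (logn p `|k : int| <= logn p `|(k + l)%R : int|)%N \/ (logn p `|l : int| <= logn p `|(k + l)%R : int|)%N.
- by rewrite le_max (ler_weXz2l b1) // lerD2l lerN2 lez_nat.
- by rewrite le_max orbC (ler_weXz2l b1) // lerD2l lerN2 lez_nat.
have dv (m : nat) (z : int) : z != 0 -> (m <= logn p `|z|)%N = (Posz (p ^ m)%N %| z)%Z.
  by move=> z0; rewrite dvdzE /= pfactor_dvdn // absz_gt0.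
case: (leqP (logn p `|k|) (logn p `|l|)) => H; [left|right].
  by rewrite dv // rpredD // -dv.
by rewrite dv // rpredD // -dv // ltnW.
Qed.

Lemma padic_abs_ultraB x y :
  padic_abs p (x - y) <= Num.max (padic_abs p x) (padic_abs p y).
Proof. by rewrite -(padic_absN y) padic_abs_ultra. Qed.

End PadicAbs.

Section Qp.
Variable p : nat.

Definition padic_cauchy (u : nat -> rat) : Prop :=
  forall e : rat, 0 < e ->
    exists N, forall m n, (N <= m)%N -> (N <= n)%N -> padic_abs p (u m - u n) < e.

Definition padic_null (u : nat -> rat) : Prop :=
  forall e : rat, 0 < e -> exists N, forall n, (N <= n)%N -> padic_abs p (u n) < e.

Definition cauchy_pred : {pred nat -> rat} := [pred u | `[< padic_cauchy u >]].

Lemma padic_cauchy_bounded u : padic_cauchy u ->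
  exists2 M, 0 < M & forall n, padic_abs p (u n) <= M.
Proof.
move=> /(_ 1 ltr01) [N HN].
exists (Num.max 1 (\sum_(i < N.+1) padic_abs p (u i))); first by rewrite lt_max ltr01.
move=> n; case: (leqP n N) => nN.
  rewrite le_max; apply/orP; right.
  rewrite (bigD1 (Ordinal (nN : (n < N.+1)%N))) //= lerDl.
  by apply: sumr_ge0 => i _; exact: padic_abs_ge0.
rewrite -(subrK (u N) (u n)); apply: le_trans (padic_abs_ultra _ _ _) _.
rewrite ge_max !le_max (ltW (HN _ _ (ltnW nN) (leqnn N))) /=.
apply/orP; right.
rewrite (bigD1 (Ordinal (ltnSn N))) //= lerDl.
by apply: sumr_ge0 => i _; exact: padic_abs_ge0.
Qed.

Fact cauchy_subring : GRing.subring_closed cauchy_pred.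
Proof.
split=> [|u v|u v].
- by apply: asboolT => e e0; exists 0%N => m n _ _; rewrite subrr padic_abs0.
- move=> /asboolW cu /asboolW cv; apply: asboolT => e e0.
  have [N HN] := cu _ e0; have [M HM] := cv _ e0.
  exists (maxn N M) => m n; rewrite !geq_max => /andP[Nm Mm] /andP[Nn Mn].
  have -> : (u - v) m - (u - v) n = (u m - u n) - (v m - v n).
    by transitivity ((u m - v m) - (u n - v n)); last by ring.
  by rewrite (le_lt_trans (padic_abs_ultraB _ _ _)) // gt_max HN ?HM.
- move=> /asboolW cu /asboolW cv; apply: asboolT => e e0.
  have [A A0 HA] := padic_cauchy_bounded cu; have [B B0 HB] := padic_cauchy_bounded cv.
  have [N HN] := cu _ (divr_gt0 e0 B0); have [M HM] := cv _ (divr_gt0 e0 A0).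
  exists (maxn N M) => m n; rewrite !geq_max => /andP[Nm Mm] /andP[Nn Mn].
  have -> : (u * v) m - (u * v) n = (u m - u n) * v m + u n * (v m - v n).
    by transitivity (u m * v m - u n * v n); last by ring.
  rewrite (le_lt_trans (padic_abs_ultra _ _ _)) // gt_max !padic_absM.
  apply/andP; split.
    apply: le_lt_trans (ler_wpM2l (padic_abs_ge0 _ _) (HB m)) _.
    by rewrite -ltr_pdivlMr // HN.
  apply: le_lt_trans (ler_wpM2r (padic_abs_ge0 _ _) (HA n)) _.
  by rewrite mulrC -ltr_pdivlMr // HM.
Qed.

HB.instance Definition _ := GRing.isSubringClosed.Build _ cauchy_pred cauchy_subring.

Record cauchy_seq := CauchySeq { cseq :> nat -> rat; _ : cseq \in cauchy_pred }.
HB.instance Definition _ := [isSub for cseq].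
HB.instance Definition _ := [Choice of cauchy_seq by <:].
HB.instance Definition _ := [SubChoice_isSubComNzRing of cauchy_seq by <:].

Definition null_pred : {pred cauchy_seq} := [pred u : cauchy_seq | `[< padic_null u >]].

Fact null_idealr : idealr_closed null_pred.
Proof.
split.
- by apply: asboolT => e e0; exists 0%N => n _; rewrite padic_abs0.
- apply/negP => /asboolW /(_ 1 ltr01) [N /(_ N (leqnn _))].
  by rewrite padic_abs1 ltxx.
move=> a u v /asboolW nu /asboolW nv; apply: asboolT => e e0.
have [A A0 HA] := padic_cauchy_bounded (asboolW (valP a)).
have [N HN] := nu _ (divr_gt0 e0 A0); have [M HM] := nv _ e0.
exists (maxn N M) => n; rewrite !geq_max => /andP[Nn Mn].
rewrite (le_lt_trans (padic_abs_ultra _ _ _)) // gt_max (HM _ Mn) andbT padic_absM.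
apply: le_lt_trans (ler_wpM2r (padic_abs_ge0 _ _) (HA n)) _.
by rewrite mulrC -ltr_pdivlMr // HN.
Qed.

HB.instance Definition _ := isIdealr.Build _ null_pred null_idealr.

(* The completion of Q: Cauchy sequences modulo null sequences. *)
Definition Qp := {ideal_quot null_pred}.

HB.instance Definition _ := GRing.ComNzRing.on Qp.

Lemma not_null_far (u : cauchy_seq) : ~ padic_null u ->
  exists2 e, 0 < e & exists N, forall n, (N <= n)%N -> e <= padic_abs p (u n).
Proof.
move=> nn; apply: contrapT => far; apply: nn => e e0.
have [N HN] := asboolW (valP u) _ e0.
suff [n Nn un] : exists2 n, (N <= n)%N & padic_abs p (u n) < e.
  exists N => m Nm; rewrite -(subrK (u n) (u m)).
  by rewrite (le_lt_trans (padic_abs_ultra _ _ _)) // gt_max HN.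
apply: contrapT => H; apply: far; exists e => //; exists N => n Nn.
by rewrite leNgt; apply/negP => un; apply: H; exists n.
Qed.

Lemma Qp_inv_ex (x : Qp) : x != 0 -> exists y, y * x = 1.
Proof.
rewrite -[x]reprK; set u := repr x => u0.
have {u0} nu : ~ padic_null u.
  move=> nu; move/negP: u0; apply; rewrite -(@rmorph0 _ _ (\pi_Qp)) -Quotient.idealrBE.
  by rewrite subr0; exact: asboolT.
have [e e0 [N HN]] := not_null_far nu.
have nz n : (N <= n)%N -> u n != 0.
  by move=> /HN; apply: contraTneq => ->; rewrite padic_abs0 -ltNge.
have cv : (fun n => (u n)^-1) \in cauchy_pred.
  apply: asboolT => d d0.
  have [M HM] := asboolW (valP u) _ (mulr_gt0 d0 (mulr_gt0 e0 e0)).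
  exists (maxn N M) => m n; rewrite !geq_max => /andP[Nm Mm] /andP[Nn Mn].
  have -> : (u m)^-1 - (u n)^-1 = (u n - u m) / (u m * u n).
    by field; rewrite !nz.
  rewrite padic_absM padic_absV padic_absM.
  have le2 : e * e <= padic_abs p (u m) * padic_abs p (u n).
    by apply: ler_pM; rewrite ?HN // ltW.
  rewrite ltr_pdivrMr ?(lt_le_trans _ le2) ?mulr_gt0 //.
  by apply: lt_le_trans (HM _ _ Mn Mm) _; rewrite ler_pM2l.
exists (\pi_Qp (CauchySeq cv)).
rewrite -rmorphM -(@rmorph1 _ _ (\pi_Qp)).
apply/eqP; rewrite -Quotient.idealrBE; apply: asboolT => d d0.
exists N => n Nn.
have -> : (CauchySeq cv * u - 1 : cauchy_seq) n = 0.
  by transitivity ((u n)^-1 * u n - 1); rewrite // mulVf ?subrr ?nz.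
by rewrite padic_abs0.
Qed.

Definition Qp_inv (x : Qp) : Qp :=
  if pselect (x != 0) is left x0 then projT1 (cid (Qp_inv_ex x0)) else 0.

Fact Qp_mulVf (x : Qp) : x != 0 -> Qp_inv x * x = 1.
Proof.
by move=> x0; rewrite /Qp_inv; case: pselect => // x0'; case: cid.
Qed.

Fact Qp_inv0 : Qp_inv 0 = 0.
Proof. by rewrite /Qp_inv; case: pselect => // n0; case/eqP: (n0). Qed.

HB.instance Definition _ := GRing.ComNzRing_isField.Build Qp Qp_mulVf Qp_inv0.
HB.instance Definition _ := isPointed.Build Qp 0.

End Qp.

(* Weighted coordinates (a : b : c : d : z). *)
Definition coords (T : Type) : Type := (T * T * T * T * T)%type.

Definition on_X2 (x : coords rat) : Prop :=
  let: (a, b, c, d, z) := x in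
  [/\ ~ [/\ a = 0, b = 0, c = 0, d = 0 & z = 0] & a * d - b * c - z ^+ 3 = 0].

(* Equality of points of P(1,2,1,2,1).  The scalar ranges over the algebraic
   closure: (0:b:0:d:0) and (0:tb:0:td:0) are the same point for every nonzero
   rational t, although t need not be a square in Q. *)
Definition wproj_eq (x y : coords rat) : Prop :=
  let: (a, b, c, d, z) := x in
  let: (a', b', c', d', z') := y in
  exists2 l : algC, l != 0 &
    [/\ ratr a' = l * ratr a, ratr b' = l ^+ 2 * ratr b, ratr c' = l * ratr c,
        ratr d' = l ^+ 2 * ratr d & ratr z' = l * ratr z].

Definition X2_rat_points : set (set (coords rat)) :=
  [set [set y | wproj_eq x y] | x in on_X2].

Definition int_coords (x : coords int) : coords rat :=
  let: (a, b, c, d, z) := x in (a%:Q, b%:Q, c%:Q, d%:Q, z%:Q).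

Definition height_coords (R : realType) (x : coords int) : R :=
  let: (a, b, c, d, z) := x in
  let s := [seq `|t|%N | t <- [:: a ^+ 4; b ^+ 2; c ^+ 4; d ^+ 2; z ^+ 4]] in
  (\max_(k <- s) k)%:R / (\big[gcdn/0]_(k <- s) k)%:R.

(* The value does not depend on the integral coordinates chosen. *)
Definition height (R : realType) (P : set (coords rat)) : R :=
  xget 0 [set height_coords R x | x in [set x | P (int_coords x)]].

Definition counting_function (R : realType) (B : R) : nat :=
  #|` fset_set [set P | X2_rat_points P /\ height R P <= B]|.

Definition zeta (R : realType) (k : nat) : R :=
  limn (series (fun n => (n.+1%:R ^- k : R))).

(* At c = 0, a null set, the integrand is 0 since 0^-1 = 0. *)
Definition box_integral (R : realType) : \bar R :=
  let mu := @lebesgue_measure R in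
  let I := `[(-1 : R), 1]%classic in
  (\int[mu]_(a in I) \int[mu]_(c in I) \int[mu]_(d in I)
    \int[mu]_(z in I `&` [set z | (`|(a * d - z ^+ 3) / c| <= 1)%R])
      (`|c|^-1)%:E)%E.

Definition leading_constant (R : realType) : R :=
  8^-1 * (zeta R 2 * zeta R 3)^-1 * (2 * fine (box_integral R)).

(* The Picard group of the resolution is identified with Z^2, as the grading
   group of its Cox ring K[a,b,c,d,z,w] / (ad - bc - z^3 w); the variables are
   numbered 0, ..., 5 in this order.  A section of the class t is a
   homogeneous polynomial of degree t modulo the relation. *)
Definition cox_weight (i : 'I_6) : int * int :=
  nth 0 [:: (1, 0); (2, 1); (1, 0); (2, 1); (1, 0); (0, 1)] i.

Definition mnm_degree (m : multinom 6) : int * int :=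
  \sum_(i < 6) cox_weight i *+ m i.

Definition cox_var (K : fieldType) (k : nat) : mpoly 6 K :=
  mpolyX K (mnm1 (inord k : 'I_6)).

Definition cox_relation (K : fieldType) : mpoly 6 K :=
  let X := cox_var K in X 0 * X 3 - X 1 * X 2 - X 4 ^+ 3 * X 5.

(* F represents a nonzero section of the class t, that is, an effective
   divisor of class t. *)
Definition cox_section (K : fieldType) (t : int * int) (F : mpoly 6 K) : Prop :=
  (forall m, m \in msupp F -> mnm_degree m = t) /\
  ~ (exists G, F = G * cox_relation K).

Definition Pic_rank : nat := 2.
Definition anticanonical : int * int := (4, 2).

(* The real cone in Pic tensor R spanned by the effective classes. *)
Definition Eff (R : realType) : set (R * R) :=
  [set v | exists2 s : seq (R * (int * int)),
    forall x, x \in s -> 0 <= x.1 /\ exists F, cox_section (K := rat) x.2 F &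
    v = (\sum_(x <- s) x.1 * x.2.1%:~R, \sum_(x <- s) x.1 * x.2.2%:~R)].

Definition Eff_dual (R : realType) : set (R * R) :=
  [set t | forall v, Eff v -> 0 <= t.1 * v.1 + t.2 * v.2].

Definition peyre_alpha (R : realType) : R :=
  let mu := @lebesgue_measure R in
  Pic_rank%:R * fine ((mu \x mu)%E
    [set t | Eff_dual t /\
       t.1 * anticanonical.1%:~R + t.2 * anticanonical.2%:~R <= 1]).

(* algC is the field of algebraic numbers, so its ring endomorphisms fix Q and
   are automatically bijective. *)
Definition galQ : Type := {rmorphism algC -> algC}.

(* s maps the class of div F - div G to that of div F^s - div G^s. *)
Definition gal_Pic (s : galQ) (t : int * int) : int * int :=
  xget 0 [set t' | exists (F G : mpoly 6 algC) (u v u' v' : int * int),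
    [/\ cox_section u F, cox_section v G, t = u - v,
        cox_section u' (map_mpoly s F) /\ cox_section v' (map_mpoly s G) &
        t' = u' - v']].

(* Continuity for the Krull topology and the discrete topology on Pic. *)
Definition gal_continuous (f : galQ -> int * int) : Prop :=
  forall s : galQ, exists S : seq algC,
    forall t : galQ, {in S, s =1 t} -> f t = f s.

Definition gal_cocycle : set (galQ -> int * int) :=
  [set f | gal_continuous f /\
    forall s t : galQ, f (s \o t : {rmorphism _ -> _}) = f s + gal_Pic s (f t)].

Definition gal_H1 : set (set (galQ -> int * int)) :=
  [set [set g | gal_cocycle g /\
           exists m, forall s, g s = f s + (gal_Pic s m - m)]
     | f in gal_cocycle].

Definition peyre_beta : nat := #|` fset_set gal_H1|.

Section Peyre.
Variable R : realType.

Definition Qp_norm (p : nat) (x : Qp p) : R :=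
  limn (fun n => ratr (padic_abs p (repr x n)) : R).

Definition Qp_open (p : nat) : set (set (Qp p)) :=
  [set U | forall x, U x ->
     exists2 e : R, 0 < e & forall y, Qp_norm (y - x) < e -> U y].

Definition Qp_borel (p : nat) := g_sigma_algebraType (@Qp_open p).

(* Translation invariant Borel measure giving Z_p volume 1. *)
Definition is_haar (p : nat) (mu : {measure set (Qp_borel p) -> \bar R}) :=
  (forall (x : Qp p) (A : set (Qp_borel p)), measurable A ->
      mu [set (x + y : Qp p) | y in A] = mu A) /\
  mu [set x : Qp p | Qp_norm x <= 1] = 1%E.

Definition density (K : comNzRingType) (abs : K -> R) (a d z : K) : R :=
  (\big[Num.max/0]_(x <- [:: a ^+ 2; a * d - z ^+ 3; 1; d; z ^+ 2]) abs x) ^- 2.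

Definition omega_infty : \bar R :=
  let mu := @lebesgue_measure R in
  (\int[mu]_a \int[mu]_d \int[mu]_z (density Num.norm a d z)%:E)%E.

Definition omega_p (p : nat) (mu : {measure set (Qp_borel p) -> \bar R}) : \bar R :=
  (\int[mu]_a \int[mu]_d \int[mu]_z
     (density (@Qp_norm p) (a : Qp p) (d : Qp p) (z : Qp p))%:E)%E.

Definition tau_partial (mu : forall p, {measure set (Qp_borel p) -> \bar R})
    (n : nat) : R :=
  fine omega_infty *
  \prod_(0 <= p < n | prime p) ((1 - p%:R^-1) ^+ 2 * fine (omega_p (mu p))).

Definition peyre_tau (mu : forall p, {measure set (Qp_borel p) -> \bar R}) : R :=
  limn (tau_partial mu).

End Peyre.

(* Main.v *)
Require Import Defs.
From HB Require Import structures.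
From mathcomp Require Import all_boot all_order all_algebra all_field.
From mathcomp Require Import all_classical all_reals all_analysis.
From mathcomp Require Import measurable_realfun.
From mathcomp Require Import -(notations) mpoly.
From mathcomp Require Import finmap zify ring lra.
Import Order.TTheory GRing.Theory Num.Theory.
Import numFieldNormedType.Exports.
Local Open Scope classical_set_scope.
Local Open Scope ring_scope.
Set Implicit Arguments. Unset Strict Implicit. Unset Printing Implicit Defensive.

(** The asymptotic formula is proved on the universal torsor. A rational point
    off the singular line a = c = z = 0 can be written (a : b/w : c : d/w : z)
    with integers satisfying a d - b c = z^3 w, w > 0 and both (a, c, z) and
    (b, d, w) primitive, uniquely up to the sign of (a, c, z)
    (torsor_proj_inj, torsor_proj_surj), and its height is the maximum of
    a^4 w^2, b^2, c^4 w^2, d^2 and z^4 w^2 (height_torsor). With m the integer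
    part of sqrt B, the counting function is therefore half the number of such
    integral points with a^2 w, c^2 w, z^2 w, |b|, |d| <= m, up to the O(B)
    points of the singular line (counting_function_bounds).

    Moebius inversion over the common divisors of (b, d, w) replaces m by m / f
    and drops the condition on (b, d, w); it accounts for the factor
    1 / zeta 2. For given (a, c, z) and w the pairs (b, d) are the lattice
    points of a line in a square. With g = gcd(a, c) there are none unless g
    divides w, and otherwise their number is g m ell + O(1), where ell is a
    normalised length (line_count_approx). As ell is monotone in w, summing g
    ell over the multiples of g amounts to summing ell over all w
    (sum_multiples_antitone). The errors are summed with the help of the
    estimate sum_sqrt_gcd for the average of sqrt (gcd(a, c)), and points with
    a c z = 0 are treated by a crude bound; the total is O(m^2)
    (sum_fiber_error).

    What remains is 8 m times the sum over w <= m of the lengths for primitive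
    positive (a, c, z) with squares at most m / w. A second Moebius inversion
    gives 1 / zeta 3 and leaves sums over all such triples, which are compared
    cell by cell with the integral of ell over the octant, that is, with an
    eighth of the box integral (octant_sum_approx). The relative error is a
    power of w / m, so the sum of m / w over w yields m ln m
    (torsor_sum_asymp, primitive_count_asymp).

    As for Peyre's constant, the Galois action on the Picard group is trivial,
    so continuous cocycles are homomorphisms to a torsion-free group and vanish
    (gal_cocycle_eq0); the effective cone is a quadrant (peyre_alphaE). The
    p-adic density is (1 + 1/p) (1 + 1/p + 1/p^2) by three successive radial
    integrals (omega_pE), so that the local factors form the Euler product of
    1 / (zeta 2 zeta 3). The real density is twice the box integral: its
    integrand M^-2 is itself an integral over a fourth variable |c| <= M^(-1/2),
    and a change of variables with the weights of the coordinates turns the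
    affine chart c = 1 into the box (omega_inftyE). *)

(** * Sums over multiples and the Moebius function *)

Section NatSums.

Lemma big_nat_shrink (V : nmodType) (F : nat -> V) (P : pred nat) (m' m : nat) :
  (m' <= m)%N -> (forall k, (m' < k <= m)%N -> P k -> F k = 0) ->
  \sum_(1 <= k < m.+1 | P k) F k = \sum_(1 <= k < m'.+1 | P k) F k.
Proof.
move=> le F0; rewrite (@big_cat_nat _ _ _ m'.+1) //=.
rewrite [X in _ + X]big_nat_cond [X in _ + X]big1 ?addr0 // => k /andP[/andP[h1 h2] h3].
by apply: F0 => //; rewrite h1.
Qed.

Lemma big_nat_multiples (V : nmodType) (F : nat -> V) (q m : nat) : (0 < q)%N ->
  \sum_(1 <= k < m.+1 | (q %| k)%N) F k = \sum_(1 <= k < (m %/ q).+1) F (q * k)%N.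
Proof.
move=> q0; elim: m => [|m IH]; first by rewrite div0n !big_geq.
rewrite big_mkcond big_nat_recr //= -big_mkcond IH.
have := divn_eq m q; have := ltn_pmod m q0.
case: (boolP (q %| m.+1)%N) => [/dvdnP[j Ej]|ndv] hm E.
  have : (m.+1 %/ q = (m %/ q).+1)%N.
    rewrite Ej mulnK //; set k := (m %/ q)%N in E *.
    have kj : (k < j)%N by rewrite -(ltn_pmul2r q0); lia.
    have : (j < k.+2)%N by rewrite -(ltn_pmul2r q0) mulSnr mulSnr; lia.
    lia.
  move=> Eq; rewrite Eq [RHS]big_nat_recr //=; congr (_ + F _).
  by rewrite -Eq mulnC divnK // Ej dvdn_mull.
have -> : (m.+1 %/ q = (m %/ q))%N.
  have ne : ((m %% q).+1 != q)%N.
    by apply: contraNN ndv => /eqP e; rewrite E -addnS e -mulSnr dvdn_mull.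
  have lt : ((m %% q).+1 < q)%N by rewrite ltn_neqAle ne.
  by rewrite {1}E -addnS divnMDl // (divn_small lt) addn0.
by rewrite addr0.
Qed.

End NatSums.

Section Mobius.

Definition squarefree (n : nat) := all (fun p => (logn p n <= 1)%N) (primes n).

Definition mobius (n : nat) : int :=
  if squarefree n then (-1) ^+ size (primes n) else 0.

Lemma squarefreeP n p : squarefree n -> (logn p n <= 1)%N.
Proof.
move=> /allP sf; case: (boolP (p \in primes n)) => [/sf//|].
by rewrite -logn_gt0 -leqNgt leqn0 => /eqP ->.
Qed.

Lemma mobius_abs_le1 n : `|mobius n| <= 1.
Proof. by rewrite /mobius; case: ifP => _; rewrite ?normr0 // normrX normrN1 expr1n. Qed.

Lemma mobius1 : mobius 1 = 1.
Proof. by rewrite /mobius /squarefree /=. Qed.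

Lemma mobius_primeM q n : prime q -> (0 < n)%N ->
  mobius (q * n) = if (q %| n)%N then 0 else - mobius n.
Proof.
move=> pq n0; have q0 := prime_gt0 pq.
have pqn0 : (0 < q * n)%N by rewrite muln_gt0 q0.
have lg p : logn p (q * n) = ((p == q) + logn p n)%N.
  by rewrite lognM // logn_prime // eq_sym.
have mp p : (p \in primes (q * n)) = (p == q) || (p \in primes n).
  by rewrite -!logn_gt0 lg; case: (p == q).
case: ifP => dv.
  rewrite /mobius ifF //; apply/negbTE/allPn; exists q; first by rewrite mp eqxx.
  rewrite lg eqxx -ltnNge; have : (0 < logn q n)%N by rewrite logn_gt0 mem_primes pq n0.
  by lia.
have qn : q \notin primes n by rewrite mem_primes pq n0 dv.
have sz : size (primes (q * n)) = (size (primes n)).+1.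
  apply: (@perm_size _ _ (q :: primes n)); apply: uniq_perm; rewrite /= ?primes_uniq ?qn // => p; rewrite in_cons mp.
have sfE : squarefree (q * n) = squarefree n.
  apply/allP/allP => h p hp.
    by have := h p; rewrite mp hp orbT lg => /(_ isT); lia.
  rewrite lg; move: hp; rewrite mp; case: eqVneq => [->|_] /= hp; last exact: h.
  by move: qn; rewrite -logn_gt0; lia.
by rewrite /mobius sfE sz exprS mulN1r; case: ifP; rewrite ?oppr0.
Qed.

(** A square-free divisor of n is either prime to q or q times a divisor d
    prime to q; passing from d to q d changes the Moebius function by a sign
    and h by the factor h q. *)
Lemma mobius_sum_split (R : comNzRingType) (h : nat -> R) (q m n : nat) :
  (forall d, h (q * d)%N = h q * h d) ->
  prime q -> (0 < n <= m)%N -> (q %| n)%N ->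
  \sum_(1 <= d < m.+1 | (d %| n)%N) (mobius d)%:~R * h d =
  (1 - h q) * \sum_(1 <= d < m.+1 | (d %| n)%N && ~~ (q %| d)%N) (mobius d)%:~R * h d.
Proof.
move=> hM pq /andP[n0 nm] qn; have q0 := prime_gt0 pq.
rewrite (bigID (fun d => (q %| d)%N)) /= mulrBl mul1r addrC; congr (_ + _).
under eq_bigl => d do rewrite andbC.
rewrite big_mkcondr /= big_nat_multiples //.
rewrite -mulNr big_mkcond [X in _ * X]big_mkcond /= mulr_sumr.
rewrite [RHS](@big_nat_shrink _ _ _ (m %/ q)%N) ?leq_div //.
  rewrite big_nat [RHS]big_nat; apply: eq_bigr => d /andP[d0 dm].
  rewrite mobius_primeM //; case: (boolP (q %| d)%N) => qd /=.
    by rewrite andbF mulr0z mul0r if_same mulr0.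
  have -> : (q * d %| n)%N = (d %| n)%N.
    by rewrite Gauss_dvd ?qn // prime_coprime.
  rewrite andbT; case: ifP => _; rewrite ?mulr0 // hM mulrNz; ring.
move=> d /andP[d1 d2] _; case: ifP; rewrite ?mulr0 // => /andP[dn qd].
have : (q * d %| n)%N by rewrite Gauss_dvd ?qn // prime_coprime.
move=> /dvdn_leq => /(_ n0); move: d1; rewrite ltn_divLR // mulnC; lia.
Qed.

(** For n > 1 apply the splitting at the least prime divisor of n to h = 1,
    where the factor 1 - h q vanishes. *)
Lemma mobius_sum (R : comNzRingType) (m n : nat) : (0 < n <= m)%N ->
  \sum_(1 <= d < m.+1 | (d %| n)%N) (mobius d)%:~R = (n == 1%N)%:R :> R.
Proof.
move=> /andP[n0 nm]; case: eqVneq => [->|n1].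
  have m0 : (0 < m)%N by exact: leq_trans n0 nm.
  rewrite big_mkcond big_ltn ?ltnS //= mobius1.
  rewrite big_nat big1 ?addr0 // => d /andP[d1 _]; rewrite dvdn1.
  by case: eqVneq d1 => // ->.
have pq : prime (pdiv n) by rewrite pdiv_prime // ltn_neqAle eq_sym n1.
transitivity (\sum_(1 <= d < m.+1 | (d %| n)%N) (mobius d)%:~R * (fun=> 1 : R) d).
  by apply: eq_bigr => d _; rewrite mulr1.
rewrite (@mobius_sum_split _ _ (pdiv n)) ?n0 ?pdiv_dvd //.
  by rewrite subrr mul0r.
by move=> _; rewrite mulr1.
Qed.

End Mobius.

(** * Power sums, partial zeta sums and the Euler product *)

Section PowerSums.
Variable R : realType.
Implicit Types (n m k : nat).

Lemma sum_le_telescope (F G : nat -> R) n :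
  (forall k, (0 < k <= n)%N -> F k <= G k - G k.-1) ->
  \sum_(1 <= k < n.+1) F k <= G n - G 0%N.
Proof.
elim: n => [|n IH] h; first by rewrite big_geq // subrr.
rewrite big_nat_recr //= (le_trans (lerD (IH _) (h n.+1 _))) ?leqnn //.
  by move=> k /andP[k0 kn]; apply: h; rewrite k0 leqW.
by rewrite /= addrC addrA subrK.
Qed.

Lemma sqrt_nat_gt0 k : (0 < k)%N -> 0 < Num.sqrt k%:R :> R.
Proof. by move=> k0; rewrite sqrtr_gt0 ltr0n. Qed.

Lemma sqrt_nat_ge1 k : (0 < k)%N -> 1 <= Num.sqrt k%:R :> R.
Proof. by move=> k0; rewrite -[leLHS]sqrtr1 ler_wsqrtr // ler1n. Qed.

(** With t and u the square roots of k + 1 and k, 1 = (t - u) (t + u) <= 2 t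
    (t - u), so 1 / t is at most the increment of 2 sqrt k. *)
Lemma sum_inv_sqrt n :
  \sum_(1 <= k < n.+1) (Num.sqrt k%:R)^-1 <= 2 * Num.sqrt n%:R :> R.
Proof.
apply: le_trans (@sum_le_telescope _ (fun k => 2 * Num.sqrt k%:R) n _) _; last first.
  by rewrite sqrtr0 mulr0 subr0.
move=> [//|k] _ /=; set t := Num.sqrt k.+1%:R; set u := Num.sqrt k%:R.
have t0 : 0 < t by exact: sqrt_nat_gt0.
have u0 : 0 <= u by exact: sqrtr_ge0.
have tu : t ^+ 2 = u ^+ 2 + 1 by rewrite !sqr_sqrtr // -natr1.
rewrite -(ler_pM2r t0) mulVf ?gt_eqF //; nra.
Qed.

(** The same telescoping for fourth roots, from 1 = t^4 - u^4 <= 4 t^3 (t -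
    u). *)
Lemma sum_inv_sqrt4 n :
  \sum_(1 <= k < n.+1) (Num.sqrt (Num.sqrt k%:R) ^+ 3)^-1
    <= 4 * Num.sqrt (Num.sqrt n%:R) :> R.
Proof.
apply: le_trans (@sum_le_telescope _ (fun k => 4 * Num.sqrt (Num.sqrt k%:R)) n _) _; last first.
  by rewrite sqrtr0 sqrtr0 mulr0 subr0.
move=> [//|k] _ /=; set t := Num.sqrt (Num.sqrt k.+1%:R); set u := Num.sqrt (Num.sqrt k%:R).
have t0 : 0 < t by rewrite sqrtr_gt0 sqrt_nat_gt0.
have u0 : 0 <= u by exact: sqrtr_ge0.
have tu : t ^+ 4 = u ^+ 4 + 1.
  by rewrite !(exprM _ 2 2) !sqr_sqrtr ?sqrtr_ge0 // -natr1.
have ut : u <= t by rewrite !ler_wsqrtr // ler_nat.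
have t30 : 0 < t ^+ 3 by rewrite exprn_gt0.
rewrite -(ler_pM2r t30) mulVf ?gt_eqF //.
have e : 1 = (t - u) * (t ^+ 3 + t ^+ 2 * u + t * u ^+ 2 + u ^+ 3).
  by transitivity (t ^+ 4 - u ^+ 4); [rewrite tu; ring | ring].
have -> : (4 * t - 4 * u) * t ^+ 3 = (t - u) * (4 * t ^+ 3) by ring.
rewrite [leLHS]e; apply: ler_wpM2l; first by rewrite subr_ge0.
rewrite !exprS !expr0 !mulr1.
have h2 : u * u <= t * t by apply: ler_pM.
have h3 : u * (u * u) <= t * (t * t) by apply: ler_pM => //; rewrite mulr_ge0.
have h4 : t * (u * u) <= t * (t * t) by apply: ler_wpM2l => //; exact: ltW.
have h5 : t * t * u <= t * t * t by apply: ler_wpM2l => //; rewrite mulr_ge0 // ltW.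
lra.
Qed.

(** The general term is at most the increment of - 2 / sqrt k; the value 0 of
    G at k = 0 accounts for the first term. *)
Lemma sum_inv_3half n :
  \sum_(1 <= k < n.+1) (k%:R * Num.sqrt k%:R)^-1 <= 3 :> R.
Proof.
pose G k : R := if k is 0%N then 0 else 3 - 2 / Num.sqrt k%:R.
apply: le_trans (@sum_le_telescope _ G n _) _; last first.
  rewrite /G subr0; case: n => [//|n].
  by rewrite lerBlDl lerDr divr_ge0 // sqrtr_ge0.
move=> [//|[|k]] _; rewrite /G /=; first by rewrite sqrtr1; lra.
set t := Num.sqrt k.+2%:R; set u := Num.sqrt k.+1%:R.
have t0 : 0 < t by exact: sqrt_nat_gt0.
have u0 : 0 < u by exact: sqrt_nat_gt0.
have tt : t ^+ 2 = k.+2%:R by rewrite sqr_sqrtr.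
have tu : t ^+ 2 = u ^+ 2 + 1 by rewrite !sqr_sqrtr // -natr1.
have -> : 3 - 2 / t - (3 - 2 / u) = 2 * (t - u) / (u * t).
  by field; rewrite !gt_eqF.
rewrite -tt ler_pdivlMr ?mulr_gt0 // mulrC ler_pdivrMr; last by rewrite mulr_gt0 // exprn_gt0.
have ut : u <= t by rewrite ler_wsqrtr // ler_nat.
have e : (t - u) * (t + u) = 1 by rewrite -[RHS](addrK (u ^+ 2)) [1 + _]addrC -tu; ring.
have : 1 <= (t - u) * (2 * t) by rewrite -[leLHS]e ler_wpM2l ?subr_ge0; lra.
rewrite expr2 => h; have := ler_wpM2l (ltW (mulr_gt0 t0 t0)) h; nra.
Qed.

Lemma ln_le_sub1 (x : R) : 0 < x -> ln x <= x - 1.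
Proof. by move=> x0; have := @le_ln1Dx R (x - 1); rewrite [1 + _]addrC subrK; apply; lra. Qed.

Lemma ln_le_2sqrt k : (0 < k)%N -> ln k%:R <= 2 * Num.sqrt k%:R :> R.
Proof.
move=> k0; have s0 := sqrt_nat_gt0 k0; set s := Num.sqrt _ in s0 *.
have -> : k%:R = s * s by rewrite -expr2 sqr_sqrtr.
rewrite lnM ?posrE //; have := ln_le_sub1 s0; lra.
Qed.

(** ln k <= 2 sqrt k reduces the sum to that of k^(-3/2). *)
Lemma sum_ln_inv_sqr n :
  \sum_(1 <= k < n.+1) ln k%:R / k%:R ^+ 2 <= 6 :> R.
Proof.
apply: (@le_trans _ _ (2 * \sum_(1 <= k < n.+1) (k%:R * Num.sqrt k%:R)^-1)); last first.
  have := sum_inv_3half n; lra.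
rewrite mulr_sumr big_nat [leRHS]big_nat; apply: ler_sum => k /andP[k0 _].
have s0 := sqrt_nat_gt0 k0; have := ln_le_2sqrt k0; set s := Num.sqrt _ in s0 *.
have -> : k%:R = s * s by rewrite -expr2 sqr_sqrtr.
rewrite ler_pdivrMr ?exprn_gt0 ?mulr_gt0 //.
have -> // : 2 / (s * s * s) * (s * s) ^+ 2 = 2 * s.
by field; rewrite gt_eqF.
Qed.

(** Sum 1 / (k + 1) <= ln (k + 1) - ln k <= 1 / k. *)
Lemma harmonic_ln n : (0 < n)%N ->
  ln n.+1%:R <= \sum_(1 <= k < n.+1) (k%:R)^-1 :> R /\
  \sum_(1 <= k < n.+1) (k%:R)^-1 <= 1 + ln n%:R :> R.
Proof.
have l2 k : (0 < k)%N -> ln k.+1%:R - ln k%:R <= k%:R^-1 :> R.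
  move=> k0; have k1 : 0 < k%:R :> R by rewrite ltr0n.
  rewrite -ln_div ?posrE ?ltr0n //; apply: le_trans (ln_le_sub1 _) _; first by rewrite divr_gt0 ?ltr0n.
  by rewrite -natr1 mulrDl divff ?gt_eqF // mul1r addrC addKr.
have l1 k : (0 < k)%N -> k.+1%:R^-1 <= ln k.+1%:R - ln k%:R :> R.
  move=> k0; have k1 : 0 < k%:R :> R by rewrite ltr0n.
  have k2 : 0 < k.+1%:R :> R by rewrite ltr0n.
  rewrite -[leRHS]opprB -ln_div ?posrE // lerNr.
  apply: le_trans (ln_le_sub1 _) _; first by rewrite divr_gt0.
  have -> : k%:R / k.+1%:R = 1 - k.+1%:R^-1 :> R.
    by rewrite -natr1; field; rewrite natr1 gt_eqF.
  by rewrite addrAC subrr sub0r.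
elim: n => // [[|n]] IH _.
  rewrite big_nat1 ln1 invr1 addr0; split=> //.
  by have := l2 1%N isT; rewrite ln1 subr0 invr1.
have [IH1 IH2] := IH isT; rewrite big_nat_recr //=.
have a1 (S a b i : R) : a <= S -> b - a <= i -> b <= S + i by lra.
have a2 (S a b i : R) : S <= 1 + a -> i <= b - a -> S + i <= 1 + b by lra.
by split; [exact: a1 IH1 (l2 _ _) | exact: a2 IH2 (l1 _ _)].
Qed.

End PowerSums.

Section Zeta.
Variable R : realType.
Implicit Types (n m k d : nat).

Definition zeta_sum k n : R := \sum_(1 <= j < n.+1) (j%:R ^+ k)^-1.

Lemma inv_exp_le k j : (1 < k)%N -> (0 < j)%N -> (j%:R ^+ k)^-1 <= (j%:R ^+ 2)^-1 :> R.
Proof.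
move=> k1 j0; have j1 : 0 < j%:R :> R by rewrite ltr0n.
by rewrite lef_pV2 ?posrE ?exprn_gt0 // ler_weXn2l // ler1n.
Qed.

(** Compare with the telescoping sum of 1 / (j (j + 1)). *)
Lemma zeta_sum_tail k n m : (1 < k)%N -> (0 < n <= m)%N ->
  zeta_sum k m - zeta_sum k n <= n%:R^-1.
Proof.
move=> k1 /andP[n0 nm].
suff : zeta_sum k m - zeta_sum k n <= n%:R^-1 - m%:R^-1.
  by move/le_trans; apply; rewrite lerBlDr lerDl invr_ge0.
rewrite -(subnK nm) addnC; elim: (m - n)%N => [|j IH]; first by rewrite addn0 !subrr.
rewrite addnS /zeta_sum big_nat_recr //= -/(zeta_sum k (n + j)) -/(zeta_sum k n).
have := inv_exp_le k1 (ltn0Sn (n + j)).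
have p1 : 0 < (n + j)%:R :> R by rewrite ltr0n addn_gt0 n0.
have : ((n + j).+1%:R ^+ 2)^-1 <= (n + j)%:R^-1 - (n + j).+1%:R^-1 :> R.
  rewrite -natr1; set x := (n + j)%:R in p1 *.
  have -> : x^-1 - (x + 1)^-1 = (x * (x + 1))^-1 by field; lra.
  rewrite lef_pV2 ?posrE; nra.
have arith (A Z a b u v w : R) : A - Z <= w - u -> b <= u - v -> a <= b -> A + a - Z <= w - v.
  by lra.
by move=> h1 h2; exact: arith IH h1 h2.
Qed.

Lemma zeta_sum_le2 k n : (1 < k)%N -> zeta_sum k n <= 2.
Proof.
move=> k1; case: n => [|n]; first by rewrite /zeta_sum big_geq.
have := @zeta_sum_tail k 1 n.+1 k1 isT.
rewrite {2}/zeta_sum big_nat1 expr1n invr1; lra.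
Qed.

Lemma zeta_sum_nondecreasing k : {homo zeta_sum k : n m / (n <= m)%N >-> n <= m}.
Proof.
move=> n m nm; rewrite /zeta_sum [leRHS](@big_cat_nat _ _ _ n.+1) //= lerDl.
by apply: sumr_ge0 => j _; rewrite invr_ge0 exprn_ge0.
Qed.

Lemma zeta_sum_cvg k : (1 < k)%N -> zeta_sum k n @[n --> \oo] --> zeta R k.
Proof.
move=> k1; have E : series (fun n => (n.+1%:R ^- k : R)) = zeta_sum k.
  apply/funext => n; rewrite /series /= /zeta_sum.
  by rewrite [RHS]big_add1.
rewrite /zeta E; apply: nondecreasing_is_cvgn; first exact: zeta_sum_nondecreasing.
by exists 2 => _ [n _ <-]; exact: zeta_sum_le2.
Qed.

Lemma zeta_sum_le_zeta k n : (1 < k)%N -> zeta_sum k n <= zeta R k.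
Proof.
move=> k1; rewrite -(cvg_lim _ (zeta_sum_cvg k1)) //.
apply: nondecreasing_cvgn_le; first exact: zeta_sum_nondecreasing.
by apply/cvg_ex; exists (zeta R k); exact: zeta_sum_cvg.
Qed.

Lemma zeta_le_zeta_sum k n : (1 < k)%N -> (0 < n)%N ->
  zeta R k <= zeta_sum k n + n%:R^-1.
Proof.
move=> k1 n0; rewrite -(cvg_lim _ (zeta_sum_cvg k1)) //.
apply: limr_le; first by apply/cvg_ex; exists (zeta R k); exact: zeta_sum_cvg.
near=> m; have nm : (n <= m)%N by near: m; exact: nbhs_infty_ge.
by have := @zeta_sum_tail k n m k1; rewrite n0 nm => /(_ isT); lra.
Unshelve. all: by end_near. Qed.

Lemma zeta_ge1 k : (1 < k)%N -> 1 <= zeta R k.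
Proof.
move=> k1; apply: le_trans (zeta_sum_le_zeta 1 k1).
by rewrite /zeta_sum big_nat1 expr1n invr1.
Qed.

Definition mobius_zeta_sum k n : R := \sum_(1 <= d < n.+1) (mobius d)%:~R * (d%:R ^+ k)^-1.

Lemma mobius_norm d : `|(mobius d)%:~R| <= 1 :> R.
Proof. by rewrite -intr_norm lerz1 mobius_abs_le1. Qed.

(** Grouping the pairs (f, j) by the product m = f j <= n leaves, for each m,
    the sum of the Moebius function over the divisors of m. *)
Lemma mobius_zeta_conv k n : (0 < n)%N ->
  \sum_(1 <= f < n.+1) (mobius f)%:~R * (f%:R ^+ k)^-1 * zeta_sum k (n %/ f) = 1.
Proof.
move=> n0.
transitivity (\sum_(1 <= f < n.+1) \sum_(1 <= m < n.+1 | (f %| m)%N)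
    (mobius f)%:~R * (m%:R ^+ k)^-1 : R).
  rewrite big_nat [RHS]big_nat; apply: eq_bigr => f /andP[f0 _].
  rewrite big_nat_multiples // mulr_sumr; apply: eq_bigr => j _.
  by rewrite natrM exprMn invfM mulrA.
rewrite (exchange_big_dep_nat predT) //=.
rewrite (eq_big_nat _ _ (F2 := fun m => (m == 1%N)%:R * (m%:R ^+ k)^-1)); last first.
  by move=> m /andP[m0 mn]; rewrite -mulr_suml mobius_sum // m0.
rewrite big_ltn // eqxx mul1r expr1n invr1 big_nat big1 ?addr0 // => m /andP[m1 _].
by rewrite gtn_eqF // mul0r.
Qed.

(** By the convolution identity, zeta k times the partial sum differs from 1
    by the sum of mu(f) f^-k times the tail of zeta k beyond n / f. Each tail
    is at most 2 f / n, and bounding f^-1 by f^(-1/2) avoids a logarithm. *)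
Lemma mobius_zeta_sum_approx k n : (1 < k)%N -> (0 < n)%N ->
  `|mobius_zeta_sum k n - (zeta R k)^-1| <= 4 / Num.sqrt n%:R.
Proof.
move=> k1 n0; have z1 := zeta_ge1 k1; set z := zeta R k in z1 *.
have z0 : 0 < z by lra.
have nR : 0 < n%:R :> R by rewrite ltr0n.
suff h : `|mobius_zeta_sum k n * z - 1| <= 4 / Num.sqrt n%:R.
  have -> : mobius_zeta_sum k n - z^-1 = (mobius_zeta_sum k n * z - 1) / z.
    by field; rewrite gt_eqF.
  rewrite normrM normfV (gtr0_norm z0) ler_pdivrMr //.
  by apply: le_trans h _; rewrite ler_peMr // divr_ge0 // sqrtr_ge0.
rewrite -[X in _ - X](mobius_zeta_conv k n0) /mobius_zeta_sum mulr_suml -sumrB.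
apply: le_trans (ler_norm_sum _ _ _) _.
apply: (@le_trans _ _ (2 / n%:R * \sum_(1 <= f < n.+1) (Num.sqrt f%:R)^-1)); last first.
  apply: le_trans (ler_wpM2l _ (sum_inv_sqrt R n)) _; first by rewrite divr_ge0.
  have s0 := sqrt_nat_gt0 R n0; set s := Num.sqrt _ in s0 *; have <- : s ^+ 2 = n%:R by rewrite sqr_sqrtr.
  have -> // : 2 / s ^+ 2 * (2 * s) = 4 / s by field; rewrite gt_eqF.
rewrite mulr_sumr big_nat [leRHS]big_nat; apply: ler_sum => f /andP[f0 fn].
have fR : 0 < f%:R :> R by rewrite ltr0n.
rewrite -mulrBr normrM normrM -mulrA; apply: le_trans (ler_piMl _ (mobius_norm f)) _.
  by rewrite mulr_ge0.
have q0 : (0 < n %/ f)%N by rewrite divn_gt0.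
have q1 : 0 < (n %/ f)%:R :> R by rewrite ltr0n.
have h1 := zeta_sum_le_zeta (n %/ f) k1; have h2 := zeta_le_zeta_sum k1 q0.
have h3 : (n %/ f)%:R^-1 <= 2 * f%:R / n%:R :> R.
  rewrite ler_pdivlMr // mulrC ler_pdivrMr // -!natrM ler_nat.
  by have := divn_eq n f; have := ltn_pmod n f0; nia.
have s1 := sqrt_nat_ge1 R f0; have s0 := sqrt_nat_gt0 R f0.
have h4 : (f%:R ^+ k)^-1 <= (f%:R ^+ 2)^-1 :> R by exact: inv_exp_le.
have h5 : 0 <= (f%:R ^+ k)^-1 :> R by rewrite invr_ge0 exprn_ge0.
rewrite (ger0_norm h5) ger0_norm; last by rewrite -/z in h1; lra.
have h6 : z - zeta_sum k (n %/ f) <= 2 * f%:R / n%:R by rewrite -/z in h2; lra.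
apply: le_trans (ler_pM h5 _ h4 h6) _; first by rewrite -/z in h1; lra.
have -> : (f%:R ^+ 2)^-1 * (2 * f%:R / n%:R) = 2 / n%:R * f%:R^-1 :> R.
  by field; rewrite !gt_eqF.
apply: ler_wpM2l; first by rewrite divr_ge0.
rewrite lef_pV2 ?posrE // -[leRHS](@sqr_sqrtr _ f%:R) // expr2 ler_peMl //; lra.
Qed.

Lemma inv_sqrt_nat_cvg0 (C : R) : C / Num.sqrt n%:R @[n --> \oo] --> (0 : R).
Proof.
apply/cvgrPdist_le => e e0; near=> n.
have n0 : (0 < n)%N by near: n; exact: nbhs_infty_gt.
have s0 := sqrt_nat_gt0 R n0.
rewrite sub0r normrN normrM normfV (gtr0_norm s0) ler_pdivrMr //.
have : (`|C| / e) ^+ 2 <= n%:R by near: n; exact: nbhs_infty_ger.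
move=> /ler_wsqrtr; rewrite sqrtr_sqr (@ger0_norm _ (`|C| / e)) ?divr_ge0 ?(ltW e0) //.
by rewrite ler_pdivrMr // mulrC.
Unshelve. all: by end_near. Qed.

Lemma cvg_inv_sqrt_rate (u : nat -> R) (l C : R) :
  (forall n, (0 < n)%N -> `|u n - l| <= C / Num.sqrt n%:R) -> u n @[n --> \oo] --> l.
Proof.
move=> h; apply/cvgrPdist_le => e e0.
have /cvgrPdist_le/(_ _ e0) H := inv_sqrt_nat_cvg0 C.
near=> n; have n0 : (0 < n)%N by near: n; exact: nbhs_infty_gt.
rewrite distrC; apply: le_trans (h n n0) _; apply: le_trans (ler_norm _) _.
by rewrite -normrN -[X in `|X|]sub0r; near: n.
Unshelve. all: by end_near. Qed.

Lemma squarefree_dvdn d m : (0 < d)%N -> squarefree d ->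
  (forall p, prime p -> (p %| d)%N -> (p %| m)%N) -> (d %| m)%N.
Proof.
move=> d0 sf h; apply/dvdn_partP => // p; rewrite mem_primes => /and3P[pp _ pd].
rewrite p_part; apply: dvdn_trans (h p pp pd).
by have := squarefreeP p sf; case: (logn p d) => [|[|//]]; rewrite ?dvd1n.
Qed.

(** The product over p < n is the sum of mu(d) d^-k over the divisors d of the
    primorial N n. Every square-free d < n is such a divisor, so the partial
    Moebius sum is contained in it and the remaining terms lie in the tail of
    zeta k. *)
Lemma euler_product k :  (1 < k)%N ->
  \prod_(0 <= p < n | prime p) (1 - (p%:R ^+ k)^-1) @[n --> \oo] --> ((zeta R k)^-1 : R).
Proof.
move=> k1; pose P n : R := \prod_(0 <= p < n | prime p) (1 - (p%:R ^+ k)^-1).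
pose N n := (\prod_(0 <= p < n | prime p) p)%N.
have N0 n : (0 < N n)%N by rewrite prodn_cond_gt0 // => p /prime_gt0.
have NS n : N n.+1 = (N n * (if prime n then n else 1))%N.
  by rewrite /N big_mkcond big_nat_recr //= -big_mkcond.
have PS n : P n.+1 = P n * (if prime n then 1 - (n%:R ^+ k)^-1 else 1).
  by rewrite /P big_mkcond big_nat_recr //= -big_mkcond.
have dvN n p : prime p -> (p < n)%N -> (p %| N n)%N.
  elim: n => // n IH pp; rewrite ltnS leq_eqVlt NS => /orP[/eqP <-|pn].
    by rewrite pp dvdn_mull.
  by rewrite dvdn_mulr // IH.
have ndvN n p : prime p -> (n <= p)%N -> ~~ (p %| N n)%N.
  elim: n => [|n IH] pp; first by rewrite /N big_geq // Euclid_dvd1.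
  move=> np; rewrite NS Euclid_dvdM // negb_or IH ?(ltnW np) //=.
  case: ifP => pn; last by rewrite Euclid_dvd1.
  by rewrite dvdn_prime2 // gtn_eqF.
have hM q d : ((q * d)%N%:R ^+ k)^-1 = (q%:R ^+ k)^-1 * (d%:R ^+ k)^-1 :> R.
  by rewrite natrM exprMn invfM.
have PE n m : (N n <= m)%N ->
    P n = \sum_(1 <= d < m.+1 | (d %| N n)%N) (mobius d)%:~R * (d%:R ^+ k)^-1.
  elim: n m => [|n IH] m.
    have -> : P 0%N = 1 by rewrite /P big_geq.
    have -> : N 0%N = 1%N by rewrite /N big_geq.
    move=> m0.
    rewrite big_mkcond big_ltn // dvd1n mobius1 expr1n invr1 mulr1 big_nat big1.
      by rewrite [RHS]addr0.
    by move=> d /andP[d1 _]; rewrite dvdn1 gtn_eqF.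
  rewrite NS PS; case: (boolP (prime n)) => pn; last by rewrite mulr1 muln1; exact: IH.
  move=> Nm.
  have n0 := prime_gt0 pn.
  have Nm' : (N n <= m)%N by apply: leq_trans Nm; rewrite leq_pmulr.
  rewrite (@mobius_sum_split _ (fun d => (d%:R ^+ k)^-1) n) //; last 2 first.
  - by rewrite muln_gt0 N0 n0.
  - by rewrite dvdn_mull.
  rewrite mulrC (IH m Nm'); congr (_ * _); apply: eq_bigl => d.
  apply/idP/andP => [h|[h1 h2]].
    split; first exact: dvdn_mulr.
    by apply: contra (ndvN n n pn (leqnn n)) => /dvdn_trans; apply.
  by rewrite -(@Gauss_dvdl d (N n) n) // coprime_sym prime_coprime.
have dist n : (0 < n)%N -> `|P n.+1 - mobius_zeta_sum k n| <= n%:R^-1.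
  move=> n0; pose m := maxn (N n.+1) n.
  rewrite (@PE n.+1 m) ?leq_maxl // /mobius_zeta_sum.
  rewrite (@big_cat_nat _ _ _ n.+1) ?ltnS ?leq_maxr //=.
  have -> : \sum_(1 <= d < n.+1 | (d %| N n.+1)%N) (mobius d)%:~R * (d%:R ^+ k)^-1 =
     \sum_(1 <= d < n.+1) (mobius d)%:~R * (d%:R ^+ k)^-1 :> R.
    rewrite big_mkcond big_nat [RHS]big_nat; apply: eq_bigr => d /andP[d0 dn].
    case: ifPn => // ndv; rewrite /mobius; case: ifPn => [sf|_]; last by rewrite mulr0z mul0r.
    case/negP: ndv; apply: squarefree_dvdn => // p pp pd; apply: dvN => //.
    by rewrite (leq_ltn_trans _ dn) // dvdn_leq.
  rewrite addrAC subrr add0r; apply: le_trans (ler_norm_sum _ _ _) _.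
  apply: le_trans (@zeta_sum_tail k n m k1 _); last by rewrite n0 leq_maxr.
  rewrite /zeta_sum [leRHS]addrC (@big_cat_nat _ _ _ n.+1 1 m.+1) ?ltnS ?leq_maxr //= addrA addNr add0r.
  rewrite big_mkcond /=; apply: ler_sum => d _; case: ifP => _; last by rewrite invr_ge0 exprn_ge0.
  have h5 : 0 <= (d%:R ^+ k)^-1 :> R by rewrite invr_ge0 exprn_ge0.
  by rewrite normrM (ger0_norm h5) ler_piMl // mobius_norm.
suff : P n.+1 @[n --> \oo] --> ((zeta R k)^-1 : R) by rewrite (cvg_shiftS P).
apply: (@cvg_inv_sqrt_rate _ _ 5) => n n0.
have h1 := mobius_zeta_sum_approx k1 n0.
have h2 : `|P n.+1 - mobius_zeta_sum k n| <= (Num.sqrt n%:R)^-1.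
  apply: le_trans (dist n n0) _; rewrite lef_pV2 ?posrE ?ltr0n ?sqrt_nat_gt0 //.
  by rewrite -[leRHS](@sqr_sqrtr _ n%:R) // expr2 ler_peMl ?sqrtr_ge0 // sqrt_nat_ge1.
have -> : P n.+1 - (zeta R k)^-1 =
  (P n.+1 - mobius_zeta_sum k n) + (mobius_zeta_sum k n - (zeta R k)^-1) by ring.
apply: le_trans (ler_normD _ _) _; lra.
Qed.

End Zeta.

(** * The Picard group: trivial Galois action and effective cone *)

Section CoxRing.

Lemma mnm_degreeE (m : multinom 6) :
  mnm_degree m = ((m (inord 0) + 2 * m (inord 1) + m (inord 2) + 2 * m (inord 3) + m (inord 4))%:Z,
                  (m (inord 1) + m (inord 3) + m (inord 5))%:Z).
Proof.
have io k (h : (k < 6)%N) : Ordinal h = inord k by apply: val_inj; rewrite /= inordK.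
rewrite /mnm_degree !big_ord_recl big_ord0 /cox_weight /=.
have l i k : val i = k -> i = inord k :> 'I_6 by move=> <-; rewrite inord_val.
rewrite (l (lift ord0 ord0) 1%N) // (l (lift ord0 (lift ord0 ord0)) 2%N) //.
rewrite (l (lift ord0 (lift ord0 (lift ord0 ord0))) 3%N) //.
rewrite (l (lift ord0 (lift ord0 (lift ord0 (lift ord0 ord0)))) 4%N) //.
rewrite (l (lift ord0 (lift ord0 (lift ord0 (lift ord0 (lift ord0 ord0))))) 5%N) //.
rewrite (l ord0 0%N) //.
have pE (x y : int) n : (x, y) *+ n = (x *+ n, y *+ n).
  by elim: n => // n IH; rewrite !mulrS IH.
rewrite !pE !mul0rn !pmulrn !mulrzz /=.
by congr (_, _) => /=; lia.
Qed.

(** The weights of the six generators lie in the quadrant, so homogeneous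
    elements have degrees there. *)
Lemma mnm_degree_ge0 (m : multinom 6) : 0 <= (mnm_degree m).1 /\ 0 <= (mnm_degree m).2.
Proof. by rewrite mnm_degreeE. Qed.

Definition monomial_aw (i j : nat) : multinom 6 :=
  mnm_add (mnm_muln (mnm1 (inord 0)) i) (mnm_muln (mnm1 (inord 5)) j).

Lemma cox_section_neq0 (K : fieldType) t (F : mpoly 6 K) : cox_section t F ->
  exists2 m, m \in msupp F & mnm_degree m = t.
Proof.
move=> [hd hG]; case E : (msupp F) => [|m s]; last first.
  by exists m; [rewrite inE eqxx | apply: hd; rewrite E inE eqxx].
by case: hG; exists 0; rewrite mul0r; exact: msuppnil0.
Qed.

(** Evaluation at the point a = w = 1, b = c = d = z = 0 of the hypersurface
    shows that these monomials are not multiples of the relation. *)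
Lemma cox_section_monomial (K : fieldType) (i j : nat) :
  cox_section (i%:Z, j%:Z) (mpolyX K (monomial_aw i j)).
Proof.
split=> [m|[G E]].
  rewrite msuppX inE => /eqP ->; rewrite mnm_degreeE /monomial_aw.
  have iE k l : (k < 6)%N -> (l < 6)%N -> (inord k == inord l :> 'I_6) = (k == l).
    by move=> hk hl; rewrite -val_eqE /= !inordK.
  by rewrite !mnmDE !mulmnE !mnm1E !iE //=; congr (_, _); lia.
pose v (k : 'I_6) : K := ((k == inord 0) || (k == inord 5))%:R.
have iE k l : (k < 6)%N -> (l < 6)%N -> (inord k == inord l :> 'I_6) = (k == l).
  by move=> hk hl; rewrite -val_eqE /= !inordK.
have := congr1 (meval v) E.
rewrite mevalM /cox_relation /cox_var !mevalB !mevalM.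
rewrite !mevalXU /v !iE //= !(mulr0, mul0r, subr0).
rewrite mevalX => /eqP; rewrite prodf_seq_eq0 => /hasP[k _] /=.
rewrite expf_eq0 => /andP[].
rewrite /monomial_aw mnmDE !mulmnE !mnm1E (eq_sym k (inord 0)) (eq_sym k (inord 5)).
by case: (inord 0 == k); case: (inord 5 == k); rewrite /= ?oner_eq0 ?mul0n.
Qed.

(** A ring endomorphism of the coefficients does not change the support, hence
    not the degree. *)
Lemma map_mpoly_cox_section (s : galQ) t t' (F : mpoly 6 algC) :
  cox_section t F -> cox_section t' (map_mpoly s F) -> t' = t.
Proof.
move=> /cox_section_neq0[m mF <-] [h _]; rewrite (h m) //.
by rewrite mcoeff_msupp mcoeff_map_mpoly fmorph_eq0 -mcoeff_msupp.
Qed.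

Lemma int_subn (z : int) : exists p q : nat, z = p%:Z - q%:Z.
Proof.
by case: z => n; [exists n, 0%N; rewrite subr0 | exists 0%N, n.+1; rewrite NegzE sub0r].
Qed.

(** Galois acts trivially: every class is a difference of classes of monomials,
    which have rational coefficients. *)
Lemma gal_Pic_id (s : galQ) t : gal_Pic s t = t.
Proof.
rewrite /gal_Pic; apply: xget_unique => /=.
  have [p [q E1]] := int_subn t.1; have [p' [q' E2]] := int_subn t.2.
  exists (mpolyX algC (monomial_aw p p')), (mpolyX algC (monomial_aw q q')).
  exists (p%:Z, p'%:Z), (q%:Z, q'%:Z), (p%:Z, p'%:Z), (q%:Z, q'%:Z).
  have tE : t = (p%:Z, p'%:Z) - (q%:Z, q'%:Z) by rewrite [t]surjective_pairing E1 E2.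
  rewrite !map_mpolyX.
  by split; [exact: cox_section_monomial|exact: cox_section_monomial|
    |split; exact: cox_section_monomial|].
move=> t' [F [G [u [v [u' [v' [hF hG -> [hF' hG'] ->]]]]]]].
by rewrite (map_mpoly_cox_section hF hF') (map_mpoly_cox_section hG hG').
Qed.

End CoxRing.

Section GaloisCohomology.

Fixpoint gal_pow (s : galQ) (k : nat) : galQ :=
  if k is k'.+1 then (s \o gal_pow s k' : {rmorphism _ -> _}) else (idfun : {rmorphism algC -> algC}).

Lemma gal_powE s k x : gal_pow s k x = iter k s x.
Proof. by elim: k => //= k ->. Qed.

(** The iterates of x are roots of its minimal polynomial. *)
Lemma gal_orbit_finite (s : galQ) (x : algC) : exists2 k, (0 < k)%N & iter k s x = x.
Proof.
have [rs Ers] := closed_field_poly_normal (minCpoly x).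
have inrs k : iter k s x \in rs.
  have : root (minCpoly x) (iter k s x).
    elim: k => [|k IH] /=; first exact: root_minCpoly.
    have [q [Eq _] _] := minCpolyP x.
    rewrite Eq in IH *; move: IH; rewrite /root => /eqP IH; apply/eqP.
    have -> : map_poly ratr q = map_poly s (map_poly ratr q).
      by rewrite -map_poly_comp; apply: eq_map_poly => y /=; rewrite fmorph_rat.
    by rewrite horner_map IH rmorph0.
  by rewrite Ers rootZ ?lead_coef_eq0 ?minCpoly_eq0 // root_prod_XsubC.
have : looping s x (size rs).
  rewrite -[looping _ _ _]negbK -looping_uniq; apply/negP => /uniq_leq_size.
  move=> /(_ rs); rewrite size_traject ltnn => h; apply: notF; apply: h.
  by move=> y /trajectP[i _ ->].
move=> /loopingP /(_ (size rs)) /trajectP[i lti E].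
exists (size rs - i)%N; first by rewrite subn_gt0.
have sinj : injective (iter i s) by elim: i {lti E} => //= i IH y z /fmorph_inj /IH.
by apply: sinj; rewrite -iterD subnKC // ltnW.
Qed.

(** The product of periods of the single elements is a common period. *)
Lemma gal_pow_fixes (s : galQ) (S : seq algC) :
  exists2 k, (0 < k)%N & {in S, forall x, iter k s x = x}.
Proof.
elim: S => [|x S [k k0 IH]]; first by exists 1%N.
have [l l0 E] := gal_orbit_finite s x.
have itM i j y : iter j s y = y -> iter (i * j) s y = y.
  by move=> e; elim: i => // i IHi; rewrite mulSn iterD IHi.
exists (l * k)%N; first by rewrite muln_gt0 l0.
by move=> y; rewrite inE => /predU1P[->|/IH]; [rewrite mulnC|]; exact: itM.
Qed.

(** A continuous homomorphism to the torsion-free discrete group Z^2 vanishes: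
    it is trivial on the stabilizer of some finite set, and that stabilizer
    contains a power of every automorphism. *)
Lemma gal_cocycle_eq0 f : gal_cocycle f -> f = (fun=> 0).
Proof.
move=> [cont hom]; have {}hom (s t : galQ) : f (s \o t : {rmorphism _ -> _}) = f s + f t.
  by rewrite hom gal_Pic_id.
have f1 : f (idfun : {rmorphism algC -> algC}) = 0.
  pose i : galQ := (idfun : {rmorphism algC -> algC}).
  have [S HS] := cont i; have := hom i i; rewrite (HS (i \o i : {rmorphism _ -> _})) //.
  by move/eqP; rewrite -subr_eq0 opprD addNKr oppr_eq0 => /eqP.
have fpow s k : f (gal_pow s k) = f s *+ k.
  by elim: k => [//|k IH] /=; rewrite hom IH mulrS.
apply/funext => s; have [S HS] := cont (idfun : {rmorphism algC -> algC}).
have [k k0 hk] := gal_pow_fixes s S.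
have : f (gal_pow s k) = 0.
  by rewrite -f1; apply: HS => x xS; rewrite gal_powE hk.
rewrite fpow; case: (f s) => x y.
have pE (a b : int) n : (a, b) *+ n = (a *+ n, b *+ n).
  by elim: n => // n IH; rewrite !mulrS IH.
rewrite pE => -[] /eqP; rewrite mulrn_eq0 gtn_eqF //= => /eqP ->.
by move=> /eqP; rewrite mulrn_eq0 gtn_eqF //= => /eqP ->.
Qed.

Lemma gal_cocycle0 : gal_cocycle (fun=> 0).
Proof.
split=> [s|s t]; first by exists [::].
by rewrite gal_Pic_id addr0.
Qed.

Lemma peyre_betaE : peyre_beta = 1%N.
Proof.
rewrite /peyre_beta; suff -> : gal_H1 = [set [set (fun=> 0)]].
  by rewrite fset_set1 cardfs1.
apply/seteqP; split=> [A [f /gal_cocycle_eq0 -> <-]|A ->]; rewrite /gal_H1 /=.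
  apply/seteqP; split=> [g [/gal_cocycle_eq0-> _]//|g -> /=].
  by split; [exact: gal_cocycle0|exists 0 => s; rewrite gal_Pic_id subrr].
exists (fun=> 0); first exact: gal_cocycle0.
apply/seteqP; split=> [g [/gal_cocycle_eq0-> _]//|g -> /=].
by split; [exact: gal_cocycle0|exists 0 => s; rewrite gal_Pic_id subrr].
Qed.

End GaloisCohomology.

Section EffectiveCone.
Variable R : realType.

(** The divisors a = 0 and w = 0 have the classes (1, 0) and (0, 1), which
    span the quadrant. *)
Lemma Eff_dualE : @Eff_dual R = [set t : R * R | 0 <= t.1 /\ 0 <= t.2].
Proof.
apply/seteqP; split=> t /=.
  move=> h; split.
    have := h (1, 0); rewrite /= mulr1 mulr0 addr0; apply.
    exists [:: (1, (1, 0))]; last by rewrite !big_seq1 /= !mul1r.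
    move=> x; rewrite inE => /eqP -> /=; split=> //.
    by exists (mpolyX rat (monomial_aw 1 0)); exact: cox_section_monomial.
  have := h (0, 1); rewrite /= mulr1 mulr0 add0r; apply.
  exists [:: (1, (0, 1))]; last by rewrite !big_seq1 /= !mul1r.
  move=> x; rewrite inE => /eqP -> /=; split=> //.
  by exists (mpolyX rat (monomial_aw 0 1)); exact: cox_section_monomial.
move=> [t1 t2] v [s hs ->] /=; rewrite addr_ge0 // mulr_ge0 //.
  rewrite big_seq sumr_ge0 // => x /hs[x0 [F /cox_section_neq0[m _ <-]]].
  by rewrite mulr_ge0 // ler0z; case: (mnm_degree_ge0 m).
rewrite big_seq sumr_ge0 // => x /hs[x0 [F /cox_section_neq0[m _ <-]]].
by rewrite mulr_ge0 // ler0z; case: (mnm_degree_ge0 m).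
Qed.

(** The polytope is the triangle with vertices 0, (1/4, 0) and (0, 1/2), of
    area 1/16. *)
Lemma peyre_alphaE : peyre_alpha R = 8^-1.
Proof.
rewrite /peyre_alpha Eff_dualE /Pic_rank /anticanonical /=.
set A := (X in fine (_ X)).
have secE (x : R) : xsection A x =
    if 0 <= x then [set` `[0, (1 - 4 * x) / 2]] else set0.
  apply/seteqP; split=> y; rewrite /xsection /= in_setE /A /=.
    move=> [[x0 y0] h]; rewrite x0 /= in_itv /= y0 /= ler_pdivlMr //.
    by move: h; rewrite -![_%:~R]pmulrn; lra.
  case: ifP => // x0; rewrite /= in_itv /= ler_pdivlMr // => /andP[y0 h].
  by split=> //; rewrite -![_%:~R]pmulrn; lra.
have -> : (lebesgue_measure \x lebesgue_measure)%E A =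
    (\int[lebesgue_measure]_(x in `[0%R, 4^-1%R]) ((1 - 4 * x) / 2)%:E)%E.
  rewrite /product_measure1 [RHS]integral_mkcond; apply: eq_integral => x _.
  rewrite /= secE patchE; case: ifPn => x0; last first.
    rewrite measure0 ifF //; apply/negbTE; rewrite notin_setE /= in_itv /=.
    by apply/negP; rewrite negb_and x0.
  rewrite lebesgue_measure_itv /= lte_fin.
  case: ifPn => [h|h].
    rewrite mem_set /=; first by rewrite sube0.
    by rewrite in_itv /= x0 /=; lra.
  case: ifPn => // /set_mem /=; rewrite in_itv /= => /andP[_ h2].
  have -> : (1 - 4 * x) / 2 = 0 by lra.
  by [].
pose F (x : R) := x / 2 - x ^+ 2.
have dF (x : R) : is_derive x 1 F ((1 - 4 * x) / 2).
  rewrite /F; apply: is_derive_eq.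
  rewrite /GRing.scale /= ?mulr0 ?addr0; by field.
rewrite (@continuous_FTC2 R _ F) //.
- by rewrite /F -EFinB /=; field.
- apply: continuous_subspaceT => x.
  apply: cvgM; last exact: cvg_cst.
  by apply: cvgB; [exact: cvg_cst|apply: cvgM; [exact: cvg_cst|exact: cvg_id]].
- have cF x : {for x, continuous F}.
    by apply/differentiable_continuous/derivable1_diffP; have := dF x; case.
  split=> [x _||]; [by have := dF x; case|exact/cvg_at_right_filter/cF|exact/cvg_at_left_filter/cF].
- by move=> x _; rewrite derive1E; apply: derive_val.
Qed.

End EffectiveCone.

(** * The p-adic norm *)

Section PadicNorm.
Variables (R : realType) (p : nat).
Hypothesis pp : prime p.
Local Notation abs := (padic_abs p).
Local Notation "\| x |" := (@Qp_norm R p x) (at level 0, x at level 99, format "\| x |").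

Let p0 : (0 : R) < p%:R. Proof. by rewrite ltr0n prime_gt0. Qed.

Lemma padic_abs_isosceles (x y : rat) : abs (x - y) < abs y -> abs x = abs y.
Proof.
move=> h; apply/eqP; rewrite eq_le; apply/andP; split.
  rewrite -(subrK y x); apply: le_trans (padic_abs_ultra _ _ _) _.
  by rewrite ge_max lexx (ltW h).
rewrite leNgt; apply/negP => h2.
have := padic_abs_ultraB p x (x - y); rewrite opprB addrC subrK.
by rewrite leNgt gt_max h2 h.
Qed.

Lemma padic_abs_dist (x y : rat) : `|abs x - abs y| <= abs (x - y).
Proof.
have [h|h] := ltP (abs (x - y)) (abs y).
  by rewrite (padic_abs_isosceles h) subrr normr0 padic_abs_ge0.
have h1 : abs x <= abs (x - y).
  by rewrite -{1}(subrK y x) (le_trans (padic_abs_ultra _ _ _)) // ge_max lexx h.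
have x0 := padic_abs_ge0 p x; have y0 := padic_abs_ge0 p y.
by rewrite ler_norml; apply/andP; split; lra.
Qed.

Lemma ratr_lt_pos (e : R) : 0 < e -> exists2 d : rat, 0 < d & ratr d < e.
Proof.
move=> e0; have hn : e^-1 < (Num.truncn e^-1).+1%:R by apply: truncnS_gt.
set n := (Num.truncn _).+1 in hn.
exists (n%:R)^-1; first by rewrite invr_gt0 ltr0n.
rewrite fmorphV /= ratr_nat invf_plt ?posrE ?ltr0n //.
Qed.

Local Notation pi u := (\pi_(Qp p) u)%qT.

Lemma Qp_pi_eq (u v : cauchy_seq p) : padic_null p (u - v) -> pi u = pi v.
Proof. by move=> h; apply/eqP; rewrite -Quotient.idealrBE; apply: asboolT. Qed.

Lemma Qp_pi_null (u v : cauchy_seq p) : pi u = pi v -> padic_null p (u - v).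
Proof. by move/eqP; rewrite -Quotient.idealrBE => /asboolW. Qed.

(** The absolute values of a Cauchy sequence form a Cauchy sequence of real
    numbers. *)
Lemma padic_abs_cvg (u : cauchy_seq p) : cvgn (fun n => ratr (abs (u n)) : R).
Proof.
apply/cauchy_cvgP; apply: cauchy_exP => e e0.
have [d d0 de] := ratr_lt_pos e0.
have [N HN] := asboolW (valP u) _ d0.
exists (ratr (abs (u N))); exists N => // n /= Nn.
rewrite /ball /= distrC -raddfB /= -ratr_norm; apply: lt_trans de.
by rewrite ltr_rat (le_lt_trans (padic_abs_dist _ _)) // HN.
Qed.

Lemma Qp_norm_cvg (u : cauchy_seq p) : (ratr (abs (u n)) : R) @[n --> \oo] --> \| pi u |.
Proof.
have cv := @padic_abs_cvg (repr (pi u)).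
rewrite /Qp_norm; set v := repr (pi u) in cv *.
have nuv : padic_null p (v - u) by apply: Qp_pi_null; rewrite reprK.
apply/cvgrPdist_lt => e e0.
have e2 : 0 < e / 2 by rewrite divr_gt0.
have [d d0 de] := ratr_lt_pos e2.
have [N HN] := nuv _ d0.
move/cvgrPdist_lt : cv => /(_ _ e2) cv.
near=> n.
have Nn : (N <= n)%N by near: n; exact: nbhs_infty_ge.
set l := lim _.
have h1 : `|l - ratr (abs (v n))| < e / 2 by near: n.
have h2 : `|ratr (abs (v n)) - ratr (abs (u n)) : R| < e / 2.
  rewrite -raddfB /= -ratr_norm; apply: lt_trans de.
  by rewrite ltr_rat (le_lt_trans (padic_abs_dist _ _)) // (HN n Nn).
have -> : l - ratr (abs (u n)) = (l - ratr (abs (v n))) + (ratr (abs (v n)) - ratr (abs (u n))) by ring.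
by apply: le_lt_trans (ler_normD _ _) _; lra.
Unshelve. all: by end_near. Qed.

Lemma Qp_norm_lim (u : cauchy_seq p) (l : R) :
  (ratr (abs (u n)) : R) @[n --> \oo] --> l -> \| pi u | = l.
Proof.
move=> h; rewrite -(cvg_lim (@Rhausdorff R) (@Qp_norm_cvg u)).
exact: (cvg_lim (@Rhausdorff R) h).
Qed.

Lemma Qp_piM (u v : cauchy_seq p) : pi u * pi v = pi (u * v).
Proof. by rewrite rmorphM. Qed.

Lemma Qp_piD (u v : cauchy_seq p) : pi u + pi v = pi (u + v).
Proof. by rewrite rmorphD. Qed.

Lemma Qp_piN (u : cauchy_seq p) : - pi u = pi (- u).
Proof. by rewrite rmorphN. Qed.

Lemma Qp_pi_surj (x : Qp p) : exists u : cauchy_seq p, x = pi u.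
Proof. by exists (repr x); rewrite reprK. Qed.

Lemma Qp_norm_ge0 (x : Qp p) : 0 <= \| x |.
Proof.
have [u ->] := Qp_pi_surj x; rewrite -(cvg_lim _ (@Qp_norm_cvg u)) //.
apply: limr_ge; first exact: padic_abs_cvg.
by near=> n; rewrite ler0q padic_abs_ge0.
Unshelve. all: by end_near. Qed.

Lemma Qp_normM (x y : Qp p) : \| x * y | = \| x | * \| y |.
Proof.
have [u ->] := Qp_pi_surj x; have [v ->] := Qp_pi_surj y.
rewrite Qp_piM; apply: Qp_norm_lim.
rewrite (_ : (fun n => _) = (fun n => ratr (abs (u n)) * ratr (abs (v n)))).
  by apply: cvgM; exact: Qp_norm_cvg.
by apply/funext => n; rewrite -rmorphM -padic_absM.
Qed.

Lemma Qp_norm_iota_def (q : rat) : (fun _ : nat => q) \in cauchy_pred p.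
Proof. by apply: asboolT => e e0; exists 0%N => m n _ _; rewrite subrr padic_abs0. Qed.

Definition Qp_of_rat (q : rat) : Qp p := pi (CauchySeq (Qp_norm_iota_def q)).

Lemma Qp_norm_of_rat q : \| Qp_of_rat q | = ratr (abs q).
Proof.
apply: Qp_norm_lim.
by rewrite (_ : (fun n => _) = cst (ratr (abs q))) //; exact: cvg_cst.
Qed.

Lemma Qp_of_rat0 : Qp_of_rat 0 = 0.
Proof.
rewrite -(@rmorph0 _ _ (\pi_(Qp p)))%qT; apply: Qp_pi_eq => e e0; exists 0%N => n _.
by rewrite -[X in abs X]/(0 - 0 : rat) subrr padic_abs0.
Qed.

Lemma Qp_of_rat1 : Qp_of_rat 1 = 1.
Proof.
rewrite -(@rmorph1 _ _ (\pi_(Qp p)))%qT; apply: Qp_pi_eq => e e0; exists 0%N => n _.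
by rewrite -[X in abs X]/(1 - 1 : rat) subrr padic_abs0.
Qed.

Lemma Qp_of_ratB q r : Qp_of_rat (q - r) = Qp_of_rat q - Qp_of_rat r.
Proof.
rewrite /Qp_of_rat -rmorphB; apply: Qp_pi_eq => e e0; exists 0%N => n _.
by rewrite -[X in abs X]/((q - r) - (q - r) : rat) subrr padic_abs0.
Qed.

Lemma Qp_norm0 : \| 0 | = 0.
Proof. by rewrite -Qp_of_rat0 Qp_norm_of_rat padic_abs0 rmorph0. Qed.

Lemma Qp_norm1 : \| 1 | = 1.
Proof. by rewrite -Qp_of_rat1 Qp_norm_of_rat padic_abs1 rmorph1. Qed.

Lemma Qp_norm_ultra (x y : Qp p) : \| x + y | <= Num.max \| x | \| y |.
Proof.
have [u ->] := Qp_pi_surj x; have [v ->] := Qp_pi_surj y; rewrite Qp_piD.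
rewrite leNgt; apply/negP; rewrite gt_max => /andP[h1 h2].
set l := \| pi (u + v) | in h1 h2; pose e1 := l - \| pi u |; pose e2 := l - \| pi v |.
pose e := Num.min e1 e2; have e0 : 0 < e by rewrite lt_min /e1 /e2 !subr_gt0 h1.
have e20 : 0 < e / 2 by rewrite divr_gt0.
have /cvgrPdist_lt/(_ _ e20) cu := @Qp_norm_cvg u.
have /cvgrPdist_lt/(_ _ e20) cv := @Qp_norm_cvg v.
have /cvgrPdist_lt/(_ _ e20) cuv := @Qp_norm_cvg (u + v).
have ee1 : e <= e1 by rewrite ge_min lexx.
have ee2 : e <= e2 by rewrite ge_min lexx orbT.
near \oo => n.
have : `|\|pi u| - ratr (abs (u n))| < e / 2 by near: n.
have : `|\|pi v| - ratr (abs (v n))| < e / 2 by near: n.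
have : `|l - ratr (abs ((u + v) n))| < e / 2 by near: n.
rewrite !ltr_norml => /andP[_ a1] /andP[a2 _] /andP[a3 _].
have a4 := padic_abs_ultra p (u n) (v n).
have {a4} : (ratr (abs ((u + v) n)) : R) <= ratr (Num.max (abs (u n)) (abs (v n))).
  by rewrite ler_rat.
rewrite /e1 /e2 in ee1 ee2; rewrite maxEle; case: ifP => _; lra.
Unshelve. all: by end_near. Qed.

Lemma Qp_normN (x : Qp p) : \| - x | = \| x |.
Proof.
have [u ->] := Qp_pi_surj x; rewrite Qp_piN; apply: Qp_norm_lim.
rewrite (_ : (fun n => _) = (fun n => ratr (abs (u n)))); first exact: Qp_norm_cvg.
by apply/funext => n; rewrite -[in RHS]padic_absN.
Qed.

Lemma Qp_norm_ultraB (x y : Qp p) : \| x - y | <= Num.max \| x | \| y |.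
Proof. by rewrite -(Qp_normN y) Qp_norm_ultra. Qed.

(** A late term of a representing Cauchy sequence is close to the whole
    sequence. *)
Lemma Qp_dense (x : Qp p) (e : R) : 0 < e -> exists q, \| x - Qp_of_rat q | < e.
Proof.
move=> e0; have [u ->] := Qp_pi_surj x.
have e20 : 0 < e / 2 by rewrite divr_gt0.
have [d d0 de] := ratr_lt_pos e20.
have [N HN] := asboolW (valP u) _ d0; exists (u N).
rewrite /Qp_of_rat -rmorphB -(cvg_lim _ (@Qp_norm_cvg _)) //.
apply: (@le_lt_trans _ _ (e / 2)); last by lra.
apply: limr_le; first exact: padic_abs_cvg.
near=> n; apply/ltW/(lt_trans _ de); rewrite ltr_rat.
by apply: HN => //; near: n; exact: nbhs_infty_ge.
Unshelve. all: by end_near. Qed.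

Lemma padic_abs_pow (q : rat) : q != 0 -> exists k : int, ratr (abs q) = (p%:R : R) ^ k.
Proof.
move=> q0; rewrite /padic_abs (negbTE q0).
by exists ((logn p `|denq q|)%:Z - (logn p `|numq q|)%:Z); rewrite fmorphXz /= ratr_nat.
Qed.

Lemma Qp_norm_isosceles (x y : Qp p) : \| x - y | < \| y | -> \| x | = \| y |.
Proof.
move=> h; apply/eqP; rewrite eq_le; apply/andP; split.
  rewrite -{1}(subrK y x); apply: le_trans (Qp_norm_ultra _ _) _.
  by rewrite ge_max lexx (ltW h).
rewrite leNgt; apply/negP => h2.
have := Qp_norm_ultraB x (x - y); rewrite opprB addrC subrK.
by rewrite leNgt gt_max h2 h.
Qed.

Lemma Qp_norm_eq0 (x : Qp p) : \| x | = 0 -> x = 0.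
Proof.
have [u ->] := Qp_pi_surj x => h; rewrite -(@rmorph0 _ _ (\pi_(Qp p)))%qT.
apply: Qp_pi_eq; rewrite subr0 => e e0.
have e1 : (0 : R) < ratr e by rewrite ltr0q.
have /cvgrPdist_lt/(_ _ e1) [N _ HN] := @Qp_norm_cvg u.
exists N => n Nn; have := HN n Nn; rewrite h sub0r normrN ger0_norm ?ler0q ?padic_abs_ge0 //.
by rewrite ltr_rat.
Qed.

Lemma Qp_norm_gt0 (x : Qp p) : x != 0 -> 0 < \| x |.
Proof.
move=> x0; rewrite lt_neqAle Qp_norm_ge0 andbT eq_sym.
by apply: contra x0 => /eqP/Qp_norm_eq0 ->.
Qed.

(** A nonzero element has the same norm as any rational number close enough to
    it. *)
Lemma Qp_norm_pow (x : Qp p) : x != 0 -> exists k : int, \| x | = (p%:R : R) ^ k.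
Proof.
move=> x0; have n0 := Qp_norm_gt0 x0; have [q hq] := Qp_dense x n0.
have h : \| Qp_of_rat q | = \| x |.
  by apply: Qp_norm_isosceles; rewrite -Qp_normN opprB.
rewrite -h Qp_norm_of_rat; apply: padic_abs_pow; apply: contraTneq n0 => q0.
by rewrite -h q0 Qp_of_rat0 Qp_norm0 ltxx.
Qed.

Lemma Qp_normV (x : Qp p) : x != 0 -> \| x^-1 | = \| x |^-1.
Proof.
move=> x0; have n0 := Qp_norm_gt0 x0; apply: (@mulfI _ \|x|); first by rewrite gt_eqF.
by rewrite -Qp_normM !divff ?Qp_norm1 // gt_eqF.
Qed.

Lemma Qp_normX (x : Qp p) n : \| x ^+ n | = \| x | ^+ n.
Proof. by elim: n => [|n IH]; rewrite ?Qp_norm1 // !exprS Qp_normM IH. Qed.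

End PadicNorm.

(** * Haar measure of balls and integrals of radial functions *)

Lemma sume_const_ord (R : realType) (n : nat) (x : \bar R) : (0 <= x)%E ->
  (\sum_(i < n) x = (n%:R)%:E * x)%E.
Proof.
move=> x0; elim: n => [|n IH]; first by rewrite big_ord0 mul0e.
by rewrite big_ord_recr /= IH -natr1 EFinD ge0_muleDl ?lee_fin // mul1e.
Qed.

Lemma measurable_max_inv_pow d (T : measurableType d) (R : realType) (D : set T)
    (f : T -> R) (L : R) (s : nat) :
  0 < L -> measurable_fun D f -> measurable_fun D (fun x => (Num.max L (f x)) ^- s).
Proof.
move=> L0 mf; apply: (measurableT_comp (f := fun y : R => (Num.max L y) ^- s)) => //.
apply: nonincreasing_measurable => // x y xy /=.
have pos z : 0 < Num.max L z by rewrite lt_max L0.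
rewrite lef_pV2 ?posrE ?exprn_gt0 // lerXn2r ?nnegrE ?(ltW (pos _)) //.
by rewrite ge_max !le_max lexx xy orbT.
Qed.

Section HaarMeasure.
Variables (R : realType) (p : nat).
Hypothesis pp : prime p.
Local Notation "\| x |" := (@Qp_norm R p x) (at level 0, x at level 99, format "\| x |").
Local Notation P := (p%:R : R).
Local Notation T := (Qp_borel R p).

Let P0 : 0 < P. Proof. by rewrite ltr0n prime_gt0. Qed.
Let P1 : 1 < P. Proof. by rewrite ltr1n prime_gt1. Qed.
Let Pn0 : P != 0. Proof. by rewrite gt_eqF. Qed.

Lemma Qp_norm_lt_pow (x : Qp p) (k : int) : \|x| < P ^ k -> \|x| <= P ^ (k - 1).
Proof.
have [->|x0] := eqVneq x 0; first by rewrite Qp_norm0 => _; rewrite exprz_ge0 // ltW.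
have [j ->] := Qp_norm_pow R x0; rewrite ltr_eXz2l // ler_eXz2l //; lia.
Qed.

Lemma Qp_open_measurable (U : set T) : Qp_open R U -> measurable U.
Proof. exact: sub_sigma_algebra. Qed.

Lemma Qp_ball_le_open (c : Qp p) (r : R) : 0 < r -> Qp_open R [set x | \|x - c| <= r].
Proof.
move=> r0 x /= hx; exists r => // y hy.
have -> : y - c = (y - x) + (x - c) by rewrite addrA subrK.
by apply: le_trans (Qp_norm_ultra _ _ _) _; rewrite ge_max hx ltW.
Qed.

Lemma Qp_ball_lt_open (c : Qp p) (r : R) : Qp_open R [set x | \|x - c| < r].
Proof.
move=> x /= hx; exists r; first exact: le_lt_trans (Qp_norm_ge0 _ _) hx.
move=> y hy; have -> : y - c = (y - x) + (x - c) by rewrite addrA subrK.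
by apply: le_lt_trans (Qp_norm_ultra _ _ _) _; rewrite gt_max hx hy.
Qed.

Lemma Qp_norm_measurable : measurable_fun [set: T] (fun x : T => \|(x : Qp p)|).
Proof.
apply: (measurability _ (RGenInftyO.measurableE R)).
move=> _ [_ [r ->] <-]; rewrite setTI; apply: Qp_open_measurable.
rewrite (_ : _ @^-1` _ = [set x | \|x - 0| < r]); first exact: Qp_ball_lt_open.
by apply/seteqP; split=> x; rewrite /= in_itv /= subr0.
Qed.

Lemma Qp_translate_measurable (c : Qp p) :
  measurable_fun [set: T] (fun x : T => (c + x : Qp p) : T).
Proof.
apply: (@measurability _ _ _ T setT _ (@Qp_open R p) erefl).
move=> _ [U oU <-]; rewrite setTI.
apply: Qp_open_measurable => x /= /oU [e e0 h]; exists e => // y hy; apply: h.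
by rewrite opprD addrACA subrr add0r.
Qed.

Local Notation iota := (@Qp_of_rat p).
Definition Qp_unif : Qp p := iota p%:R.

Lemma padic_abs_nat (n : nat) : n != 0%N -> padic_abs p n%:R = (p%:R ^- logn p n : rat).
Proof.
move=> n0; have := @padic_abs_frac p n 1; rewrite divr1 => -> //.
by rewrite /= logn1 sub0r -exprnN.
Qed.

Lemma Qp_norm_unif : \|Qp_unif| = P^-1.
Proof.
rewrite Qp_norm_of_rat padic_abs_nat ?lognn -?lt0n ?prime_gt0 //.
by rewrite logn_prime // eqxx expr1 fmorphV /= ratr_nat.
Qed.

Lemma Qp_unif_neq0 : Qp_unif != 0.
Proof.
apply: contra_neq (_ : P^-1 != 0) => [E|]; last by rewrite invr_eq0.
by rewrite -Qp_norm_unif E Qp_norm0.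
Qed.

Lemma Qp_norm_unifX (k : int) : \|Qp_unif ^ k| = P ^ (- k).
Proof.
have h n : \|Qp_unif ^+ n| = P ^- n by rewrite Qp_normX Qp_norm_unif exprVn.
case: k => n; first by rewrite -exprnP h exprnN.
rewrite NegzE opprK -exprnN Qp_normV ?expf_neq0 ?Qp_unif_neq0 // h invrK.
by rewrite exprnP.
Qed.

(** Residue classes: a p-integral fraction agrees modulo p with the residue
    of its numerator times the inverse of its denominator. *)
Lemma padic_residue (q : rat) : padic_abs p q <= 1 ->
  exists2 i, (i < p)%N & padic_abs p (q - i%:R) < 1.
Proof.
have p1r : (1 : rat) < p%:R by rewrite ltr1n prime_gt1.
move=> hq; set n := numq q; set d := denq q.
have d0 : d != 0 by rewrite denq_eq0.
have dq : q = n%:Q / d%:Q by rewrite divq_num_den.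
have pd : ~~ (p %| `|d|)%N.
  apply/negP => pd; have pn : ~~ (p %| `|n|)%N.
    apply/negP => pn; have := coprime_num_den q.
    rewrite /coprime => /eqP g1; have : (p %| gcdn `|n| `|d|)%N by rewrite dvdn_gcd pn.
    by rewrite g1 Euclid_dvd1.
  have n0 : n != 0 by apply: contraNneq pn => ->; rewrite dvdn0.
  move: hq; rewrite dq padic_abs_frac // (_ : logn p `|n| = 0%N); last first.
    by apply/eqP; rewrite -leqn0 leqNgt logn_gt0 mem_primes pp absz_gt0 n0.
  have l0 : (0 < logn p `|d|)%N by rewrite logn_gt0 mem_primes pp absz_gt0 d0.
  by rewrite subr0 leNgt -exprnP exprn_egt1 // -lt0n l0.
have [u hu] : exists u : int, (d * u = 1 %[mod p])%Z.
  have : coprimez d p%:Z by rewrite coprimezE /= coprime_sym prime_coprime.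
  move=> /coprimezP[[u v] /= E]; exists u; apply/eqP; rewrite eqz_mod_dvd.
  have -> : d * u - 1 = - v * p%:Z by lia.
  exact: dvdz_mull.
have pz0 : p%:Z != 0 by have := prime_gt0 pp; lia.
pose i := `|((n * u) %% p%:Z)%Z|%N.
have iE : i%:Z = ((n * u) %% p%:Z)%Z by rewrite /i gez0_abs // modz_ge0.
exists i; first by rewrite -ltz_nat iE ltz_mod.
have pdv : (p%:Z %| n - i%:Z * d)%Z.
  rewrite -eqz_mod_dvd iE eq_sym; apply/eqP.
  by rewrite modzMml -mulrA [u * d]mulrC -modzMmr hu modzMmr mulr1.
have -> : q - i%:R = (n - i%:Z * d)%:Q / d%:Q.
  rewrite dq rmorphB rmorphM /= mulrBl mulfK ?intr_eq0 //.
have [->|m0] := eqVneq (n - i%:Z * d) 0; first by rewrite mul0r padic_abs0 ltr01.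
rewrite padic_abs_frac // (_ : logn p `|d| = 0%N); last first.
  by apply/eqP; rewrite -leqn0 leqNgt logn_gt0 mem_primes pp absz_gt0 d0.
have : (0 < logn p `|(n - i%:Z * d)%R|)%N.
  by rewrite logn_gt0 mem_primes pp absz_gt0 m0 -[p]/`|p%:Z|%N -dvdzE.
case: (logn _ _) => // l _; rewrite sub0r -exprnN invf_lt1 ?exprn_egt1 //.
by rewrite exprn_gt0 // (lt_trans ltr01).
Qed.

Definition Qp_ball (k : int) : set T := [set x | \|(x : Qp p)| <= P ^ k].

Lemma Qp_ball_measurable k : measurable (Qp_ball k).
Proof.
apply: Qp_open_measurable; rewrite /Qp_ball.
rewrite (_ : (fun x => _) = [set x : Qp p | \|x - 0| <= P ^ k]).
  by apply: Qp_ball_le_open; rewrite exprz_gt0.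
by apply/funext => x /=; rewrite subr0.
Qed.

Definition Qp_digit (k : int) (i : nat) : Qp p := iota i%:R * Qp_unif ^ (- k).

Definition Qp_coset (c : Qp p) (A : set T) : set T := [set (c + y : Qp p) | y in A].

(** An element of norm at most p^k, scaled to a p-adic integer and
    approximated by a rational number, is congruent modulo p to a digit. *)
Lemma Qp_ball_cosets k :
  Qp_ball k = \big[setU/set0]_(i < p) Qp_coset (Qp_digit k i) (Qp_ball (k - 1)).
Proof.
rewrite -(bigcup_mkord p (fun i => Qp_coset (Qp_digit k i) (Qp_ball (k - 1)))).
have digitE i : \|Qp_digit k i| <= P ^ k.
  rewrite /Qp_digit Qp_normM Qp_norm_unifX opprK Qp_norm_of_rat.
  rewrite ler_piMl ?exprz_ge0 ?(ltW P0) //.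
  case: (eqVneq i 0%N) => [->|i0]; first by rewrite padic_abs0 rmorph0 ler01.
  rewrite padic_abs_nat // -[leRHS](rmorph1 (@ratr R)) ler_rat invf_le1 ?exprn_gt0 ?ltr0n ?prime_gt0 //.
  by rewrite exprn_ege1 // ler1n prime_gt0.
apply/seteqP; split=> x /=; last first.
  move=> [i _ [y hy <-]]; apply: le_trans (Qp_norm_ultra _ _ _) _; rewrite ge_max digitE /=.
  by apply: le_trans hy _; rewrite ler_eXz2l //; lia.
move=> hx; pose y : Qp p := x * Qp_unif ^ k.
have y1 : \|y| <= 1.
  rewrite Qp_normM Qp_norm_unifX -invr_expz ler_pdivrMr ?exprz_gt0 // mul1r.
  exact: hx.
have [q hq] := @Qp_dense R p y 1 ltr01.
have q1 : padic_abs p q <= 1.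
  rewrite -(@ler_rat R) rmorph1 -Qp_norm_of_rat.
  have -> : iota q = y - (y - iota q) by rewrite opprB addrC subrK.
  by apply: le_trans (Qp_norm_ultraB _ _ _) _; rewrite ge_max y1 ltW.
have [i ip hi] := padic_residue q1.
exists i => //; exists (x - Qp_digit k i : Qp p); last by rewrite addrC subrK.
have u0 : Qp_unif ^ k != 0 by rewrite expfz_neq0 // Qp_unif_neq0.
have -> : (x : Qp p) - Qp_digit k i = (y - iota i%:R) * Qp_unif ^ (- k).
  by rewrite mulrBl -invr_expz /y mulfK // /Qp_digit -invr_expz.
have h1 : \|y - iota i%:R| < P ^ (0%:Z).
  have -> : y - iota i%:R = (y - iota q) + iota (q - i%:R) by rewrite Qp_of_ratB addrA subrK.
  apply: le_lt_trans (Qp_norm_ultra _ _ _) _; rewrite expr0z gt_max hq /= Qp_norm_of_rat.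
  by rewrite -[ltRHS](rmorph1 (@ratr R)) ltr_rat.
have := Qp_norm_lt_pow h1; rewrite sub0r => h2.
rewrite /Qp_ball /= Qp_normM Qp_norm_unifX opprK expfzDr // [leRHS]mulrC.
by rewrite ler_wpM2r // exprz_ge0 // ltW.
Qed.

Lemma Qp_cosets_trivIset k :
  trivIset [set: nat] (fun i => if (i < p)%N then
     Qp_coset (Qp_digit k i) (Qp_ball (k - 1)) else set0).
Proof.
apply/trivIsetP => i j _ _ ij; case: ifP => ip; last by rewrite set0I.
case: ifP => jp; last by rewrite setI0.
apply/seteqP; split=> // x [[y hy <-] [z hz E]].
have E2 : Qp_digit k i - Qp_digit k j = (z : Qp p) - y.
  by apply/eqP; rewrite subr_eq addrAC eq_sym subr_eq addrC E addrC.
have : \|Qp_digit k i - Qp_digit k j| <= P ^ (k - 1).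
  by rewrite E2; apply: le_trans (Qp_norm_ultraB _ _ _) _; rewrite ge_max hy hz.
rewrite /Qp_digit -mulrBl Qp_normM Qp_norm_unifX opprK -Qp_of_ratB Qp_norm_of_rat.
suff -> : padic_abs p (i%:R - j%:R) = 1.
  by rewrite rmorph1 mul1r ler_eXz2l //; lia.
wlog ji : i j ip jp ij {E E2 y z hy hz x} / (j < i)%N.
  move=> h; have [ji|] := ltnP j i; first exact: h.
  rewrite leq_eqVlt (negbTE ij) /= => ji.
  by rewrite -padic_absN opprB h // eq_sym.
rewrite -natrB ?(ltnW ji) // padic_abs_nat ?subn_eq0 -?ltnNge //.
rewrite (_ : logn p (i - j) = 0%N) ?expr0 ?invr1 //.
apply/eqP; rewrite -leqn0 leqNgt logn_gt0 mem_primes pp subn_gt0 ji /=.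
by apply/negP => /dvdn_leq; rewrite subn_gt0 ji => /(_ isT); lia.
Qed.

Variable mu : {measure set T -> \bar R}.
Hypothesis hmu : is_haar mu.

(** The ball is a disjoint union of p translates of the next smaller ball. *)
Lemma haar_ball_step k : (mu (Qp_ball k) = P%:E * mu (Qp_ball (k - 1)))%E.
Proof.
pose F i := if (i < p)%N then
     Qp_coset (Qp_digit k i) (Qp_ball (k - 1)) else set0.
have mF i : measurable (F i).
  rewrite /F; case: ifP => // _; have := @Qp_translate_measurable (- Qp_digit k i) measurableT _ (Qp_ball_measurable (k - 1)).
  rewrite setTI; congr measurable; apply/seteqP; split=> x /=.
    by move=> h; exists (- Qp_digit k i + x : Qp p); rewrite // addrA subrr add0r.
  by move=> [y hy <-]; rewrite addKr.
have -> : Qp_ball k = \big[setU/set0]_(i < p) F i.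
  by rewrite Qp_ball_cosets; apply: eq_bigr => i _; rewrite /F ltn_ord.
rewrite measure_bigsetU //; last exact: Qp_cosets_trivIset.
rewrite (eq_bigr (fun=> mu (Qp_ball (k - 1)))); last first.
  by move=> i _; rewrite /F ltn_ord; apply: (hmu.1); exact: Qp_ball_measurable.
by rewrite sume_const_ord.
Qed.

Lemma haar_ball k : mu (Qp_ball k) = (P ^ k)%:E.
Proof.
have h0 : mu (Qp_ball 0) = 1%E by have := hmu.2; rewrite /Qp_ball expr0z.
have hn (n : nat) : mu (Qp_ball n) = (P ^ n%:Z)%:E.
  elim: n => [|n IH]; first by rewrite h0 expr0z.
  rewrite haar_ball_step -addn1 PoszD addrK IH -EFinM.
  by rewrite [in RHS]addrC expfzDr // expr1z.
case: k => n; first exact: hn.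
rewrite NegzE; elim: n.+1 => {n}[|n IH]; first by rewrite oppr0 h0 expr0z.
move: IH; rewrite haar_ball_step (_ : - n%:Z - 1 = - n.+1%:Z); last by lia.
move=> E; have -> : - n.+1%:Z = - n%:Z + -1 by lia.
have -> : - n%:Z + -1 = - n.+1%:Z by lia.
have -> : (P ^ (- n.+1%:Z))%:E = ((P^-1)%:E * (P ^ (- n%:Z))%:E)%E.
  by rewrite -EFinM (_ : - n.+1%:Z = -1 + - n%:Z) ?expfzDr // ?exprN1 //; lia.
by rewrite -E muleA -EFinM mulVf // mul1e.
Qed.

Lemma Qp_exhaust (x : T) : exists k : nat, Qp_ball k x.
Proof.
have [->|x0] := eqVneq (x : Qp p) 0.
  by exists 0%N; rewrite /Qp_ball /= Qp_norm0 expr0z.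
have [k hk] := Qp_norm_pow R x0; exists `|k|%N.
by rewrite /Qp_ball /= hk ler_eXz2l //; lia.
Qed.

Lemma haar_sigma_finite : sigma_finite [set: T] mu.
Proof.
exists (fun k : nat => Qp_ball k).
  by apply/esym/seteqP; split=> // x _; have [k hk] := Qp_exhaust x; exists k.
move=> k; split; first exact: Qp_ball_measurable.
by rewrite haar_ball ltry.
Qed.

Lemma eseries_EFin_lim (G : nat -> R) (l : R) :
  series G n @[n --> \oo] --> l -> \big[+%E/0%E]_(0 <= i <oo) (G i)%:E = l%:E.
Proof.
move=> h; apply/cvg_lim => //.
rewrite (_ : (fun n => _) = EFin \o series G).
  exact: (cvg_comp _ _ h).
by apply/funext => n; rewrite /= sumEFin.
Qed.

(** The integral of max(1, |x|)^-s over Q_p, with the geometric series over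
    the spheres of radius p, p^2, and so on summed up. *)
Definition radial_const (s : nat) : R := 1 + (1 - P^-1) * (P * P ^- s) / (1 - P * P ^- s).

(** Decompose the space into the ball of radius p^k and the spheres around it;
    the integrand is constant on each piece, and the volumes are p^k and
    p^(k+j+1) - p^(k+j). *)
Lemma integral_radial (s : nat) (k : int) : (1 < s)%N ->
  (\int[mu]_x ((Num.max (P ^ k) \|(x : Qp p)|) ^- s)%:E
    = (P ^ k * (P ^ k) ^- s * radial_const s)%:E)%E.
Proof.
move=> s1; pose L := P ^ k; have L0 : 0 < L by rewrite exprz_gt0.
pose F (i : nat) : set T := if i is j.+1 then Qp_ball (k + j.+1%:Z) `\` Qp_ball (k + j%:Z) else Qp_ball k.
pose r := P * P ^- s.
have r0 : 0 < r by rewrite mulr_gt0 // invr_gt0 exprn_gt0.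
have r1 : r < 1.
  rewrite /r; case: s s1 {r r0} => [//|[//|s]] _.
  rewrite exprSr invfM mulrA mulrAC divff // mul1r invf_lt1 ?exprn_gt0 //.
  by rewrite exprn_egt1.
have subB i j : i <= j -> Qp_ball i `<=` Qp_ball j.
  by move=> ij x hx; apply: le_trans hx _; rewrite ler_eXz2l.
have mF i : measurable (F i).
  by case: i => [|j] /=; [|apply: measurableD]; exact: Qp_ball_measurable.
have FB i : F i `<=` Qp_ball (k + i%:Z).
  by case: i => [|j] /=; [rewrite addr0|apply: subDsetl].
have tF : trivIset [set: nat] F.
  apply: ltn_trivIset => j i ij; apply/seteqP; split=> // x [Fi Fj].
  case: j ij Fj => [//|j] ij /= [_]; apply.
  by apply: subB (FB i x Fi); rewrite lerD2l lez_nat -ltnS.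
have UF : \bigcup_i F i = [set: T].
  apply/seteqP; split=> // x _.
  have [n hn] : exists n : nat, Qp_ball (k + n%:Z) x.
    have [m hm] := Qp_exhaust x; exists (`|k| + m)%N; apply: subB hm; lia.
  elim: n hn => [|n IH] hn; first by exists 0%N; rewrite //= -[k]addr0.
  have [/IH //|hx] := pselect (Qp_ball (k + n%:Z) x).
  by exists n.+1.
have mf : measurable_fun [set: T] (fun x : T => ((Num.max L \|(x : Qp p)|) ^- s)%:E : \bar R).
  apply/measurable_EFinP; apply: measurable_max_inv_pow => //.
  exact: Qp_norm_measurable.
have f0 (x : T) : (0 <= ((Num.max L \|(x : Qp p)|) ^- s)%:E)%E.
  by rewrite lee_fin invr_ge0 exprn_ge0 // le_max ltW.
rewrite -UF ge0_integral_bigcup //; last by rewrite UF.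
pose G (i : nat) : R := if i is j.+1 then L * L ^- s * (1 - P^-1) * r ^+ j.+1 else L * L ^- s.
rewrite (eq_eseriesr (g := fun i => (G i)%:E)); last first.
  have cst_int (i : nat) (c : R) : (forall x, F i x -> Num.max L \|(x : Qp p)| = c) ->
      (\int[mu]_(x in F i) ((Num.max L \|(x : Qp p)|) ^- s)%:E = (c ^- s)%:E * mu (F i))%E.
    move=> hc; rewrite -integral_cst //; apply: eq_integral => x /set_mem hx.
    by rewrite hc.
  case=> [|j] _ /=.
    rewrite (@cst_int 0%N L); last by move=> x hx; apply/max_idPl.
    by rewrite /= haar_ball -EFinM -/L mulrC.
  rewrite (@cst_int j.+1 (L * P ^+ j.+1)); last first.
    move=> x /= [h1 h2].
    have h3 : P ^ (k + j%:Z) < \|(x : Qp p)| by rewrite ltNge; apply/negP.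
    have -> : \|(x : Qp p)| = L * P ^+ j.+1.
      apply/eqP; rewrite eq_le; apply/andP; split.
        by move: h1; rewrite /Qp_ball /= expfzDr.
      rewrite leNgt; apply/negP => h4.
      have : \|(x : Qp p)| < P ^ (k + j.+1%:Z) by rewrite expfzDr.
      move/Qp_norm_lt_pow; rewrite (_ : k + j.+1%:Z - 1 = k + j%:Z); last by lia.
      by rewrite leNgt h3.
    apply/max_idPr; rewrite ler_peMr ?(ltW L0) // exprn_ege1 // (ltW P1) //.
  have fin : (mu (Qp_ball (k + j.+1%:Z)) < +oo)%E by rewrite haar_ball ltry.
  have -> : mu (F j.+1) = (mu (Qp_ball (k + j.+1%:Z)) - mu (Qp_ball (k + j%:Z)))%E.
    transitivity (mu (Qp_ball (k + j.+1%:Z)) - mu (Qp_ball (k + j.+1%:Z) `&` Qp_ball (k + j%:Z)))%E.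
      by apply: measureD => //; exact: Qp_ball_measurable.
    by rewrite setIidr //; apply: subB; lia.
  rewrite !haar_ball -EFinB -EFinM; congr (_%:E).
  rewrite !expfzDr // -/L -!exprnP /G /r exprMn exprMn invfM exprVn.
  rewrite -!exprM [(s * _)%N]mulnC; set Q := P ^+ (_ * s).
  have Q0 : Q != 0 by rewrite expf_neq0.
  have Ls0 : L ^+ s != 0 by rewrite expf_neq0 // gt_eqF.
  by rewrite !exprS; field; rewrite Pn0 Q0 Ls0.
apply: eseries_EFin_lim.
pose Gg := geometric (L * L ^- s * (1 - P^-1) * r) r.
have cg : series Gg n @[n --> \oo] --> L * L ^- s * (1 - P^-1) * r / (1 - r).
  by apply: cvg_geometric_series; rewrite ger0_norm ?ltW.
rewrite -(cvg_shiftS (series G)) (_ : (fun n => _) = (fun n => L * L ^- s + series Gg n)).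
  have -> : L * L ^- s * radial_const s = L * L ^- s + L * L ^- s * (1 - P^-1) * r / (1 - r).
    by rewrite /radial_const -/r mulrDr mulr1 !mulrA.
  by apply: cvgD => //; exact: cvg_cst.
apply/funext => n; rewrite /series /= big_nat_recl //; congr (_ + _).
by apply: eq_bigr => i _; rewrite /Gg /geometric /= exprS mulrA.
Qed.

Lemma radial_const2 : radial_const 2 = 1 + P^-1.
Proof.
rewrite /radial_const; have -> : P * P ^- 2 = P^-1 by rewrite expr2; field.
by rewrite mulrAC divff ?mul1r // subr_eq0 eq_sym invr_eq1 gt_eqF.
Qed.

Lemma radial_const3 : radial_const 3 * (1 + P^-1) = 1 + P^-1 + P ^- 2.
Proof.
rewrite /radial_const; have -> : P * P ^- 3 = P ^- 2 by rewrite !exprS; field.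
rewrite !exprS expr0; field.
have : 1 < P * P by rewrite -expr2 exprn_egt1.
by move=> h; rewrite Pn0 /=; lra.
Qed.

End HaarMeasure.

(** * The p-adic densities *)

(** An alias that carries the hypotheses, so that inference finds the
    sigma-finiteness needed for Tonelli. *)
Definition haar_measure (R : realType) (p : nat) (mu : {measure set (Qp_borel R p) -> \bar R})
  (pp : prime p) (hmu : is_haar mu) : set (Qp_borel R p) -> \bar R := mu.

Section HaarSigmaFinite.
Variables (R : realType) (p : nat) (mu : {measure set (Qp_borel R p) -> \bar R}).
Variables (pp : prime p) (hmu : is_haar mu).

HB.instance Definition _ := measure_function.Measure.copy (haar_measure pp hmu) mu.
HB.instance Definition _ :=
  Measure_isSigmaFinite.Build _ _ _ (haar_measure pp hmu) (haar_sigma_finite pp hmu).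

End HaarSigmaFinite.

Section PadicDensity.
Variables (R : realType) (p : nat).
Hypothesis pp : prime p.
Local Notation "\| x |" := (@Qp_norm R p x) (at level 0, x at level 99, format "\| x |").
Local Notation P := (p%:R : R).
Local Notation T := (Qp_borel R p).
Variable mu : {measure set T -> \bar R}.
Hypothesis hmu : is_haar mu.

Let P0 : 0 < P. Proof. by rewrite ltr0n prime_gt0. Qed.

(** Integrate against the image of the measure under the translation, which is
    the measure itself. *)
Lemma haar_integral_translate (f : T -> \bar R) (c : Qp p) :
  measurable_fun [set: T] f -> (forall x, 0 <= f x)%E ->
  (\int[mu]_x f (c + (x : Qp p))%R = \int[mu]_x f x)%E.
Proof.
move=> mf f0; have mc := @Qp_translate_measurable R p c.
rewrite -[LHS](@ge0_integral_pushforward _ _ T T R _ mc mu setT f) //.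
apply: eq_measure_integral => A mA _; rewrite /pushforward /=.
rewrite -(hmu.1 (- c) A mA); congr (mu _); apply/seteqP; split=> x /=.
  by move=> h; exists (c + (x : Qp p)) => //; rewrite addKr.
by move=> [y hy <-]; rewrite addNKr.
Qed.

Lemma measurable_ge0_sublevel d (X : measurableType d) (g : X -> R) :
  (forall x, 0 <= g x) -> (forall r, 0 < r -> measurable [set x | g x < r]) ->
  measurable_fun [set: X] g.
Proof.
move=> g0 mg; apply: (measurability _ (RGenInftyO.measurableE R)).
move=> _ [_ [r ->] <-]; rewrite setTI.
have -> : g @^-1` `]-oo, r[ = [set x | g x < r].
  by apply/seteqP; split=> x; rewrite /= in_itv.
have [r0|r0] := ltP 0 r; first exact: mg.
rewrite (_ : [set _ | _] = set0) //; apply/seteqP; split=> // x /=.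
by rewrite ltNge (le_trans r0).
Qed.

Lemma Qp_mul_ball_measurable (a c : Qp p) (r : R) : 0 < r ->
  measurable ([set d | \|a * d - c| < r] : set T).
Proof.
move=> r0; apply: Qp_open_measurable => x /= hx.
exists (r / (\|a| + 1)); first by rewrite divr_gt0 // ltr_wpDl // Qp_norm_ge0.
move=> y hy; have -> : a * y - c = a * (y - x) + (a * x - c) by ring.
apply: le_lt_trans (Qp_norm_ultra _ _ _) _; rewrite gt_max hx andbT Qp_normM.
have a0 := Qp_norm_ge0 R a.
apply: le_lt_trans (ler_wpM2r (Qp_norm_ge0 _ _) (_ : _ <= \|a| + 1)) _; first by rewrite lerDl.
by rewrite mulrC -ltr_pdivlMr // ltr_wpDl.
Qed.

Lemma Qp_cube_ball_measurable (c : Qp p) (r : R) : 0 < r ->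
  measurable ([set z | \|z ^+ 3 - c| < r] : set T).
Proof.
move=> r0; apply: Qp_open_measurable => x /= hx.
pose m := Num.max 1 \|x|; have m1 : 1 <= m by rewrite le_max lexx.
have m0 : 0 < m by exact: lt_le_trans m1.
have m20 : 0 < m ^+ 2 by rewrite exprn_gt0.
exists (Num.min 1 (r / m ^+ 2)); first by rewrite lt_min ltr01 divr_gt0.
move=> y; rewrite lt_min => /andP[h1 h2].
have hxm : \|x| <= m by rewrite le_max lexx orbT.
have hym : \|y| <= m.
  rewrite -(subrK x y); apply: le_trans (Qp_norm_ultra _ _ _) _.
  by rewrite ge_max hxm (le_trans (ltW h1) m1).
have -> : y ^+ 3 - c = (y - x) * (y ^+ 2 + (x * y + x ^+ 2)) + (x ^+ 3 - c) by ring.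
apply: le_lt_trans (Qp_norm_ultra _ _ _) _; rewrite gt_max hx andbT Qp_normM.
apply: le_lt_trans (ler_wpM2l (Qp_norm_ge0 _ _) (_ : _ <= m ^+ 2)) _; last first.
  by rewrite -ltr_pdivlMr.
have x0 := Qp_norm_ge0 R x; have y0 := Qp_norm_ge0 R y.
apply: le_trans (Qp_norm_ultra _ _ _) _; rewrite ge_max Qp_normX.
rewrite (lerXn2r 2) ?nnegrE // ?(ltW m0) //=.
apply: le_trans (Qp_norm_ultra _ _ _) _; rewrite ge_max Qp_normX Qp_normM.
by rewrite (lerXn2r 2) ?nnegrE // ?(ltW m0) // andbT expr2 ler_pM.
Qed.

(** By the ultrametric inequality, |a d - z^3| < r holds iff both terms are
    closer than r to a common rational number, and there are countably many. *)
Lemma Qp_cubic_measurable (a : Qp p) :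
  measurable_fun [set: T * T] (fun w : T * T => \|a * (w.1 : Qp p) - (w.2 : Qp p) ^+ 3|).
Proof.
apply: measurable_ge0_sublevel => [w|r r0]; first exact: Qp_norm_ge0.
rewrite (_ : [set _ | _] = \bigcup_(q : rat)
    ([set d | \|a * d - Qp_of_rat p q| < r] `*` [set z | \|z ^+ 3 - Qp_of_rat p q| < r])).
  apply: countable_bigcupT_measurable => [|q]; first exact: countableP.
  by apply: measurableX; [exact: Qp_mul_ball_measurable|exact: Qp_cube_ball_measurable].
apply/seteqP; split=> -[d z] /=.
  move=> h; have [q hq] := Qp_dense (a * d) r0; exists q => //=; split=> //.
  have -> : z ^+ 3 - Qp_of_rat p q = - (a * d - z ^+ 3) + (a * d - Qp_of_rat p q) by ring.
  by apply: le_lt_trans (Qp_norm_ultra _ _ _) _; rewrite gt_max Qp_normN h.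
move=> [q _ [/= h1 h2]].
have -> : a * d - z ^+ 3 = (a * d - Qp_of_rat p q) - (z ^+ 3 - Qp_of_rat p q) by ring.
by apply: le_lt_trans (Qp_norm_ultraB _ _ _) _; rewrite gt_max h1.
Qed.

Lemma densityE (a d z : Qp p) : density (@Qp_norm R p) a d z =
  (Num.max 1 (Num.max (\|a| ^+ 2) (Num.max \|a * d - z ^+ 3| (Num.max \|d| (\|z| ^+ 2))))) ^- 2.
Proof.
rewrite /density !big_cons big_nil Qp_norm1 !Qp_normX.
rewrite (max_l (exprn_ge0 2 (Qp_norm_ge0 R z))).
by rewrite (maxCA \|_ - _| 1) (maxCA (\|a| ^+ 2) 1).
Qed.

Lemma density_measurable (a : Qp p) :
  measurable_fun [set: T * T] (fun w : T * T => (density (@Qp_norm R p) a (w.1 : Qp p) (w.2 : Qp p))%:E).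
Proof.
apply/measurable_EFinP.
under eq_fun do rewrite densityE.
apply: measurable_max_inv_pow => //.
apply: measurable_maxr; first exact: measurable_cst.
apply: measurable_maxr; first exact: Qp_cubic_measurable.
apply: measurable_maxr.
  by apply: (measurableT_comp (@Qp_norm_measurable R p)).
apply: measurable_funX.
by apply: (measurableT_comp (@Qp_norm_measurable R p)).
Qed.

Lemma density_ge0 (a d z : Qp p) : 0 <= density (@Qp_norm R p) a d z.
Proof. by rewrite densityE invr_ge0 exprn_ge0 // le_max ler01. Qed.

Definition amax (a : Qp p) : R := Num.max 1 \|a|.

Lemma amax_ge1 a : 1 <= amax a. Proof. by rewrite le_max lexx. Qed.

Lemma amax_pow a : exists k : int, amax a = P ^ k.
Proof.
rewrite /amax; have [h|h] := leP \|a| 1; first by exists 0; rewrite expr0z.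
have a0 : a != 0 by apply: contraTneq h => ->; rewrite Qp_norm0 -leNgt ler01.
by have [k ->] := Qp_norm_pow R a0; exists k.
Qed.

Lemma max_small_case (x y u v w : R) : x <= 1 -> y <= Num.max u w ->
  w <= Num.max u y -> v <= Num.max 1 w ->
  Num.max 1 (Num.max x (Num.max y (Num.max u v))) = Num.max 1 (Num.max u w).
Proof.
rewrite !le_max => x1 h1 h2 h3; apply/eqP; rewrite eq_le !ge_max !le_max !lexx x1 !orbT /=.
apply/andP; split; first by rewrite h1 orbT /=; case/orP: h3 => ->; rewrite ?orbT.
by case/orP: h2 => ->; rewrite ?orbT.
Qed.

Lemma max_large_case (x y u v w : R) : 1 <= x -> y <= Num.max u w ->
  w <= Num.max u y -> v <= Num.max x w ->
  Num.max 1 (Num.max x (Num.max u (Num.max y v))) = Num.max x (Num.max u w).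
Proof.
rewrite !le_max => x1 h1 h2 h3; apply/eqP; rewrite eq_le !ge_max !le_max !lexx x1 !orbT /=.
apply/andP; split.
  by case/orP: h1 => ->; case/orP: h3 => ->; rewrite ?orbT.
by case/orP: h2 => ->; rewrite ?orbT.
Qed.

Lemma ler_sqr_cube (t : R) : 0 <= t -> t ^+ 2 <= Num.max 1 (t ^+ 3).
Proof.
move=> t0; rewrite le_max; have [h|h] := leP t 1.
  by rewrite exprn_ile1.
by rewrite [t ^+ 3]exprS ler_peMl ?orbT ?exprn_ge0 // ltW.
Qed.

(** For |a| > 1 the translation d -> d + z^3 / a turns a d - z^3 into a d;
    for |a| <= 1 the term a d is dominated by d. *)
Lemma density_shift (a z : Qp p) : exists c : Qp p, forall d : Qp p,
  density (@Qp_norm R p) a (c + d) z =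
  (Num.max (amax a ^+ 2) (Num.max (amax a * \|d|) (\|z| ^+ 3 / amax a))) ^- 2.
Proof.
have z0 := Qp_norm_ge0 R z; have z30 : 0 <= \|z| ^+ 3 by rewrite exprn_ge0.
have a0 := Qp_norm_ge0 R a; have z23 := ler_sqr_cube z0.
rewrite /amax; have [a1|a1] := leP \|a| 1.
  exists 0 => d; rewrite add0r densityE expr1n mul1r divr1.
  have d0 := Qp_norm_ge0 R d.
  have ad : \|a * d| <= \|d| by rewrite Qp_normM ler_piMl.
  have nu : \|a * d - z ^+ 3| <= Num.max \|d| (\|z| ^+ 3).
    apply: le_trans (Qp_norm_ultraB _ _ _) _; rewrite Qp_normX ge_max !le_max ad lexx.
    by rewrite orbT.
  have zz : \|z| ^+ 3 <= Num.max \|d| \|a * d - z ^+ 3|.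
    have e : z ^+ 3 = a * d - (a * d - z ^+ 3) by ring.
    rewrite -Qp_normX [in leLHS]e; apply: le_trans (Qp_norm_ultraB _ _ _) _.
    by rewrite ge_max !le_max ad lexx orbT.
  have a2 : \|a| ^+ 2 <= 1 by rewrite exprn_ile1.
  by congr (_ ^- 2); exact: max_small_case.
have an0 : a != 0 by apply: contraTneq a1 => ->; rewrite Qp_norm0 -leNgt ler01.
have ap : 0 < \|a| by exact: lt_trans a1.
exists (z ^+ 3 / a) => d; rewrite densityE.
have -> : a * (z ^+ 3 / a + d) - z ^+ 3 = a * d.
  by rewrite mulrDr mulrCA divff // mulr1 addrAC subrr add0r.
rewrite Qp_normM; have d0 := Qp_norm_ge0 R d.
have nz : \|z ^+ 3 / a| = \|z| ^+ 3 / \|a| by rewrite Qp_normM Qp_normX Qp_normV.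
have da : \|d| <= \|a| * \|d| by rewrite ler_peMl // ltW.
have h1 : \|z ^+ 3 / a + d| <= Num.max (\|a| * \|d|) (\|z| ^+ 3 / \|a|).
  apply: le_trans (Qp_norm_ultra _ _ _) _; rewrite nz ge_max !le_max lexx da.
  by rewrite orbT.
have h2 : \|z| ^+ 3 / \|a| <= Num.max (\|a| * \|d|) \|z ^+ 3 / a + d|.
  have e : z ^+ 3 / a = (z ^+ 3 / a + d) - d by ring.
  rewrite -nz [in leLHS]e; apply: le_trans (Qp_norm_ultraB _ _ _) _; rewrite ge_max !le_max lexx da.
  by rewrite orbT.
have h3 : \|z| ^+ 2 <= Num.max (\|a| ^+ 2) (\|z| ^+ 3 / \|a|).
  rewrite le_max; have [h|h] := leP \|z| \|a|; first by rewrite lerXn2r ?nnegrE.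
  rewrite ler_pdivlMr // [\|z| ^+ 3]exprSr ler_wpM2l ?orbT ?exprn_ge0 //.
  exact: ltW.
have h4 : 1 <= \|a| ^+ 2 by rewrite exprn_ege1 // ltW.
by congr (_ ^- 2); exact: max_large_case.
Qed.

(** After the shift the integrand is a radial function of d. *)
Lemma integral_density_d (a z : Qp p) :
  (\int[mu]_d (density (@Qp_norm R p) a (d : Qp p) z)%:E =
   ((1 + P^-1) * (Num.max (amax a) \|z|) ^- 3)%:E)%E.
Proof.
have [c hc] := density_shift a z.
have A1 := amax_ge1 a; have A0 : 0 < amax a by exact: lt_le_trans A1.
have [ka hka] := amax_pow a.
set A := amax a in hc A1 A0 hka *.
pose K := Num.max A (\|z| ^+ 3 / A ^+ 2).
have K0 : 0 < K by rewrite lt_max A0.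
have [k hk] : exists k : int, K = P ^ k.
  rewrite /K; have [h|h] := leP (\|z| ^+ 3 / A ^+ 2) A; first by exists ka.
  have z0 : z != 0.
    by apply: contraTneq h => ->; rewrite Qp_norm0 expr0n /= mul0r -leNgt ltW.
  have [kz hz] := Qp_norm_pow R z0; exists (kz * 3 - ka * 2).
  by rewrite hz hka !exprnP !exprz_exp invr_expz -expfzDr ?gt_eqF.
have KE : A ^+ 2 * K = (Num.max A \|z|) ^+ 3.
  have z0 := Qp_norm_ge0 R z.
  have A2 : 0 < A ^+ 2 by rewrite exprn_gt0.
  have E : A ^+ 2 * (\|z| ^+ 3 / A ^+ 2) = \|z| ^+ 3 by rewrite mulrC divfK // gt_eqF.
  rewrite /K maxr_pMr ?(ltW A2) // E -exprSr.
  have [h|h] := leP \|z| A.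
    by apply/max_idPl; rewrite lerXn2r ?nnegrE ?(ltW A0).
  by apply/max_idPr; rewrite lerXn2r ?nnegrE ?(ltW A0) // ltW.
have mfd : measurable_fun [set: T] (fun d : T => (density (@Qp_norm R p) a (d : Qp p) z)%:E : \bar R).
  have := measurableT_comp (density_measurable a) (measurable_pair2 (T1 := T) (z : T)).
  by [].
rewrite -(haar_integral_translate c mfd); last by move=> x; rewrite lee_fin density_ge0.
under eq_integral => d _.
  rewrite hc.
  have -> : Num.max (A ^+ 2) (Num.max (A * \|(d : Qp p)|) (\|z| ^+ 3 / A)) = A * Num.max K \|(d : Qp p)|.
    rewrite [RHS]maxr_pMr ?(ltW A0) //.
    have -> : A * K = Num.max (A ^+ 2) (\|z| ^+ 3 / A).
      rewrite /K maxr_pMr ?(ltW A0) //; congr (Num.max _ _).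
      by move: (\|z| ^+ 3) => w; field; rewrite gt_eqF.
    by rewrite -maxA [Num.max (\|z| ^+ 3 / A) _]maxC.
  rewrite exprMn invfM EFinM.
  over.
rewrite ge0_integralZl //; last 3 first.
- apply/measurable_EFinP/measurable_max_inv_pow => //; exact: Qp_norm_measurable.
- by move=> x _; rewrite lee_fin invr_ge0 exprn_ge0 // le_max (ltW K0).
- by rewrite lee_fin invr_ge0 exprn_ge0 // ltW.
under eq_integral do rewrite hk.
rewrite (integral_radial pp hmu k (s := 2)) // -hk radial_const2 // -EFinM.
congr (_%:E); rewrite -KE; field.
by rewrite !gt_eqF.
Qed.

(** With d integrated out, the integrals over z and then over a are again
    radial. *)
Lemma omega_pE : omega_p mu = ((1 + P^-1) * (1 + P^-1 + P ^- 2))%:E.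
Proof.
pose m : {sigma_finite_measure set T -> \bar R} := haar_measure pp hmu.
have rm (k : int) L s : (1 < s)%N -> L = P ^ k ->
    (\int[mu]_x ((Num.max L \|(x : Qp p)|) ^- s)%:E = (L * L ^- s * radial_const R p s)%:E)%E.
  by move=> s1 ->; exact: integral_radial.
have mr L s : 0 < L -> measurable_fun [set: T] (fun x : T => ((Num.max L \|(x : Qp p)|) ^- s)%:E : \bar R).
  by move=> L0; apply/measurable_EFinP/measurable_max_inv_pow => //; exact: Qp_norm_measurable.
have P1 : 0 <= 1 + P^-1 by rewrite addr_ge0 // invr_ge0 ltW.
have inner (a : Qp p) : (\int[mu]_d \int[mu]_z (density (@Qp_norm R p) a (d : Qp p) (z : Qp p))%:E
    = ((1 + P^-1) * (amax a ^- 2 * radial_const R p 3))%:E)%E.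
  have A1 := amax_ge1 a; have A0 : 0 < amax a by exact: lt_le_trans A1.
  have [ka hka] := amax_pow a.
  have d0 x : (0 <= (density (@Qp_norm R p) a (x.1 : Qp p) (x.2 : Qp p))%:E)%E.
    by rewrite lee_fin density_ge0.
  transitivity (\int[mu]_z \int[mu]_d (density (@Qp_norm R p) a (d : Qp p) (z : Qp p))%:E)%E.
    exact: (@fubini_tonelli _ _ T T R m m _ (density_measurable a) d0).
  under eq_integral do rewrite integral_density_d EFinM.
  rewrite ge0_integralZl //; last 2 first.
  - exact: mr.
  - by move=> x _; rewrite lee_fin invr_ge0 exprn_ge0 // le_max (ltW A0).
  rewrite (rm ka) // -EFinM; congr (_%:E); congr (_ * (_ * _)).
  by field; rewrite gt_eqF.
rewrite /omega_p; under eq_integral do rewrite inner mulrCA mulrC EFinM.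
have C3 : (1 + P^-1) * radial_const R p 3 = 1 + P^-1 + P ^- 2.
  by rewrite mulrC; exact: radial_const3.
rewrite C3 ge0_integralZl //; last 2 first.
- exact: (mr 1 2%N).
- by move=> x _; rewrite lee_fin invr_ge0 exprn_ge0 // (le_trans ler01) // amax_ge1.
rewrite (rm 0) // ?expr0z // expr1n invr1 !mul1r radial_const2 // -EFinM mulrC.
by [].
Qed.

Lemma local_factor : (1 - P^-1) ^+ 2 * fine (omega_p mu) = (1 - P ^- 2) * (1 - P ^- 3).
Proof. by rewrite omega_pE /= -!exprVn; ring. Qed.

End PadicDensity.

(** The local factors are the Euler factors of 1 / zeta 2 and 1 / zeta 3. *)
Lemma tau_partialE (R : realType) (mu : forall p, {measure set (Qp_borel R p) -> \bar R}) :
  (forall p, prime p -> is_haar (mu p)) ->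
  tau_partial mu n @[n --> \oo] --> fine (omega_infty R) * ((zeta R 2)^-1 * (zeta R 3)^-1).
Proof.
move=> hmu; rewrite /tau_partial; apply: cvgM; first exact: cvg_cst.
rewrite (_ : (fun n => _) = (fun n => (\prod_(0 <= p < n | prime p) (1 - (p%:R ^+ 2)^-1 : R)) *
   \prod_(0 <= p < n | prime p) (1 - (p%:R ^+ 3)^-1 : R))).
  by apply: cvgM; exact: euler_product.
apply/funext => n; rewrite -big_split /=; apply: eq_bigr => p pp.
by rewrite (local_factor pp (hmu p pp)).
Qed.

(** * Scaling and reflection of Lebesgue integrals *)

Section LebesgueTools.
Variable R : realType.
Local Notation mu := (@lebesgue_measure R).

(** The measure A -> k * mu (k^-1 A) agrees with mu on intervals, hence
    everywhere. *)
Lemma ge0_integral_scale (k : R) (f : R -> \bar R) : 0 < k ->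
  measurable_fun [set: R] f -> (forall x, 0 <= f x)%E ->
  (\int[mu]_x f (k * x)%R = (k^-1)%:E * \int[mu]_x f x)%E.
Proof.
move=> k0 mf f0.
have mk : measurable_fun [set: measurableTypeR R] ( *%R k : measurableTypeR R -> measurableTypeR R).
  by apply: measurable_funM; [exact: measurable_cst|exact: measurable_id].
pose nu := measure_function_pushforward__canonical__measure_function_Measure mu mk.
have muE (A : set R) : measurable A -> mu A = mscale (NngNum (ltW k0)) nu A.
  apply: lebesgue_measure_unique => _ [[a b]] _ <-.
  have E : *%R k @^-1` `]a, b] = `]a / k, b / k]%classic.
    by apply/seteqP; split=> x; rewrite /= !in_itv /= ltr_pdivrMr // ler_pdivlMr // mulrC.
  transitivity (k%:E * mu `](a / k)%R, (b / k)%R]%classic)%E; last by rewrite -E.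
  rewrite !lebesgue_measure_itv /= !lte_fin ltr_pM2r ?invr_gt0 //.
  case: ifP => _; last by rewrite mule0.
  by rewrite -EFinD -EFinM -mulrBl mulrC divfK // gt_eqF.
have -> : (\int[mu]_x f x = k%:E * \int[mu]_x f (k * x)%R)%E.
  transitivity (\int[mscale (NngNum (ltW k0)) nu]_x f x)%E.
    by apply: eq_measure_integral => //= A mA _; exact: muE.
  rewrite ge0_integral_mscale //=; congr (_ * _)%E.
  by rewrite ge0_integral_pushforward.
by rewrite muleA -EFinM mulVf ?mul1e // gt_eqF.
Qed.

Lemma ge0_integral_even (f : R -> \bar R) :
  measurable_fun [set: R] f -> (forall x, 0 <= f x)%E -> (forall x, f (- x) = f x) ->
  (\int[mu]_x f x = 2%:E * \int[mu]_(x in `]0%R, +oo[) f x)%E.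
Proof.
move=> mf f0 fe.
have mfD (D : set R) : measurable_fun D f by exact: measurable_funTS.
have -> : [set: R] = `]-oo, 0%R] `|` `]0%R, +oo[.
  apply/seteqP; split=> // x _ /=; rewrite !in_itv /= andbT.
  by case: (leP x 0) => _; [left|right].
rewrite ge0_integral_setU //=; last 2 first.
- exact: mfD.
- by apply/disj_setPRL => x /=; rewrite !in_itv /= andbT => x0; rewrite leNgt x0.
have -> : (\int[mu]_(x in `]-oo, 0%R]) f x = \int[mu]_(x in `]0%R, +oo[) f x)%E.
  under eq_integral do rewrite -fe.
  rewrite -ge0_integration_by_substitution0 //.
  by rewrite -integral_itv_obnd_cbnd.
by rewrite -[2]/(1 + 1) EFinD ge0_muleDl ?lee_fin // mul1e.
Qed.

Lemma measurable_bool_natr d (T : measurableType d) (D : set T) (b : T -> bool) :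
  measurable_fun D b -> measurable_fun D (fun x => (b x)%:R : R).
Proof. by move=> mb; apply: (measurableT_comp (f := fun c : bool => c%:R : R)). Qed.

Lemma measurable_inv_norm d (T : measurableType d) (D : set T) (f : T -> R) :
  measurable_fun D f -> measurable_fun D (fun x => `|f x|^-1).
Proof.
move=> mf.
have -> : (fun x => `|f x|^-1) = (fun y : R => `|y| `^ -1) \o f.
  apply/funext => x /=; have [->|h] := eqVneq (f x) 0.
    by rewrite normr0 invr0 powR0 // oppr_eq0 oner_eq0.
  by rewrite powRN powRr1.
apply: measurableT_comp => //.
exact: (measurableT_comp (measurable_powR (-1)) (@normr_measurable R setT)).
Qed.

Lemma integral_power_interval (t : R) : 0 < t ->
  (\int[mu]_c (`|c| ^+ 3 * (`|c| <= t)%R%:R)%R%:E = (t ^+ 4 / 2)%:E)%E.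
Proof.
move=> t0; rewrite ge0_integral_even; last 3 first.
- apply/measurable_EFinP; apply: measurable_funM.
    by apply: measurable_funX; exact: normr_measurable.
  apply: measurable_bool_natr; apply: measurable_fun_ler; last exact: measurable_cst.
  exact: normr_measurable.
- by move=> x; rewrite lee_fin mulr_ge0 // exprn_ge0.
- by move=> x; rewrite normrN.
pose F (x : R) := x ^+ 4 / 4.
have dF (x : R) : is_derive x 1 F (x ^+ 3).
  rewrite /F; apply: is_derive_eq.
  have E (y : R) : 4^-1 * (y * (y * (y + y) + y * y) + y * (y * y)) = y ^+ 3 by field.
  by rewrite !scaler0 add0r /GRing.scale /= !mulr1 E.
have -> : (\int[mu]_(c in `]0%R, +oo[) (`|c| ^+ 3 * (`|c| <= t)%R%:R)%R%:E =
           \int[mu]_(c in `[0%R, t]) (c ^+ 3)%:E)%E.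
  rewrite -[RHS]integral_itv_obnd_cbnd; last first.
    apply: measurable_funTS; apply/measurable_EFinP; apply: measurable_funX; exact: measurable_id.
  rewrite [LHS]integral_mkcond [RHS]integral_mkcond; apply: eq_integral => x _.
  rewrite !patchE; case: ifPn => [|].
    rewrite mem_setE /= in_itv /= andbT => x0; case: ifPn.
      by rewrite mem_setE /= in_itv /= => /andP[_ xt]; rewrite gtr0_norm // xt mulr1.
    rewrite notin_setE /= in_itv /= x0 /= => /negP xt.
    by rewrite gtr0_norm // (negbTE xt) mulr0.
  rewrite notin_setE /= in_itv /= andbT => /negP x0; rewrite ifF //.
  apply/negbTE; rewrite notin_setE /= in_itv /=; apply/negP.
  by rewrite negb_and x0.
rewrite (@continuous_FTC2 R _ F) //.
- by rewrite /F -EFinB -EFinM; congr (_%:E); field.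
- by apply: continuous_subspaceT => x; exact: exprn_continuous.
- have cF x : {for x, continuous F}.
    by apply/differentiable_continuous/derivable1_diffP; have := dF x; case.
  split=> [x _||]; [by have := dF x; case|exact/cvg_at_right_filter/cF|exact/cvg_at_left_filter/cF].
- by move=> x _; rewrite derive1E; apply: derive_val.
Qed.

End LebesgueTools.

(** * The real density and the box integral *)

Section RealDensity.
Variable R : realType.
Local Notation mu := (@lebesgue_measure R).
Local Notation MR := (measurableTypeR R).

Lemma measurable_integral_last d (X : measurableType d) (h : X -> R -> \bar R) :
  measurable_fun [set: X * MR] (fun w => h w.1 w.2) -> (forall x y, 0 <= h x y)%E ->
  measurable_fun [set: X] (fun x => \int[mu]_y h x y)%E.
Proof.
move=> mh h0.
exact: (@measurable_fun_fubini_tonelli_F _ _ X MR R mu (fun w => h w.1 w.2) mh (fun w => h0 w.1 w.2)).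
Qed.

Lemma fubini_swap (h : R -> R -> \bar R) :
  measurable_fun [set: MR * MR] (fun w => h w.1 w.2) -> (forall x y, 0 <= h x y)%E ->
  (\int[mu]_x \int[mu]_y h x y = \int[mu]_y \int[mu]_x h x y)%E.
Proof.
move=> mh h0.
exact: (@fubini_tonelli _ _ MR MR R mu mu (fun w => h w.1 w.2) mh (fun w => h0 w.1 w.2)).
Qed.

(** The integrand of the box integral, extended by zero to all real arguments
    so that Tonelli applies to integrals over the whole line. *)
Definition box_fun (c a d z : R) : R :=
  `|c|^-1 * [&& `|a| <= 1, `|c| <= 1, `|d| <= 1, `|z| <= 1 & `|a * d - z ^+ 3| <= `|c| ]%:R.

Lemma box_fun_ge0 c a d z : 0 <= box_fun c a d z.
Proof. by rewrite mulr_ge0 // invr_ge0. Qed.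

Lemma measurable_box_fun d (X : measurableType d) (fc fa fd fz : X -> R) :
  measurable_fun [set: X] fc -> measurable_fun [set: X] fa ->
  measurable_fun [set: X] fd -> measurable_fun [set: X] fz ->
  measurable_fun [set: X] (fun x => (box_fun (fc x) (fa x) (fd x) (fz x))%:E).
Proof.
move=> mc ma md mz; apply/measurable_EFinP; apply: measurable_funM.
  exact: measurable_inv_norm.
have mn (f : X -> R) : measurable_fun [set: X] f -> measurable_fun [set: X] (fun x => `|f x|).
  by move=> mf; apply: (measurableT_comp (@normr_measurable R setT)).
apply: measurable_bool_natr.
have m1 (f : X -> R) : measurable_fun [set: X] f -> measurable_fun [set: X] (fun x => `|f x| <= 1).
  by move=> mf; apply: measurable_fun_ler; [exact: mn|exact: measurable_cst].
do !(apply: measurable_and; first exact: m1).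
apply: measurable_fun_ler; last exact: mn.
apply: mn; apply: measurable_funB; first exact: measurable_funM.
exact: measurable_funX.
Qed.

Ltac meas_coord :=
  repeat first [exact: measurable_cst | exact: measurable_id | exact: measurable_snd
   | exact: measurable_fst
   | apply: (measurableT_comp measurable_fst) | apply: (measurableT_comp measurable_snd)
   | apply: measurable_funM | apply: measurable_funX
   | apply: (measurableT_comp (@normr_measurable R setT)) ].

Lemma fubini_rotate (h : R -> R -> R -> R -> \bar R) :
  measurable_fun [set: ((MR * MR) * MR) * MR] (fun w => h w.1.1.1 w.1.1.2 w.1.2 w.2) ->
  (forall c a d z, 0 <= h c a d z)%E ->
  (\int[mu]_a \int[mu]_d \int[mu]_z \int[mu]_c h c a d z =
   \int[mu]_c \int[mu]_a \int[mu]_d \int[mu]_z h c a d z)%E.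
Proof.
move=> mh h0.
have m1 : measurable_fun [set: (MR * MR) * MR] (fun w => \int[mu]_z h w.1.1 w.1.2 w.2 z)%E.
  by apply: (@measurable_integral_last _ _ (fun w z => h w.1.1 w.1.2 w.2 z)).
have m2 : measurable_fun [set: MR * MR] (fun w => \int[mu]_d \int[mu]_z h w.1 w.2 d z)%E.
  apply: (@measurable_integral_last _ _ (fun w d => \int[mu]_z h w.1 w.2 d z)%E) => // w d.
  exact: integral_ge0.
transitivity (\int[mu]_a \int[mu]_d \int[mu]_c \int[mu]_z h c a d z)%E.
  apply: eq_integral => a _; apply: eq_integral => d _.
  apply: (@fubini_swap (fun z c => h c a d z)) => //.
  have mp : measurable_fun [set: MR * MR] (fun w : MR * MR => (((w.2, a), d), w.1)).
    by do !(apply: measurable_fun_pair => //); exact: measurable_cst.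
  exact: (measurableT_comp mh mp).
transitivity (\int[mu]_a \int[mu]_c \int[mu]_d \int[mu]_z h c a d z)%E.
  apply: eq_integral => a _.
  apply: (@fubini_swap (fun d c => \int[mu]_z h c a d z)%E) => [|x y]; last exact: integral_ge0.
  have mp : measurable_fun [set: MR * MR] (fun w : MR * MR => ((w.2, a), w.1)).
    by do !(apply: measurable_fun_pair => //); exact: measurable_cst.
  exact: (measurableT_comp m1 mp).
apply: (@fubini_swap (fun a c => \int[mu]_d \int[mu]_z h c a d z)%E) => [|x y].
  have mp : measurable_fun [set: MR * MR] (fun w : MR * MR => (w.2, w.1)).
    by do !(apply: measurable_fun_pair => //).
  exact: (measurableT_comp m2 mp).
by apply: integral_ge0 => d _; exact: integral_ge0.
Qed.

Lemma box_integralE :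
  box_integral R = (\int[mu]_a \int[mu]_c \int[mu]_d \int[mu]_z (box_fun c a d z)%:E)%E.
Proof.
rewrite /box_integral.
have inE1 (x : R) : (x \in (`[(-1 : R), 1]%classic : set R)) = (`|x| <= 1).
  by rewrite mem_setE in_itv /= ler_norml.
rewrite [LHS]integral_mkcond; apply: eq_integral => a _; rewrite patchE inE1.
case: ifPn => [ha|ha]; last first.
  rewrite integral0_eq // => c _; rewrite integral0_eq // => d _; rewrite integral0_eq // => z _.
  by rewrite /box_fun (negbTE ha) mulr0.
rewrite [LHS]integral_mkcond; apply: eq_integral => c _; rewrite patchE inE1.
case: ifPn => [hc|hc]; last first.
  rewrite integral0_eq // => d _; rewrite integral0_eq // => z _.
  by rewrite /box_fun (negbTE hc) andbF mulr0.
rewrite [LHS]integral_mkcond; apply: eq_integral => d _; rewrite patchE inE1.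
case: ifPn => [hd|hd]; last first.
  rewrite integral0_eq // => z _.
  by rewrite /box_fun (negbTE hd) !andbF mulr0.
rewrite [LHS]integral_mkcond; apply: eq_integral => z _; rewrite patchE in_setI inE1.
rewrite /box_fun ha hc hd /=.
have [->|c0] := eqVneq c 0; first by rewrite normr0 invr0 mul0r; case: ifP.
have -> : (z \in [set z0 | `|(a * d - z0 ^+ 3) / c| <= 1]) = (`|a * d - z ^+ 3| <= `|c|).
  apply/asboolP/idP => /=; by rewrite normrM normfV ler_pdivrMr ?normr_gt0 // mul1r.
by case: ifP; rewrite ?mulr1 ?mulr0.
Qed.

(** For k = |c| the inequality k^2 M <= 1 says that the point scaled with the
    weights 1, 2, 1 of a, d, z lies in the unit box. *)
Lemma densityRE (a d z : R) : exists2 M, 1 <= M &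
  density Num.norm a d z = M ^- 2 /\
  forall k, 0 < k -> (k ^+ 2 * M <= 1) =
   [&& `|k * a| <= 1, k <= 1, `|k ^+ 2 * d| <= 1, `|k * z| <= 1 &
     `|k * a * (k ^+ 2 * d) - (k * z) ^+ 3| <= k].
Proof.
rewrite /density !big_cons big_nil.
set M := Num.max _ _; exists M; first by rewrite /M !le_max normr1 lexx !orbT.
split=> // k k0; have k20 : 0 < k ^+ 2 by rewrite exprn_gt0.
have sq (x : R) : (k ^+ 2 * x ^+ 2 <= 1) = (`|k * x| <= 1).
  by rewrite -exprMn -real_normK ?num_real // expr_le1.
have nrm (x : R) : k ^+ 2 * `|x| = `|k ^+ 2 * x| by rewrite normrM (gtr0_norm k20).
rewrite /M !maxr_pMr ?(ltW k20) // !ge_max mulr0 ler01 andbT normr1 mulr1.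
rewrite -nrm !normrX !real_normK ?num_real // !sq nrm expr_le1 ?(ltW k0) //.
have -> : k * a * (k ^+ 2 * d) - (k * z) ^+ 3 = k * (k ^+ 2 * (a * d - z ^+ 3)) by ring.
have cancel_k (x : R) : (k * x <= k) = (x <= 1) by rewrite -[X in _ <= X]mulr1 ler_pM2l.
have -> : `|k * (k ^+ 2 * (a * d - z ^+ 3))| = k * (k ^+ 2 * `|a * d - z ^+ 3|).
  by rewrite normrM (gtr0_norm k0) -nrm.
rewrite cancel_k.
by do ![case: (_ <= _)].
Qed.

(** The integral of |c|^3 over |c| <= t is t^4 / 2; take t = M^(-1/2). *)
Lemma density_as_integral (a d z : R) :
  ((density Num.norm a d z)%:E =
   2%:E * \int[mu]_c (`|c| ^+ 4 * box_fun c (`|c| * a) (`|c| ^+ 2 * d) (`|c| * z))%:E)%E.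
Proof.
have [M M1 [-> hM]] := densityRE a d z.
have M0 : 0 < M by exact: lt_le_trans M1.
have s0 : 0 < Num.sqrt M by rewrite sqrtr_gt0.
pose t := (Num.sqrt M)^-1; have t0 : 0 < t by rewrite invr_gt0.
have tE k : 0 < k -> (k ^+ 2 * M <= 1) = (k <= t).
  move=> k0; rewrite -{1}(sqr_sqrtr (ltW M0)) -exprMn expr_le1 ?mulr_ge0 ?(ltW k0) ?(ltW s0) //.
  by rewrite -ler_pdivlMr // div1r.
transitivity (2%:E * (t ^+ 4 / 2)%:E)%E.
  rewrite -EFinM; congr (_%:E); rewrite /t.
  have -> : M ^- 2 = (Num.sqrt M) ^- 4 by rewrite (exprM _ 2 2) sqr_sqrtr // ltW.
  by rewrite exprVn; move: (_ ^- 4) => u; field.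
congr (_ * _)%E; rewrite -integral_power_interval //; apply: eq_integral => c _.
congr (_%:E); have [->|c0] := eqVneq c 0.
  by rewrite normr0 !expr0n /= !mul0r.
have k0 : 0 < `|c| by rewrite normr_gt0.
rewrite /box_fun -(tE _ k0) hM //.
have E (u : R) : `|c| ^+ 3 * u = `|c| ^+ 4 * (`|c|^-1 * u).
  by rewrite mulrA (exprSr _ 3) mulfK // gt_eqF.
exact: E.
Qed.

Lemma ge0_integralZ_scale (r k : R) (f : R -> \bar R) : 0 <= r -> 0 < k ->
  measurable_fun [set: R] f -> (forall x, 0 <= f x)%E ->
  (\int[mu]_x (r%:E * f (k * x)%R) = (r / k)%:E * \int[mu]_x f x)%E.
Proof.
move=> r0 k0 mf f0; rewrite ge0_integralZl //.
  by rewrite ge0_integral_scale // muleA EFinM.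
have mk : measurable_fun [set: measurableTypeR R] ( *%R k : measurableTypeR R -> measurableTypeR R).
  by apply: measurable_funM; [exact: measurable_cst|exact: measurable_id].
exact: (measurableT_comp (mf : measurable_fun [set: measurableTypeR R] f) mk).
Qed.

Lemma integral_double (f : MR -> \bar R) : measurable_fun [set: MR] f ->
  (forall x, 0 <= f x)%E -> (\int[mu]_x (2%:E * f x) = 2%:E * \int[mu]_x f x)%E.
Proof. by move=> mf f0; rewrite ge0_integralZl // lee_fin. Qed.

(** Write M^-2 as twice the integral of |c|^3 over |c| <= M^-1/2, and rescale
    a, d, z by |c|, |c|^2, |c|: this exchanges the coordinate c set to 1 in
    the affine density for the fourth variable of the box integral. *)
Lemma omega_inftyE : omega_infty R = (2%:E * box_integral R)%E.
Proof.
pose h c a d z := ((2 * `|c| ^+ 4) * box_fun c (`|c| * a) (`|c| ^+ 2 * d) (`|c| * z))%:E.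
have h0 c a d z : (0 <= h c a d z)%E.
  by rewrite lee_fin mulr_ge0 ?box_fun_ge0 // mulr_ge0 // exprn_ge0.
have mh : measurable_fun [set: ((MR * MR) * MR) * MR] (fun w => h w.1.1.1 w.1.1.2 w.1.2 w.2).
  rewrite /h; under eq_fun do rewrite EFinM.
  have mc : measurable_fun [set: ((MR * MR) * MR) * MR] (fun w : ((MR * MR) * MR) * MR => `|w.1.1.1 : R|).
    meas_coord.
  apply: emeasurable_funM.
    apply/measurable_EFinP; apply: measurable_funM; first exact: measurable_cst.
    exact: measurable_funX.
  by apply: measurable_box_fun; meas_coord.
have b0 c a d z : (0 <= (box_fun c a d z)%:E)%E by rewrite lee_fin box_fun_ge0.
have m1 : measurable_fun [set: (MR * MR) * MR] (fun w => \int[mu]_z (box_fun w.1.1 w.1.2 w.2 z)%:E)%E.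
  apply: (@measurable_integral_last _ _ (fun w z => (box_fun w.1.1 w.1.2 w.2 z)%:E)) => //.
  by apply: measurable_box_fun; meas_coord.
have m2 : measurable_fun [set: MR * MR] (fun w => \int[mu]_d \int[mu]_z (box_fun w.1 w.2 d z)%:E)%E.
  apply: (@measurable_integral_last _ _ (fun w d => \int[mu]_z (box_fun w.1 w.2 d z)%:E)%E) => // w d.
  by apply: integral_ge0 => ? _.
have i1 c a d : (0 <= \int[mu]_z (box_fun c a d z)%:E)%E by apply: integral_ge0 => ? _.
have i2 c a : (0 <= \int[mu]_d \int[mu]_z (box_fun c a d z)%:E)%E by apply: integral_ge0 => ? _.
have i3 c : (0 <= \int[mu]_a \int[mu]_d \int[mu]_z (box_fun c a d z)%:E)%E by apply: integral_ge0 => ? _.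
have mz c a d : measurable_fun [set: MR] (fun z => (box_fun c a d z)%:E).
  by apply: measurable_box_fun; meas_coord.
have md c a : measurable_fun [set: MR] (fun d => \int[mu]_z (box_fun c a d z)%:E)%E.
  apply: (@measurable_integral_last _ _ (fun d z => (box_fun c a d z)%:E)) => //.
  by apply: measurable_box_fun; meas_coord.
have ma c : measurable_fun [set: MR] (fun a => \int[mu]_d \int[mu]_z (box_fun c a d z)%:E)%E.
  apply: (@measurable_integral_last _ _ (fun a d => \int[mu]_z (box_fun c a d z)%:E)%E) => //.
  apply: (@measurable_integral_last _ _ (fun w z => (box_fun c w.1 w.2 z)%:E)) => //.
  by apply: measurable_box_fun; meas_coord.
transitivity (\int[mu]_a \int[mu]_d \int[mu]_z \int[mu]_c h c a d z)%E.
  rewrite /omega_infty; apply: eq_integral => a _; apply: eq_integral => d _.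
  apply: eq_integral => z _; rewrite density_as_integral -ge0_integralZl //.
  - by apply: eq_integral => c _; rewrite /h -EFinM mulrA.
  - under eq_fun do rewrite EFinM; apply: emeasurable_funM.
      by apply/measurable_EFinP; apply: measurable_funX; exact: normr_measurable.
    by apply: measurable_box_fun; meas_coord; exact: (@normr_measurable R setT).
  - by move=> c _; rewrite lee_fin mulr_ge0 ?box_fun_ge0 // exprn_ge0.
transitivity (\int[mu]_c \int[mu]_a \int[mu]_d \int[mu]_z h c a d z)%E.
  exact: (fubini_rotate mh h0).
transitivity (\int[mu]_c (2%:E * \int[mu]_a \int[mu]_d \int[mu]_z (box_fun c a d z)%:E))%E; last first.
  have mc : measurable_fun [set: MR] (fun c => \int[mu]_a \int[mu]_d \int[mu]_z (box_fun c a d z)%:E)%E.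
    exact: (@measurable_integral_last _ _ (fun c a => \int[mu]_d \int[mu]_z (box_fun c a d z)%:E)%E m2 i2).
  rewrite (integral_double mc i3).
  rewrite box_integralE.
  exact: (congr1 (fun t => 2%:E * t)%E (@fubini_swap (fun c a => \int[mu]_d \int[mu]_z (box_fun c a d z)%:E)%E m2 i2)).
apply: eq_integral => c _.
have [->|c0] := eqVneq c 0.
  rewrite integral0_eq; last first.
    move=> a _; rewrite integral0_eq // => d _; rewrite integral0_eq // => z _.
    by rewrite /h normr0 expr0n mulr0 mul0r.
  rewrite integral0_eq ?mule0 // => a _; rewrite integral0_eq // => d _; rewrite integral0_eq // => z _.
  by rewrite /box_fun normr0 invr0 mul0r.
have k0 : 0 < `|c| by rewrite normr_gt0.
rewrite /h; set k := `|c| in k0 *; have k20 : 0 < k ^+ 2 by rewrite exprn_gt0.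
have r1 : 0 <= 2 * k by rewrite mulr_ge0 // ltW.
have r3 : 0 <= 2 * k ^+ 3 by rewrite mulr_ge0 // exprn_ge0 // ltW.
have r4 : 0 <= 2 * k ^+ 4 by rewrite mulr_ge0 // exprn_ge0 // ltW.
have q4 : 2 * k ^+ 4 / k = 2 * k ^+ 3 by rewrite (exprSr _ 3) mulrA mulfK // gt_eqF.
have q3 : 2 * k ^+ 3 / k ^+ 2 = 2 * k by rewrite (exprS _ 2) mulrA mulfK // gt_eqF.
have q1 : 2 * k / k = 2 by rewrite mulfK // gt_eqF.
have e1 a d : (\int[mu]_z ((2 * k ^+ 4) * box_fun c a d (k * z))%:E =
    (2 * k ^+ 3)%:E * \int[mu]_z (box_fun c a d z)%:E)%E.
  under eq_integral do rewrite EFinM.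
  rewrite (@ge0_integralZ_scale _ k (fun z => (box_fun c a d z)%:E) r4 k0 (mz c a d) (b0 c a d)).
  by rewrite q4.
have e2 a : (\int[mu]_d ((2 * k ^+ 3)%:E * \int[mu]_z (box_fun c a (k ^+ 2 * d)%R z)%:E) =
    (2 * k)%:E * \int[mu]_d \int[mu]_z (box_fun c a d z)%:E)%E.
  rewrite (@ge0_integralZ_scale _ (k ^+ 2) (fun d => \int[mu]_z (box_fun c a d z)%:E)%E r3 k20 (md c a) (i1 c a)).
  by rewrite q3.
under eq_integral => a _.
  under eq_integral => d _ do rewrite e1.
  rewrite e2; over.
rewrite (@ge0_integralZ_scale _ k (fun a => \int[mu]_d \int[mu]_z (box_fun c a d z)%:E)%E r1 k0 (ma c) (i2 c)).
by rewrite q1.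
Qed.

End RealDensity.

(** * Section lengths *)

Section SectionLength.
Variable R : realType.
Implicit Types x y n : R.
Local Notation mu := (@lebesgue_measure R).

Definition overlap x y n : R := Num.min (2 * Num.min x y) (Num.max 0 (x + y - n)).

(** For x, y > 0 the interval of all d with |d| <= 1 and |x d - n| <= y has
    length overlap x y |n| / x; ell is this length divided by y. *)
Definition ell x y n : R := overlap x y n / (x * y).

Lemma overlap_ge0 x y n : 0 <= x -> 0 <= y -> 0 <= overlap x y n.
Proof. by move=> x0 y0; rewrite le_min mulr_ge0 ?le_min ?x0 //= le_max lexx. Qed.

Lemma ell_ge0 x y n : 0 <= x -> 0 <= y -> 0 <= ell x y n.
Proof. by move=> x0 y0; rewrite divr_ge0 ?overlap_ge0 // mulr_ge0. Qed.

Lemma overlap_le x y n : overlap x y n <= 2 * Num.min x y.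
Proof. by rewrite ge_min lexx. Qed.

Lemma ell_le_l x y n : 0 < x -> 0 < y -> ell x y n <= 2 / x.
Proof.
move=> x0 y0; rewrite ler_pdivrMr ?mulr_gt0 //.
apply: le_trans (overlap_le _ _ _) _; rewrite mulrA divfK ?gt_eqF //.
by rewrite ler_pM2l // ge_min lexx orbT.
Qed.

Lemma ell_le_r x y n : 0 < x -> 0 < y -> ell x y n <= 2 / y.
Proof.
move=> x0 y0; rewrite ler_pdivrMr ?mulr_gt0 //.
apply: le_trans (overlap_le _ _ _) _; rewrite [x * y]mulrC mulrA divfK ?gt_eqF //.
by rewrite ler_pM2l // ge_min lexx.
Qed.

Lemma overlap_antitone x y n m : n <= m -> overlap x y m <= overlap x y n.
Proof.
move=> nm; rewrite le_min !ge_min lexx /=; apply/orP; right.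
by rewrite ge_max !le_max lexx /= lerB ?orbT.
Qed.

Lemma ell_antitone x y n m : 0 <= x -> 0 <= y -> n <= m -> ell x y m <= ell x y n.
Proof.
by move=> x0 y0 nm; rewrite ler_wpM2r ?overlap_antitone // invr_ge0 mulr_ge0.
Qed.

Lemma ellZ (t : R) x y n : 0 < t -> ell (t * x) (t * y) (t * n) = ell x y n / t.
Proof.
move=> t0; rewrite /ell /overlap.
have -> : Num.min (2 * Num.min (t * x) (t * y)) (Num.max 0 (t * x + t * y - t * n)) =
  t * Num.min (2 * Num.min x y) (Num.max 0 (x + y - n)).
  have e1 : Num.min (t * x) (t * y) = t * Num.min x y by rewrite minr_pMr ?(ltW t0).
  have e2 : Num.max 0 (t * x + t * y - t * n) = t * Num.max 0 (x + y - n).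
    by rewrite maxr_pMr ?(ltW t0) // mulr0; congr (Num.max _ _); ring.
  by rewrite e1 e2 [RHS]minr_pMr ?(ltW t0) // [2 * (t * _)]mulrCA.
have -> : t * x * (t * y) = t * t * (x * y) by ring.
rewrite [in LHS]invfM; move: (Num.min _ _) ((x * y)^-1) => w u.
by field; rewrite gt_eqF.
Qed.

Lemma min_lip (e a b a' b' : R) : `|a - a'| <= e -> `|b - b'| <= e ->
  `|Num.min a b - Num.min a' b'| <= e.
Proof.
rewrite !ler_norml => h1 h2.
by case: (lerP a b) => ?; case: (lerP a' b') => ?; lra.
Qed.

Lemma max_lip (e a b a' b' : R) : `|a - a'| <= e -> `|b - b'| <= e ->
  `|Num.max a b - Num.max a' b'| <= e.
Proof.
rewrite !ler_norml => h1 h2.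
by case: (lerP a b) => ?; case: (lerP a' b') => ?; lra.
Qed.

Lemma min_cases (a b : R) :
  (a <= b /\ Num.min a b = a) \/ (b <= a /\ Num.min a b = b).
Proof. by case: (lerP a b) => [|/ltW] h; [left|right]. Qed.

Lemma max_cases (a b : R) :
  (a <= b /\ Num.max a b = b) \/ (b <= a /\ Num.max a b = a).
Proof. by case: (lerP a b) => [|/ltW] h; [left|right]. Qed.

Lemma overlap_lip x y n x' y' n' : x' <= x -> x - 1 <= x' -> y' <= y -> y - 1 <= y' ->
  n' <= n -> n <= n' + 3 -> `|overlap x' y' n' - overlap x y n| <= 5.
Proof.
move=> h1 h2 h3 h4 h5 h6; rewrite /overlap; apply: min_lip.
  rewrite -mulrBr normrM ger0_norm //.
  have : `|Num.min x' y' - Num.min x y| <= 1 by apply: min_lip; rewrite ler_norml; lra.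
  lra.
by apply: max_lip; rewrite ler_norml; lra.
Qed.

(** On a unit cell the numerator varies by O(1) and the denominator by a
    factor 1 + O(1/x + 1/y). *)
Lemma ell_cell x y n x' y' n' : 2 <= x -> 2 <= y -> x' <= x -> x - 1 <= x' -> y' <= y -> y - 1 <= y' ->
  n' <= n -> n <= n' + 3 -> `|ell x' y' n' - ell x y n| <= 44 / (x * y).
Proof.
move=> x2 y2 h1 h2 h3 h4 h5 h6.
have hl := overlap_lip h1 h2 h3 h4 h5 h6.
have x0 : 0 < x by lra.
have y0 : 0 < y by lra.
have x'0 : x / 2 <= x' by lra.
have y'0 : y / 2 <= y' by lra.
have x'p : 0 < x' by lra.
have y'p : 0 < y' by lra.
have xy0 : 0 < x * y by rewrite mulr_gt0.
have xy'0 : 0 < x' * y' by rewrite mulr_gt0.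
have q : (x' * y')^-1 <= 4 / (x * y).
  rewrite ler_pdivlMr // mulrC ler_pdivrMr //.
  have : x / 2 * (y / 2) <= x' * y' by apply: ler_pM; lra.
  lra.
have -> : ell x' y' n' - ell x y n = (overlap x' y' n' - overlap x y n) / (x' * y') +
   overlap x y n * ((x * y - x' * y') / (x * y)) / (x' * y').
  rewrite /ell; field.
  by rewrite !gt_eqF.
have dp : 0 <= x * y - x' * y' by rewrite subr_ge0 ler_pM // ltW.
have dq : x * y - x' * y' <= x + y.
  have : (x - 1) * (y - 1) <= x' * y' by apply: ler_pM; lra.
  lra.
have ov0 : 0 <= overlap x y n by rewrite overlap_ge0 // ltW.
have ov : overlap x y n * ((x * y - x' * y') / (x * y)) <= 4.
  rewrite mulrA ler_pdivrMr //.
  have m2 : overlap x y n <= 2 * Num.min x y by exact: overlap_le.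
  apply: le_trans (ler_pM ov0 dp m2 dq) _.
  have mx : Num.min x y <= x by rewrite ge_min lexx.
  have my : Num.min x y <= y by rewrite ge_min lexx orbT.
  have m0 : 0 <= Num.min x y by rewrite le_min !ltW.
  nra.
apply: le_trans (ler_normD _ _) _; rewrite !normrM normfV (gtr0_norm xy'0).
have i0 : 0 <= (x' * y')^-1 by rewrite invr_ge0 ltW.
rewrite [X in _ + X](_ : _ = overlap x y n * ((x * y - x' * y') / (x * y)) * (x' * y')^-1); last first.
  by rewrite (ger0_norm ov0) normfV (ger0_norm dp) (gtr0_norm xy0).
rewrite -mulrDl; apply: le_trans (ler_pM _ i0 (lerD hl ov) q) _.
  by rewrite addr_ge0 // mulr_ge0 // divr_ge0 // ltW.
by rewrite mulrA ler_wpM2r ?invr_ge0 ?(ltW xy0) //; lra.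
Qed.

Lemma overlap_section x c n : 0 < x -> 0 < c ->
  Num.max 0 (Num.min x (n + c) - Num.max (- x) (n - c)) = overlap x c `|n|.
Proof.
move=> x0 c0; have maxE (k : R) : Num.max (- x) (k - c) = - Num.min x (c - k).
  by rewrite oppr_min opprB.
have H (k : R) : 0 <= k -> Num.max 0 (Num.min x (k + c) + Num.min x (c - k)) = overlap x c k.
  rewrite /overlap => k0.
  case: (min_cases x c) => -[? ->]; case: (max_cases 0 (x + c - k)) => -[? ->];
  case: (min_cases x (k + c)) => -[? ->]; case: (min_cases x (c - k)) => -[? ->];
  match goal with |- Num.max 0 ?u = Num.min ?v ?w =>
    case: (max_cases 0 u) => -[? ->]; case: (min_cases v w) => -[? ->] end; lra.
rewrite maxE opprK; have [n0|n0] := leP 0 n; first by rewrite ger0_norm // H.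
rewrite ltr0_norm // -H; last by rewrite oppr_ge0 ltW.
by rewrite opprK [- n + c]addrC [c + n]addrC [X in Num.max 0 X = _]addrC.
Qed.

Lemma ge0_integral_box_d (a c z : R) : a != 0 -> c != 0 ->
  (\int[mu]_d (box_fun c a d z)%:E =
   (if [&& `|a| <= 1, `|c| <= 1 & `|z| <= 1] then ell `|a| `|c| (`|z| ^+ 3) else 0)%:E)%E.
Proof.
move=> a0 c0; have ka : 0 < `|a| by rewrite normr_gt0.
have kc : 0 < `|c| by rewrite normr_gt0.
case: ifPn => [/and3P[ha hc hz]|h]; last first.
  rewrite integral0_eq // => d _; rewrite /box_fun.
  case: and5P => [[h1 h2 h3 h4 h5]|_]; last by rewrite mulr0.
  by rewrite h1 h2 h4 in h.
pose n := Num.sg a * z ^+ 3.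
pose lo := Num.max (- `|a|) (n - `|c|) / `|a|; pose hi := Num.min `|a| (n + `|c|) / `|a|.
have nE : `|n| = `|z| ^+ 3 by rewrite normrM normr_sg a0 mul1r normrX.
transitivity (\int[mu]_(d in `[lo, hi]) (cst (`|c|^-1)%:E d))%E.
  rewrite [RHS]integral_mkcond; apply: eq_integral => d _; rewrite patchE mem_setE in_itv /=.
  have -> : (lo <= d <= hi) = (`|d| <= 1) && (`|a * d - z ^+ 3| <= `|c|).
    have -> : `|a * d - z ^+ 3| = `|(`|a| * d - n)|.
      have e : Num.sg a * (a * d - z ^+ 3) = `|a| * d - n by rewrite mulrBr mulrA -normrEsg.
      by rewrite -e normrM normr_sg a0 mul1r.
    rewrite /lo /hi ler_pdivrMr // ler_pdivlMr // ge_max le_min !ler_norml.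
    have e1 : (-1 <= d) = (- `|a| <= d * `|a|) by rewrite -[X in _ = (X <= _)]mulN1r ler_pM2r.
    have e2 : (d <= 1) = (d * `|a| <= `|a|) by rewrite -[X in _ = (_ <= X)]mul1r ler_pM2r.
    have e3 : (- `|c| <= `|a| * d - n) = (n - `|c| <= d * `|a|).
      by rewrite lerBrDr [- _ + _]addrC [d * _]mulrC.
    have e4 : (`|a| * d - n <= `|c|) = (d * `|a| <= n + `|c|).
      by rewrite lerBlDr [n + _]addrC [d * _]mulrC.
    by rewrite e1 e2 e3 e4; do ![case: (_ <= _)].
  by rewrite /box_fun ha hc hz /=; case: ifP; rewrite ?mulr1 ?mulr0.
rewrite integral_cst; last exact: measurable_itv.
have hm : mu `[lo, hi]%classic = (if (lo < hi)%R then (hi - lo)%:E else 0%E).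
  by rewrite lebesgue_measure_itv /= lte_fin; case: ifP.
transitivity ((`|c|^-1)%:E * (if (lo < hi)%R then (hi - lo)%:E else 0))%E; first by rewrite -hm.
rewrite /ell -nE -overlap_section // /lo /hi.
rewrite ltr_pM2r ?invr_gt0 //; set u := Num.max (- _) _; set v := Num.min _ _.
case: ltP => h; last by rewrite mule0 max_l ?mul0r // subr_le0.
rewrite max_r ?subr_ge0 1?ltW // -EFinM; congr (_%:E).
by field; rewrite !gt_eqF.
Qed.

End SectionLength.

(** * Integrals over cells of side 1/K *)

Section CellSums.
Variable R : realType.
Local Notation mu := (@lebesgue_measure R).
Local Notation MR := (measurableTypeR R).

Definition cell (K k : nat) : set R := `]k%:R / K%:R, k.+1%:R / K%:R]%classic.

Lemma integral_cell_cst (K k : nat) (r : R) : (0 < K)%N ->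
  (\int[mu]_(x in cell K k) (r%:E) = (r / K%:R)%:E)%E.
Proof.
move=> K0; have k0 : (0 : R) < K%:R by rewrite ltr0n.
transitivity (\int[mu]_(x in cell K k) (cst r%:E x))%E => //.
rewrite integral_cst; last exact: measurable_itv.
have hm : mu (cell K k) = ((K%:R)^-1)%:E.
  rewrite lebesgue_measure_itv /= lte_fin ltr_pM2r ?invr_gt0 // ltr_nat ltnSn.
  by rewrite -EFinD -mulrBl -natrB // subSnn mul1r.
by rewrite EFinM -hm.
Qed.

Lemma measurable_cell (K k : nat) : measurable (cell K k).
Proof. exact: measurable_itv. Qed.

Lemma lee_addACA (x y a b c d : \bar R) :
  (x <= a + b -> y <= c + d -> x + y <= a + c + (b + d))%E.
Proof. by move=> h1 h2; rewrite addeACA; exact: leeD. Qed.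

Lemma cells_cover (K n : nat) : (0 < K)%N ->
  `]0, n.+1%:R / K%:R]%classic = `]0, n%:R / K%:R]%classic `|` cell K n :> set R.
Proof.
move=> K0; have k0 : (0 : R) < K%:R by rewrite ltr0n.
have n0 : 0 <= n%:R / K%:R :> R by rewrite divr_ge0.
have nn : n%:R / K%:R <= n.+1%:R / K%:R :> R by rewrite ler_pM2r ?invr_gt0 // ler_nat.
apply/seteqP; split=> x /=; rewrite !in_itv /=.
  by move=> /andP[x0 x1]; case: (lerP x (n%:R / K%:R)) => h; [left|right]; rewrite /cell /= ?in_itv /= ?x0 ?x1 ?h.
case=> /andP[x0 x1]; first by rewrite x0 (le_trans x1).
by move: x0 x1; rewrite !bnd_simp => x0 x1; rewrite x1 andbT (le_lt_trans n0).
Qed.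

Lemma cells_integralD (K n : nat) (f : R -> \bar R) : (0 < K)%N ->
  measurable_fun [set: R] f -> (forall x, 0 <= f x)%E ->
  (\int[mu]_(x in `]0%R, (n.+1%:R / K%:R)%R]) f x =
   \int[mu]_(x in `]0%R, (n%:R / K%:R)%R]) f x + \int[mu]_(x in cell K n) f x)%E.
Proof.
move=> K0 mf f0; rewrite cells_cover // ge0_integral_setU //.
- exact: measurable_cell.
- exact: measurable_funTS.
by apply/disj_setPRL => x /=; rewrite !in_itv /= => /andP[]; rewrite bnd_simp => x0 _; rewrite leNgt x0 andbF.
Qed.

Lemma cells_integral_ge (K : nat) (g : R -> \bar R) (F : nat -> R) : (0 < K)%N ->
  measurable_fun [set: R] g -> (forall x, 0 <= g x)%E ->
  (forall k x, (k < K)%N -> cell K k x -> ((F k)%:E <= g x)%E) ->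
  (((\sum_(k < K) F k) / K%:R)%:E <= \int[mu]_(x in `]0%R, 1%R]) g x)%E.
Proof.
move=> K0 mg g0 hF; have k0 : (0 : R) < K%:R by rewrite ltr0n.
suff H n : (n <= K)%N -> (((\sum_(k < n) F k) / K%:R)%:E <=
    \int[mu]_(x in `]0%R, (n%:R / K%:R)%R]) g x)%E.
  by have := H K (leqnn _); rewrite divff ?gt_eqF.
elim: n => [_|n IH nK]; first by rewrite big_ord0 mul0r integral_ge0.
rewrite cells_integralD // big_ord_recr /= mulrDl EFinD.
apply: leeD; first exact: IH (ltnW nK).
apply: (@le_trans _ _ (\int[mu]_(x in cell K n) (Num.max 0 (F n))%:E)%E).
  by rewrite integral_cell_cst // lee_fin ler_pM2r ?invr_gt0 // le_max lexx orbT.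
apply: ge0_le_integral => //=.
- exact: measurable_cell.
- by move=> x _; rewrite lee_fin le_max lexx.
- exact: measurable_funTS.
move=> x xn; have := hF n x nK xn; have := g0 x.
by case: (max_cases 0 (F n)) => -[_ ->].
Qed.

(** The term p, which is integrated exactly, absorbs an unbounded part of g. *)
Lemma cells_integral_le (K : nat) (g p : R -> \bar R) (F : nat -> R) : (0 < K)%N ->
  measurable_fun [set: R] g -> (forall x, 0 <= g x)%E ->
  measurable_fun [set: R] p -> (forall x, 0 <= p x)%E ->
  (forall k, (k < K)%N -> 0 <= F k) ->
  (forall k x, (k < K)%N -> cell K k x -> (g x <= (F k)%:E + p x)%E) ->
  (\int[mu]_(x in `]0%R, 1%R]) g x <=
   ((\sum_(k < K) F k) / K%:R)%:E + \int[mu]_(x in `]0%R, 1%R]) p x)%E.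
Proof.
move=> K0 mg g0 mp p0 F0 hF; have k0 : (0 : R) < K%:R by rewrite ltr0n.
suff H n : (n <= K)%N -> (\int[mu]_(x in `]0%R, (n%:R / K%:R)%R]) g x <=
    ((\sum_(k < n) F k) / K%:R)%:E + \int[mu]_(x in `]0%R, (n%:R / K%:R)%R]) p x)%E.
  by have := H K (leqnn _); rewrite divff ?gt_eqF.
elim: n => [_|n IH nK].
  by rewrite big_ord0 mul0r set_itvoc0 !integral_set0 addr0.
rewrite (cells_integralD n K0 mg g0) (cells_integralD n K0 mp p0) big_ord_recr /= mulrDl EFinD.
apply: lee_addACA; first exact: IH (ltnW nK).
rewrite -(integral_cell_cst n (F n) K0) -ge0_integralD //=.
- apply: ge0_le_integral => //=.
  + exact: measurable_cell.
  + exact: measurable_funTS.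
  + by apply: emeasurable_funD => //; exact: measurable_funTS.
  + by move=> x xn; exact: hF.
- exact: measurable_cell.
- by move=> x _; rewrite lee_fin F0.
- exact: measurable_funTS.
Qed.

End CellSums.

(** * The box integral over the positive octant *)

Section BoxOctant.
Variable R : realType.
Local Notation mu := (@lebesgue_measure R).
Local Notation MR := (measurableTypeR R).

Definition box_slice (a c z : R) : \bar R := (\int[mu]_d (box_fun c a d z)%:E)%E.

Lemma box_slice_ge0 a c z : (0 <= box_slice a c z)%E.
Proof. by apply: integral_ge0 => d _; rewrite lee_fin box_fun_ge0. Qed.

Lemma measurable_box_slice d (X : measurableType d) (fa fc fz : X -> MR) :
  measurable_fun [set: X] fa -> measurable_fun [set: X] fc ->
  measurable_fun [set: X] fz ->
  measurable_fun [set: X] (fun x => box_slice (fa x) (fc x) (fz x)).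
Proof.
move=> ma mc mz.
apply: (@measurable_integral_last R _ X (fun x d => (box_fun (fc x) (fa x) d (fz x))%:E)) => [|x y].
  apply: measurable_box_fun; last 1 first.
  - exact: (measurableT_comp mz measurable_fst).
  - exact: (measurableT_comp mc measurable_fst).
  - exact: (measurableT_comp ma measurable_fst).
  exact: measurable_snd.
by rewrite lee_fin box_fun_ge0.
Qed.

Lemma box_sliceE a c z : 0 < a <= 1 -> 0 < c <= 1 -> 0 < z <= 1 ->
  box_slice a c z = (ell a c (z ^+ 3))%:E.
Proof.
move=> /andP[a0 a1] /andP[c0 c1] /andP[z0 z1].
rewrite /box_slice ge0_integral_box_d ?gt_eqF //.
by rewrite !gtr0_norm // a1 c1 z1.
Qed.

Lemma box_slice0 a c z : ~~ [&& `|a| <= 1, `|c| <= 1 & `|z| <= 1] -> box_slice a c z = 0%E.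
Proof.
move=> h; rewrite /box_slice integral0_eq // => d _; rewrite /box_fun.
case: and5P => [[h1 h2 h3 h4 h5]|_]; last by rewrite mulr0.
by rewrite h1 h2 h4 in h.
Qed.

Lemma box_slice_evenc a c z : box_slice a (- c) z = box_slice a c z.
Proof. by apply: eq_integral => d _; rewrite /box_fun normrN. Qed.

Lemma box_slice_c0 a z : box_slice a 0 z = 0%E.
Proof. by rewrite /box_slice integral0_eq // => d _; rewrite /box_fun normr0 invr0 mul0r. Qed.

Lemma box_slice_evenz a c z : box_slice a c (- z) = box_slice a c z.
Proof.
have [->|c0] := eqVneq c 0; first by rewrite !box_slice_c0.
have [->|a0] := eqVneq a 0.
  apply: eq_integral => d _; rewrite /box_fun !mul0r !sub0r !normrN exprNn.
  by rewrite -signr_odd /= expr1 mulN1r normrN.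
by rewrite /box_slice !ge0_integral_box_d // normrN.
Qed.

Lemma box_slice_evena a c z : box_slice (- a) c z = box_slice a c z.
Proof.
have [->|c0] := eqVneq c 0; first by rewrite !box_slice_c0.
have [->|a0] := eqVneq a 0; first by rewrite oppr0.
by rewrite /box_slice !ge0_integral_box_d ?oppr_eq0 // normrN.
Qed.

Lemma integral_even_unit (f : R -> \bar R) : measurable_fun [set: R] f ->
  (forall x, 0 <= f x)%E -> (forall x, f (- x) = f x) ->
  (forall x, 1 < `|x| -> f x = 0%E) ->
  (\int[mu]_x f x = 2%:E * \int[mu]_(x in `]0%R, 1%R]) f x)%E.
Proof.
move=> mf f0 fe fz; rewrite ge0_integral_even //; congr (_ * _)%E.
rewrite [LHS]integral_mkcond [RHS]integral_mkcond; apply: eq_integral => x _.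
rewrite !patchE !mem_setE !in_itv /= andbT.
have [x0|//] := ltP 0 x; have [//|x1] := leP x 1.
by rewrite fz // gtr0_norm.
Qed.

Lemma measurable_integral_unit d (X : measurableType d) (h : X -> R -> \bar R) :
  measurable_fun [set: X * MR] (fun w => h w.1 w.2) -> (forall x y, 0 <= h x y)%E ->
  measurable_fun [set: X] (fun x => \int[mu]_(y in `]0%R, 1%R]) h x y)%E.
Proof.
move=> mh h0; pose g x (y : MR) := (h x y * (((0 < y) && (y <= 1))%:R)%R%:E)%E.
have -> : (fun x => \int[mu]_(y in `]0%R, 1%R]) h x y)%E = (fun x => \int[mu]_y g x y)%E.
  apply/funext => x; rewrite integral_mkcond; apply: eq_integral => y _.
  by rewrite patchE /g mem_setE in_itv /=; case: ifP; rewrite ?mule1 ?mule0.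
apply: (@measurable_integral_last R _ X g) => [|x y]; last by rewrite mule_ge0 ?lee_fin.
apply: emeasurable_funM => //; apply/measurable_EFinP; apply: measurable_bool_natr.
by apply: measurable_and; [apply: measurable_fun_ltr|apply: measurable_fun_ler].
Qed.

Lemma measurable_slice_z (a c : R) : measurable_fun [set: R] (fun z => box_slice a c z).
Proof. exact: (@measurable_box_slice _ MR (cst a) (cst c) id). Qed.

Definition box_plane (a c : R) : \bar R := (\int[mu]_(z in `]0%R, 1%R]) box_slice a c z)%E.
Definition box_line (a : R) : \bar R := (\int[mu]_(c in `]0%R, 1%R]) box_plane a c)%E.

Lemma box_plane_ge0 a c : (0 <= box_plane a c)%E.
Proof. by apply: integral_ge0 => z _; exact: box_slice_ge0. Qed.

Lemma box_line_ge0 a : (0 <= box_line a)%E.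
Proof. by apply: integral_ge0 => z _; exact: box_plane_ge0. Qed.

Lemma measurable_box_plane2 : measurable_fun [set: MR * MR] (fun w : MR * MR => box_plane w.1 w.2).
Proof.
apply: (measurable_integral_unit (h := fun (w : MR * MR) z => box_slice w.1 w.2 z)) => [|w z].
  apply: (@measurable_box_slice _ _ (fun w : (MR * MR) * MR => w.1.1) (fun w : (MR * MR) * MR => w.1.2) snd) => //.
  - exact: (measurableT_comp measurable_fst measurable_fst).
  - exact: (measurableT_comp measurable_snd measurable_fst).
exact: box_slice_ge0.
Qed.

Lemma measurable_box_plane a : measurable_fun [set: R] (box_plane a).
Proof.
have mp : measurable_fun [set: MR] (fun c : MR => (a : MR, c)).
  by apply: measurable_fun_pair => //; exact: measurable_cst.
exact: (measurableT_comp measurable_box_plane2 mp).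
Qed.

Lemma measurable_box_line : measurable_fun [set: R] box_line.
Proof.
apply: (measurable_integral_unit (h := fun (a : MR) c => box_plane a c)) => [|a c].
  exact: measurable_box_plane2.
exact: box_plane_ge0.
Qed.

(** After integration over d the integrand is even in each of a, c and z. *)
Lemma box_integral_octant :
  box_integral R = (8%:E * \int[mu]_(a in `]0%R, 1%R]) box_line a)%E.
Proof.
have z1 a c : (\int[mu]_z box_slice a c z = 2%:E * box_plane a c)%E.
  apply: (integral_even_unit (measurable_slice_z a c)) => [x|x|x x1].
  - exact: box_slice_ge0.
  - exact: box_slice_evenz.
  - by rewrite box_slice0 // !negb_and -(ltNge 1 `|x|) x1 !orbT.
have z2 a : (\int[mu]_c box_plane a c = 2%:E * box_line a)%E.
  apply: (integral_even_unit (measurable_box_plane a) (box_plane_ge0 a)) => [x|x x1].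
    by apply: eq_integral => z _; exact: box_slice_evenc.
  rewrite /box_plane integral0_eq // => z _.
  by rewrite box_slice0 // !negb_and -(ltNge 1 `|x|) x1 !orbT.
have z3 : (\int[mu]_a box_line a = 2%:E * \int[mu]_(a in `]0%R, 1%R]) box_line a)%E.
  apply: (integral_even_unit measurable_box_line box_line_ge0) => [x|x x1].
    apply: eq_integral => c _; apply: eq_integral => z _.
    exact: box_slice_evena.
  rewrite /box_line integral0_eq // => c _; rewrite /box_plane integral0_eq // => z _.
  by rewrite box_slice0 // !negb_and -(ltNge 1 `|x|) x1.
have -> : (8%:E = 2%:E * (2%:E * 2%:E) :> \bar R)%E by rewrite -!EFinM; congr (_%:E); ring.
rewrite box_integralE.
transitivity (\int[mu]_a ((2 * 2 : R)%:E * box_line a))%E; last first.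
  rewrite (ge0_integralZl mu measurableT measurable_box_line (fun x _ => box_line_ge0 x)) ?lee_fin // z3 -!EFinM !muleA -!EFinM; congr (_%:E * _)%E; ring.
apply: eq_integral => a _.
transitivity (\int[mu]_c (2%:E * box_plane a c))%E; last first.
  rewrite (integral_double (measurable_box_plane a) (box_plane_ge0 a)) z2 muleA -EFinM; exact: erefl.
apply: eq_integral => c _; rewrite -z1.
apply: (@fubini_swap R (fun d z => (box_fun c a d z)%:E)) => [|d z].
  by apply: measurable_box_fun; first [exact: measurable_cst | exact: measurable_fst | exact: measurable_snd].
by rewrite lee_fin box_fun_ge0.
Qed.

End BoxOctant.

(** * Cell bounds for the section length *)

Section BoxCells.
Variable R : realType.
Local Notation mu := (@lebesgue_measure R).
Local Notation MR := (measurableTypeR R).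

Lemma cellP (K k : nat) (x : R) : (0 < K)%N -> cell K k x ->
  k%:R < K%:R * x <= k.+1%:R.
Proof.
move=> K0; have k0 : (0 : R) < K%:R by rewrite ltr0n.
by rewrite /cell /= in_itv /= ltr_pdivrMr // ler_pdivlMr // mulrC.
Qed.

Lemma cell_unit (K k : nat) (x : R) : (k < K)%N -> cell K k x -> 0 < x <= 1.
Proof.
move=> kK; have K0 : (0 < K)%N by case: K kK.
have k0 : (0 : R) < K%:R by rewrite ltr0n.
rewrite /cell /= in_itv /= => /andP[h1 h2].
rewrite (le_lt_trans _ h1) ?divr_ge0 //= (le_trans h2) // ler_pdivrMr // mul1r ler_nat //.
Qed.

Variable K : nat.
Hypothesis K0 : (0 < K)%N.

(** The scaled section length K^-1 ell at the far corner of the cell with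
    indices k, l, m. *)
Definition cell_val (k l m : nat) : R := ell k.+1%:R l.+1%:R (m.+1%:R ^+ 3 / K%:R ^+ 2).
Definition cell_err (k l : nat) : R := 44 / (k.+1%:R * l.+1%:R).

(** Away from the planes a = 0 and c = 0 this is ell_cell in coordinates
    scaled by K. In a cell touching one of these planes both values are at
    most 4 / (k + l + 1), as k or l vanishes. *)
Lemma ell_in_cell (k l m : nat) (a c z : R) : (k < K)%N -> (l < K)%N -> (m < K)%N ->
  cell K k a -> cell K l c -> cell K m z -> (0 < k + l)%N ->
  `|ell a c (z ^+ 3) - K%:R * cell_val k l m| <= K%:R * cell_err k l.
Proof.
move=> kK lK mK /(cellP K0) ha /(cellP K0) hc /(cellP K0) hz kl.
have k0 : (0 : R) < K%:R by rewrite ltr0n.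
have -> : ell a c (z ^+ 3) = K%:R * ell (K%:R * a) (K%:R * c) (K%:R * z ^+ 3).
  by rewrite ellZ // mulrC divfK // gt_eqF.
rewrite -mulrBr normrM (gtr0_norm k0) ler_pM2l //.
have -> : K%:R * z ^+ 3 = (K%:R * z) ^+ 3 / K%:R ^+ 2 by field; rewrite gt_eqF.
move: ha hc hz; move: (K%:R * a) (K%:R * c) (K%:R * z) => {}a {}c {}z.
move=> /andP[a1 a2] /andP[c1 c2] /andP[z1 z2].
have kp : (0 : R) <= k%:R by []. have lp : (0 : R) <= l%:R by [].
have mp : (0 : R) <= m%:R by [].
have eS (i : nat) : i.+1%:R = i%:R + 1 :> R by rewrite -addn1 natrD.
have a0 : 0 < a by lra. have c0 : 0 < c by lra. have z0 : 0 < z by lra.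
have pos (i : nat) : 0 < i.+1%:R :> R by [].
have diff (x y e : R) : 0 <= x <= e -> 0 <= y <= e -> `|x - y| <= e.
  by move=> /andP[? ?] /andP[? ?]; rewrite ler_norml; lra.
have n1 : 0 <= ell a c (z ^+ 3 / K%:R ^+ 2) by apply: ell_ge0; exact: ltW.
have n2 : 0 <= cell_val k l m by exact: ell_ge0.
have [k1|k1] := posnP k; last have [l1|l1] := posnP l.
- have l1 : (1 : R) <= l%:R by rewrite ler1n; move: kl; rewrite k1.
  have bd : 4 / l.+1%:R <= cell_err k l.
    by rewrite /cell_err k1 mul1r ler_pM2r ?invr_gt0 //; lra.
  apply: diff; rewrite ?n1 ?n2 /=; apply: (le_trans _ bd).
    apply: le_trans (ell_le_r _ a0 c0) _.
    rewrite ler_pdivrMr // mulrAC ler_pdivlMr // eS; lra.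
  apply: le_trans (ell_le_r _ (pos _) (pos _)) _.
  by rewrite ler_pM2r ?invr_gt0 //; lra.
- have l2 : (1 : R) <= k%:R by rewrite ler1n.
  have bd : 4 / k.+1%:R <= cell_err k l.
    by rewrite /cell_err l1 mulr1 ler_pM2r ?invr_gt0 //; lra.
  apply: diff; rewrite ?n1 ?n2 /=; apply: (le_trans _ bd).
    apply: le_trans (ell_le_l _ a0 c0) _.
    rewrite ler_pdivrMr // mulrAC ler_pdivlMr // eS; lra.
  apply: le_trans (ell_le_l _ (pos _) (pos _)) _.
  by rewrite ler_pM2r ?invr_gt0 //; lra.
have k2 : (1 : R) <= k%:R by rewrite ler1n.
have l2 : (1 : R) <= l%:R by rewrite ler1n.
have mK' : m%:R + 1 <= K%:R :> R by rewrite -eS ler_nat.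
apply: ell_cell; rewrite ?eS in a2 c2 z2 *; try lra.
  by rewrite ler_pM2r ?invr_gt0 ?exprn_gt0 // lerXn2r ?nnegrE //; lra.
have K2 : 0 < K%:R ^+ 2 :> R by rewrite exprn_gt0.
rewrite ler_pdivrMr // mulrDl divfK ?gt_eqF //.
have h1 : m%:R ^+ 3 <= z ^+ 3 by rewrite lerXn2r ?nnegrE //; lra.
have h2 : (m%:R + 1) ^+ 2 <= K%:R ^+ 2 :> R by rewrite lerXn2r ?nnegrE //; lra.
nra.
Qed.

Lemma cell_val0_le (k l m : nat) : k = 0%N -> l = 0%N -> cell_val k l m <= cell_err k l.
Proof.
move=> -> ->; rewrite /cell_val /cell_err; apply: le_trans (ell_le_l _ _ _) _ => //.
by rewrite !mulr1 !invr1 !mulr1; lra.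
Qed.

Lemma box_slice_cell (k l m : nat) (a c z : R) : (k < K)%N -> (l < K)%N -> (m < K)%N ->
  cell K k a -> cell K l c -> cell K m z -> box_slice a c z = (ell a c (z ^+ 3))%:E.
Proof.
by move=> kK lK mK ha hc hz; rewrite box_sliceE //; [exact: cell_unit kK ha|exact: cell_unit lK hc|exact: cell_unit mK hz].
Qed.

(** Near a = c = 0 the integrand is unbounded but integrable: it is at most
    twice the inverse of the larger variable. *)
Definition corner (a c : R) : \bar R :=
  ((2 * `|a|^-1 * [&& 0 < a, a <= K%:R^-1, 0 < c & c <= a]%:R)%R%:E +
   (2 * `|c|^-1 * [&& 0 < c, c <= K%:R^-1, 0 < a & a <= c]%:R)%R%:E)%E.

Lemma corner_ge0 a c : (0 <= corner a c)%E.
Proof. by rewrite adde_ge0 // lee_fin mulr_ge0 // mulr_ge0 // invr_ge0. Qed.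

Lemma cell_upper (k l m : nat) (a c z : R) : (k < K)%N -> (l < K)%N -> (m < K)%N ->
  cell K k a -> cell K l c -> cell K m z ->
  (box_slice a c z <= (K%:R * (cell_val k l m + cell_err k l))%:E + corner a c)%E.
Proof.
move=> kK lK mK ha hc hz; have [kl|kl] := posnP (k + l)%N; last first.
  rewrite (box_slice_cell kK lK mK) //; have := corner_ge0 a c; set e := corner a c => e0.
  apply: (@le_trans _ _ ((K%:R * (cell_val k l m + cell_err k l))%:E + 0)%E); last exact: leeD.
  rewrite adde0 lee_fin; have := ell_in_cell kK lK mK ha hc hz kl.
  rewrite ler_norml mulrDr; lra.
have /andP[/eqP ek /eqP el] : (k == 0%N) && (l == 0%N) by rewrite -addn_eq0 kl.
have k0 : (0 : R) < K%:R by rewrite ltr0n.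
rewrite (box_slice_cell kK lK mK) //; subst k l.
have /andP[a0 _] := cell_unit kK ha; have /andP[c0 _] := cell_unit lK hc.
move: ha hc => /(cellP K0)/andP[_ ha] /(cellP K0)/andP[_ hc].
rewrite -ler_pdivlMl // mulr1 in ha; rewrite -ler_pdivlMl // mulr1 in hc.
have nn : 0 <= K%:R * (cell_val 0 0 m + cell_err 0 0).
  by rewrite mulr_ge0 ?addr_ge0 ?ell_ge0 // divr_ge0.
rewrite /corner -!EFinD lee_fin a0 c0 ha hc /= (gtr0_norm a0) (gtr0_norm c0).
rewrite -[X in X <= _]add0r; apply: lerD => //; have [ca|ac] := leP c a.
  apply: le_trans (ell_le_l _ a0 c0) _; rewrite mulr1 lerDl.
  by rewrite mulr_ge0 // mulr_ge0 // invr_ge0 ltW.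
apply: le_trans (ell_le_r _ a0 c0) _; rewrite (ltW ac) mulr1 lerDr.
by rewrite mulr_ge0 // mulr_ge0 // invr_ge0 ltW.
Qed.

Lemma cell_lower (k l m : nat) (a c z : R) : (k < K)%N -> (l < K)%N -> (m < K)%N ->
  cell K k a -> cell K l c -> cell K m z ->
  ((K%:R * (cell_val k l m - cell_err k l))%:E <= box_slice a c z)%E.
Proof.
move=> kK lK mK ha hc hz; have [kl|kl] := posnP (k + l)%N; last first.
  rewrite (box_slice_cell kK lK mK) // lee_fin; have := ell_in_cell kK lK mK ha hc hz kl.
  rewrite ler_norml mulrBr; lra.
have /andP[/eqP ek /eqP el] : (k == 0%N) && (l == 0%N) by rewrite -addn_eq0 kl.
apply: le_trans (box_slice_ge0 _ _ _); rewrite lee_fin mulr_ge0_le0 //.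
by rewrite subr_le0 cell_val0_le.
Qed.

Lemma measurable_corner d (X : measurableType d) (f g : X -> MR) :
  measurable_fun [set: X] f -> measurable_fun [set: X] g ->
  measurable_fun [set: X] (fun x => corner (f x) (g x)).
Proof.
move=> mf mg; have m0 : measurable_fun [set: X] (fun=> 0 : R) by exact: measurable_cst.
have mK : measurable_fun [set: X] (fun=> K%:R^-1 : R) by exact: measurable_cst.
suff H (u v : X -> R) : measurable_fun [set: X] u -> measurable_fun [set: X] v ->
    measurable_fun [set: X] (fun x => (2 * `|u x|^-1 * [&& 0 < u x, u x <= K%:R^-1, 0 < v x & v x <= u x]%:R)%R%:E).
  by apply: emeasurable_funD; exact: H.
move=> mu' mv; apply/measurable_EFinP; apply: measurable_funM.
  by apply: measurable_funM; [exact: measurable_cst|exact: measurable_inv_norm].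
apply: measurable_bool_natr.
apply: measurable_and; first exact: measurable_fun_ltr.
apply: measurable_and; first exact: measurable_fun_ler.
by apply: measurable_and; [exact: measurable_fun_ltr|exact: measurable_fun_ler].
Qed.

Lemma corner_section (a : R) :
  (\int[mu]_c (2 * `|a|^-1 * [&& (0 < a)%R, (a <= K%:R^-1)%R, (0 < c)%R & (c <= a)%R]%:R)%R%:E =
   (2 * ((0 < a) && (a <= K%:R^-1))%:R)%R%:E)%E.
Proof.
case: (boolP ((0 < a) && (a <= K%:R^-1))) => [/andP[a0 ak]|h]; last first.
  rewrite integral0_eq ?mulr0 // => c _.
  by move: h; rewrite negb_and => /orP[/negbTE->|/negbTE->]; rewrite ?andbF mulr0.
transitivity (\int[mu]_(c in `]0%R, a]) (cst (2 * a^-1)%:E c))%E.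
  rewrite [RHS]integral_mkcond; apply: eq_integral => c _; rewrite patchE mem_setE in_itv /=.
  by rewrite a0 ak (gtr0_norm a0) /=; case: ifP; rewrite ?mulr1 ?mulr0.
rewrite integral_cst //.
have hm : mu `]0%R, a]%classic = a%:E.
  by rewrite lebesgue_measure_itv /= lte_fin a0 -EFinD oppr0 addr0.
transitivity ((2 * a^-1)%:E * a%:E)%E; first by rewrite -hm.
by rewrite -EFinM mulfVK ?gt_eqF // mulr1.
Qed.

(** The two summands have equal integrals by symmetry, and for the first one
    the integral over c cancels the factor 1 / |a|. *)
Lemma integral_corner : (\int[mu]_a \int[mu]_c corner a c = (4 / K%:R)%:E)%E.
Proof.
have k0 : (0 : R) < K%:R by rewrite ltr0n.
pose t (a c : R) := ((2 * `|a|^-1 * [&& 0 < a, a <= K%:R^-1, 0 < c & c <= a]%:R)%R%:E : \bar R).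
have t0 a c : (0 <= t a c)%E by rewrite lee_fin mulr_ge0 // mulr_ge0 // invr_ge0.
have mt : measurable_fun [set: MR * MR] (fun w : MR * MR => t w.1 w.2).
  apply/measurable_EFinP; apply: measurable_funM.
    by apply: measurable_funM; [exact: measurable_cst|apply: measurable_inv_norm; exact: measurable_fst].
  apply: measurable_bool_natr.
  do !(apply: measurable_and; first by [apply: measurable_fun_ltr|apply: measurable_fun_ler]).
  by apply: measurable_fun_ler.
have mt1 a : measurable_fun [set: R] (t a).
  have mp : measurable_fun [set: MR] (fun c : MR => (a : MR, c)).
    by apply: measurable_fun_pair => //; exact: measurable_cst.
  exact: (measurableT_comp mt mp).
have mt2' : measurable_fun [set: MR * MR] (fun w : MR * MR => t w.2 w.1).
  have mp : measurable_fun [set: MR * MR] (fun w : MR * MR => (w.2, w.1)).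
    by apply: measurable_fun_pair.
  exact: (measurableT_comp mt mp).
have mt2 a : measurable_fun [set: R] (t ^~ a).
  have mp : measurable_fun [set: MR] (fun c : MR => (c, a : MR)).
    by apply: measurable_fun_pair => //; exact: measurable_cst.
  exact: (measurableT_comp mt mp).
have m1 : measurable_fun [set: R] (fun a => \int[mu]_c t a c)%E.
  exact: (@measurable_integral_last R _ MR t mt).
have m2 : measurable_fun [set: R] (fun a => \int[mu]_c t c a)%E.
  exact: (@measurable_integral_last R _ MR (fun a c => t c a) mt2').
have g1 a : (0 <= \int[mu]_c t a c)%E by apply: integral_ge0 => ? _.
have g2 a : (0 <= \int[mu]_c t c a)%E by apply: integral_ge0 => ? _.
have e1 : (\int[mu]_a \int[mu]_c t a c = (2 / K%:R)%:E)%E.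
  transitivity (\int[mu]_(a in `]0%R, (K%:R^-1)%R]) (cst 2%:E a))%E.
    rewrite [RHS]integral_mkcond; apply: eq_integral => a _; rewrite patchE mem_setE in_itv /=.
    by rewrite /t corner_section; case: ifP; rewrite ?mulr1 ?mulr0.
  rewrite integral_cst //.
  have hm : mu `]0%R, (K%:R^-1)%R]%classic = K%:R^-1%:E.
    by rewrite lebesgue_measure_itv /= lte_fin invr_gt0 k0 -EFinD oppr0 addr0.
  by rewrite EFinM -hm.
transitivity (\int[mu]_a (\int[mu]_c t a c + \int[mu]_c t c a))%E.
  apply: eq_integral => a _.
  exact: (ge0_integralD mu measurableT (fun c _ => t0 a c) (mt1 a) (fun c _ => t0 c a) (mt2 a)).
rewrite (ge0_integralD mu measurableT (fun a _ => g1 a) m1 (fun a _ => g2 a) m2) e1.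
rewrite -(fubini_swap mt t0) e1 -EFinD -mulrDl; congr (_%:E); congr (_ / _); ring.
Qed.

Definition cell_sum : R := \sum_(k < K) \sum_(l < K) \sum_(m < K) cell_val k l m.
Definition cell_bound : R := \sum_(k < K) \sum_(l < K) \sum_(m < K) cell_err k l.

Lemma nested_cells (F : nat -> nat -> nat -> R) :
  (\sum_(k < K) (\sum_(l < K) (\sum_(m < K) (K%:R * F k l m)) / K%:R) / K%:R) / K%:R =
  (\sum_(k < K) \sum_(l < K) \sum_(m < K) F k l m) / K%:R ^+ 2.
Proof.
have k0 : K%:R != 0 :> R by rewrite pnatr_eq0 -lt0n.
rewrite !mulr_suml; apply: eq_bigr => k _; rewrite !mulr_suml; apply: eq_bigr => l _.
rewrite !mulr_suml; apply: eq_bigr => m _; by field.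
Qed.

(** On each cell the integrand is at least the corner value minus the error;
    integrate this over z, c and a in turn. *)
Lemma box_octant_lower :
  (((cell_sum - cell_bound) / K%:R ^+ 2)%:E <= \int[mu]_(a in `]0%R, 1%R]) box_line a)%E.
Proof.
rewrite /cell_sum /cell_bound -sumrB.
under eq_bigr do rewrite -sumrB. under eq_bigr do under eq_bigr do rewrite -sumrB.
rewrite -(nested_cells (fun k l m => cell_val k l m - cell_err k l)).
apply: (cells_integral_ge (F := fun k : nat => (\sum_(l < K) (\sum_(m < K) (K%:R *
  (cell_val k l m - cell_err k l))) / K%:R) / K%:R)) => // [||k a kK ha].
- exact: measurable_box_line.
- exact: box_line_ge0.
apply: (cells_integral_ge (F := fun l : nat => (\sum_(m < K) (K%:R *
  (cell_val k l m - cell_err k l))) / K%:R)) => // [||l c lK hc].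
- exact: measurable_box_plane.
- exact: box_plane_ge0.
apply: (cells_integral_ge (F := fun m : nat => (K%:R *
  (cell_val k l m - cell_err k l)))) => // [||m z mK hz].
- exact: measurable_slice_z.
- exact: box_slice_ge0.
exact: cell_lower.
Qed.

(** As for the lower bound, except that the block of cells at a = c = 0 needs
    the additional term corner. *)
Lemma box_octant_upper :
  (\int[mu]_(a in `]0%R, 1%R]) box_line a <=
   ((cell_sum + cell_bound) / K%:R ^+ 2)%:E + (4 / K%:R)%:E)%E.
Proof.
have nn k l m : 0 <= K%:R * (cell_val k l m + cell_err k l).
  by rewrite mulr_ge0 ?addr_ge0 ?ell_ge0 // divr_ge0.
have mc a : measurable_fun [set: R] (corner a).
  by apply: (@measurable_corner _ MR (cst a) id).
have mc2 : measurable_fun [set: MR * MR] (fun w : MR * MR => corner w.1 w.2).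
  by apply: measurable_corner.
have mcl : measurable_fun [set: R] (fun a => \int[mu]_c corner a c)%E.
  by apply: (@measurable_integral_last R _ MR corner mc2); exact: corner_ge0.
have cl0 a : (0 <= \int[mu]_c corner a c)%E by apply: integral_ge0 => c _; exact: corner_ge0.
have sub (f : R -> \bar R) : measurable_fun [set: R] f -> (forall x, 0 <= f x)%E ->
    (\int[mu]_(x in `]0%R, 1%R]) f x <= \int[mu]_x f x)%E.
  by move=> mf f0; apply: ge0_subset_integral.
rewrite /cell_sum /cell_bound -big_split.
under eq_bigr do rewrite /= -big_split. under eq_bigr do under eq_bigr do rewrite /= -big_split.
rewrite -(nested_cells (fun k l m => cell_val k l m + cell_err k l)).
rewrite -integral_corner.
apply: le_trans (leeD (le_refl _) (sub _ mcl cl0)).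
apply: (cells_integral_le (F := fun k : nat => (\sum_(l < K) (\sum_(m < K) (K%:R *
  (cell_val k l m + cell_err k l))) / K%:R) / K%:R)) => // [||k kK|k a kK ha].
- exact: measurable_box_line.
- exact: box_line_ge0.
- by rewrite divr_ge0 // sumr_ge0 // => l _; rewrite divr_ge0 // sumr_ge0.
apply: le_trans (leeD (le_refl _) (sub _ (mc a) (corner_ge0 a))).
apply: (cells_integral_le (F := fun l : nat => (\sum_(m < K) (K%:R *
  (cell_val k l m + cell_err k l))) / K%:R)) => // [|||l lK|l c lK hc].
- exact: measurable_box_plane.
- exact: box_plane_ge0.
- exact: corner_ge0.
- by rewrite divr_ge0 // sumr_ge0.
have -> : corner a c = (\int[mu]_(z in `]0%R, 1%R]) (cst (corner a c) z))%E.
  rewrite integral_cst //.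
  have hm : mu `]0%R, 1%R]%classic = 1%E.
    by rewrite lebesgue_measure_itv /= lte_fin ltr01 -EFinD oppr0 addr0.
  by transitivity (corner a c * 1)%E; [rewrite mule1|rewrite -hm].
apply: (cells_integral_le (F := fun m : nat => (K%:R *
  (cell_val k l m + cell_err k l)))) => // [|||m z mK hz].
- exact: measurable_slice_z.
- exact: box_slice_ge0.
- by move=> x; exact: corner_ge0.
exact: cell_upper.
Qed.

End BoxCells.

(** * The box integral as a density of lattice points *)

Section OctantSum.
Variable R : realType.
Implicit Type x : R.

Definition root4 x : R := Num.sqrt (Num.sqrt x).

(** The discrete analogue of x times the octant integral: all positive a, c, z
    with squares at most x contribute. *)
Definition octant_sum x : R :=
  let K := Num.truncn (Num.sqrt x) in
  \sum_(k < K) \sum_(l < K) \sum_(m < K) ell k.+1%:R l.+1%:R (m.+1%:R ^+ 3 / x).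

Lemma box_fin : box_integral R \is a fin_num.
Proof.
have := @box_octant_upper R 1 isT; have := @box_octant_lower R 1 isT.
by rewrite box_integral_octant; case: (integral _ _ _) => [r||].
Qed.

Lemma box_cells (K : nat) : (0 < K)%N ->
  `|K%:R ^+ 2 * (fine (box_integral R) / 8) - cell_sum R K| <= cell_bound R K + 4 * K%:R.
Proof.
move=> K0; have k0 : (0 : R) < K%:R by rewrite ltr0n.
have k2 : (0 : R) < K%:R ^+ 2 by rewrite exprn_gt0.
have := @box_octant_upper R K K0; have := @box_octant_lower R K K0.
have := box_fin; rewrite box_integral_octant.
case: (integral _ _ _) => [r _||] //.
rewrite -EFinD !lee_fin /= [8 * r]mulrC mulfK //.
  rewrite ler_pdivrMr // => h1 h2.
  have {}h2 : r * K%:R ^+ 2 <= cell_sum R K + cell_bound R K + 4 * K%:R.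
    move: h2; rewrite -(ler_pM2r k2) mulrDl divfK ?gt_eqF //.
    by have -> : 4 / K%:R * K%:R ^+ 2 = 4 * K%:R :> R by field; rewrite gt_eqF.
  by rewrite ler_norml; lra.
Qed.

Lemma ell_lip (a c n n' : R) : 0 < a -> 0 < c -> `|ell a c n - ell a c n'| <= `|n - n'| / (a * c).
Proof.
move=> a0 c0; rewrite /ell -mulrBl normrM (gtr0_norm (_ : 0 < (a * c)^-1)) ?invr_gt0 ?mulr_gt0 //.
rewrite ler_pM2r ?invr_gt0 ?mulr_gt0 //; apply: min_lip; first by rewrite subrr normr0.
apply: max_lip; first by rewrite subrr normr0.
by rewrite [X in `|X|](_ : _ = n' - n) 1?distrC //; ring.
Qed.

Lemma sqrtK_ge0 x : 0 <= x -> Num.sqrt x * Num.sqrt x = x.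
Proof. by move=> x0; rewrite -expr2 sqr_sqrtr. Qed.

Lemma harmonic_sqr_le (K : nat) :
  (\sum_(k < K) (k.+1%:R)^-1) ^+ 2 <= 16 * Num.sqrt K%:R :> R.
Proof.
have h : \sum_(k < K) (k.+1%:R)^-1 <= 4 * root4 K%:R :> R.
  apply: le_trans (sum_inv_sqrt4 R K); rewrite big_add1 /= big_mkord.
  apply: ler_sum => k _; have k1 : 1 <= Num.sqrt k.+1%:R :> R by exact: sqrt_nat_ge1.
  rewrite lef_pV2 ?posrE ?ltr0n ?exprn_gt0 ?sqrtr_gt0 ?(lt_le_trans ltr01 k1) //.
  set y := Num.sqrt (Num.sqrt _).
  have y1 : 1 <= y by rewrite -[1]sqrtr1 ler_wsqrtr.
  have -> : k.+1%:R = y ^+ 4 :> R.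
    by rewrite (exprM y 2 2) /y !sqr_sqrtr ?sqrtr_ge0.
  by rewrite ler_weXn2l.
have n0 : 0 <= \sum_(k < K) (k.+1%:R)^-1 :> R by apply: sumr_ge0 => k _; rewrite invr_ge0.
have r0 : 0 <= root4 K%:R by exact: sqrtr_ge0.
apply: (@le_trans _ _ ((4 * root4 K%:R) ^+ 2)); first by rewrite lerXn2r ?nnegrE // mulr_ge0.
by rewrite exprMn /root4 sqr_sqrtr ?sqrtr_ge0 // -natrX.
Qed.

Lemma triple_harmonic (K : nat) (e : R) :
  \sum_(k < K) \sum_(l < K) \sum_(m < K) (e / (k.+1%:R * l.+1%:R)) =
  e * (K%:R * (\sum_(k < K) (k.+1%:R)^-1) ^+ 2).
Proof.
rewrite expr2 [in RHS]mulr_suml !mulr_sumr; apply: eq_bigr => k _.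
rewrite [in RHS]mulr_sumr !mulr_sumr; apply: eq_bigr => l _.
by rewrite sumr_const card_ord -[_ *+ K]mulr_natl invfM; ring.
Qed.

(** Let K be the integer part of sqrt x. Replacing x by K^2 and integrals by
    values at corners of cells costs O(1 / (a c)) for each triple, so O(K)
    times the square of a harmonic sum, which is O(sqrt K). *)
Lemma octant_sum_approx : exists2 C : R, 0 <= C & forall x, 1 <= x ->
  `|octant_sum x - x * (fine (box_integral R) / 8)| <= C * (Num.sqrt x * root4 x).
Proof.
set b := fine (box_integral R) / 8; exists (47 * 16 + 4 + 3 * `|b|) => [|x x1].
  by rewrite addr_ge0 // mulr_ge0.
set K := Num.truncn (Num.sqrt x); set s := Num.sqrt x.
have s1 : 1 <= s by rewrite -[1]sqrtr1 ler_wsqrtr.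
have s0 : 0 <= s by exact: sqrtr_ge0.
have sE : s * s = x by rewrite sqrtK_ge0 // (le_trans ler01).
have /andP[Ks sK] : K%:R <= s < K.+1%:R by rewrite truncn_itv.
have K0 : (0 < K)%N by rewrite lt0n; apply: contraTneq sK => ->; rewrite -leNgt.
have kR : (1 : R) <= K%:R by rewrite ler1n.
have kp : (0 : R) < K%:R by rewrite ltr0n.
have eS : K.+1%:R = K%:R + 1 :> R by rewrite -addn1 natrD.
rewrite eS in sK.
set H := \sum_(k < K) (k.+1%:R)^-1 : R.
have Kx : K%:R ^+ 2 <= x by rewrite -sE expr2 ler_pM.
have xK : x - K%:R ^+ 2 <= 3 * K%:R by rewrite -sE; nra.
have d1 : `|octant_sum x - cell_sum R K| <= 3 * (K%:R * H ^+ 2).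
  rewrite -triple_harmonic /octant_sum -/K /cell_sum -sumrB.
  apply: le_trans (ler_norm_sum _ _ _) _; apply: ler_sum => k _; rewrite -sumrB.
  apply: le_trans (ler_norm_sum _ _ _) _; apply: ler_sum => l _; rewrite -sumrB.
  apply: le_trans (ler_norm_sum _ _ _) _; apply: ler_sum => m _.
  apply: le_trans (ell_lip _ _ _ _) _ => //.
  rewrite ler_pM2r ?invr_gt0 ?mulr_gt0 //.
  set w := m.+1%:R; have wK : w <= K%:R by rewrite ler_nat.
  have w0 : 0 <= w by [].
  have k2 : 0 < K%:R ^+ 2 :> R by rewrite exprn_gt0 // (lt_le_trans ltr01).
  have x0 : 0 < x by rewrite (lt_le_trans ltr01).
  have -> : w ^+ 3 / x - w ^+ 3 / K%:R ^+ 2 = - (w ^+ 3 * (x - K%:R ^+ 2) / (K%:R ^+ 2 * x)).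
    by field; rewrite !gt_eqF // (lt_le_trans ltr01).
  have n0 : 0 <= w ^+ 3 * (x - K%:R ^+ 2) by rewrite mulr_ge0 ?exprn_ge0 // subr_ge0.
  rewrite normrN ger0_norm; last by rewrite divr_ge0 // mulr_ge0 // ltW.
  rewrite ler_pdivrMr ?mulr_gt0 //.
  have w3 : w ^+ 3 <= K%:R ^+ 3 by rewrite lerXn2r ?nnegrE.
  apply: le_trans (ler_pM _ _ w3 xK) _; rewrite ?exprn_ge0 ?subr_ge0 //.
  have -> : K%:R ^+ 3 * (3 * K%:R) = 3 * (K%:R ^+ 2 * K%:R ^+ 2) :> R by ring.
  by rewrite ler_pM2l // ler_pM2l.
have d2 := box_cells K0; rewrite -/b in d2.
have -> : octant_sum x - x * b = (octant_sum x - cell_sum R K)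
  - (K%:R ^+ 2 * b - cell_sum R K) - (x - K%:R ^+ 2) * b by ring.
have e : cell_bound R K = 44 * (K%:R * H ^+ 2) by rewrite -triple_harmonic.
rewrite e in d2.
have d3 : `|(x - K%:R ^+ 2) * b| <= 3 * K%:R * `|b|.
  by rewrite normrM ler_wpM2r // ger0_norm ?subr_ge0.
apply: le_trans (ler_normB _ _) _; apply: le_trans (lerD (ler_normB _ _) d3) _.
have r1 : 1 <= root4 x by rewrite -[1]sqrtr1 ler_wsqrtr.
have hH : H ^+ 2 <= 16 * root4 x.
  by apply: le_trans (harmonic_sqr_le K) _; rewrite ler_pM2l // ler_wsqrtr.
have hKH : K%:R * H ^+ 2 <= s * (16 * root4 x) by rewrite ler_pM ?sqr_ge0.
have hK : K%:R <= s * root4 x by rewrite -[K%:R]mulr1 ler_pM.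
have b0 : 0 <= `|b| by [].
have := ler_wpM2r b0 hK; lra.
Qed.

End OctantSum.

(** * Integer ranges and residue classes *)

Section IntRange.

Definition zrange (m : nat) : seq int := [seq Posz i - Posz m | i <- iota 0 (2 * m).+1].

Lemma mem_zrange m x : (x \in zrange m) = (`|x| <= m)%N.
Proof.
apply/mapP/idP => [[i]|h]; first by rewrite mem_iota => hi ->; lia.
by exists (absz (x + m%:Z)); [rewrite mem_iota; lia|lia].
Qed.

Lemma zrange_uniq m : uniq (zrange m).
Proof. by rewrite map_inj_uniq ?iota_uniq // => i j /= h; lia. Qed.

Lemma perm_filter_zrange (s : seq int) m (P : pred int) : uniq s ->
  (forall x, (x \in s) = (`|x| <= m)%N && P x) -> perm_eq [seq x <- zrange m | P x] s.
Proof.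
move=> us h; apply: uniq_perm => //; first by rewrite filter_uniq ?zrange_uniq.
by move=> x; rewrite mem_filter mem_zrange h andbC.
Qed.

Section Sums.
Variables (V : nmodType) (F : int -> V).

Lemma big_zrange_shrink m n : (n <= m)%N -> (forall x, (n < `|x|)%N -> F x = 0) ->
  \sum_(x <- zrange m) F x = \sum_(x <- zrange n) F x.
Proof.
move=> nm F0; rewrite (bigID (fun x : int => (`|x| <= n)%N)) /= [X in _ + X]big1; last first.
  by move=> x; rewrite -ltnNge; exact: F0.
rewrite addr0 -big_filter; apply: perm_big; apply: perm_filter_zrange; first exact: zrange_uniq.
by move=> x; rewrite mem_zrange; lia.
Qed.

Lemma big_zrange_multiples m (f : nat) : (0 < f)%N ->
  \sum_(x <- zrange m | (f%:Z %| x)%Z) F x = \sum_(x <- zrange (m %/ f)) F (f%:Z * x).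
Proof.
move=> f0; rewrite -big_filter -(big_map (fun x => f%:Z * x) xpredT); apply: perm_big.
apply: perm_filter_zrange.
  by rewrite map_inj_uniq ?zrange_uniq // => x y /= /mulfI; apply; lia.
move=> x; apply/mapP/andP => [[y]|[h /dvdzP[y e]]].
  rewrite mem_zrange leq_divRL // => hy ->; split; last exact: dvdz_mulr.
  by rewrite abszM mulnC.
exists y; last by rewrite mulrC.
by rewrite mem_zrange leq_divRL //; move: h; rewrite e abszM.
Qed.

Lemma big_zrange_interval m (A B : int) : - m%:Z <= A -> B <= m%:Z -> A <= B + 1 ->
  \sum_(x <- zrange m | A <= x <= B) F x = \sum_(j < `|B - A + 1|) F (A + j%:Z).
Proof.
move=> hA hB hAB; rewrite -big_filter -(big_mkord xpredT (fun j => F (A + j%:Z))).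
rewrite -(big_map (fun j : nat => A + j%:Z) xpredT F); apply: perm_big.
apply: perm_filter_zrange.
  by rewrite map_inj_uniq ?iota_uniq // => i j /= h; lia.
move=> x; apply/mapP/idP => [[j]|h]; first by rewrite mem_index_iota => hj ->; lia.
by exists `|x - A|%N; [rewrite mem_index_iota; lia|lia].
Qed.

Lemma big_zrange_sign m :
  \sum_(x <- zrange m) F x = F 0 + \sum_(1 <= k < m.+1) (F k%:Z + F (- k%:Z)).
Proof.
rewrite big_split /= addrA; transitivity (\sum_(x <- [:: 0 & [seq k%:Z | k <- iota 1 m] ++ [seq - k%:Z | k <- iota 1 m]]) F x).
  apply: perm_big; apply: uniq_perm; first exact: zrange_uniq.
    rewrite /= cat_uniq !map_inj_uniq ?iota_uniq; try by move=> i j /= h; lia.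
    rewrite andbT /= mem_cat negb_or -andbA; apply/and3P; split.
    - by apply/mapP => -[j]; rewrite mem_iota; lia.
    - by apply/mapP => -[j]; rewrite mem_iota; lia.
    by apply/hasPn => x /mapP[j]; rewrite mem_iota => hj ->; apply/mapP => -[i]; rewrite mem_iota; lia.
  move=> x; rewrite mem_zrange inE mem_cat; apply/idP/or3P => [h|[/eqP->|/mapP[j]|/mapP[j]]] //.
  - case: (ltrgtP x 0) => hx; [apply: Or33|apply: Or32|apply: Or31] => //; apply/mapP;
      by exists `|x|%N; [rewrite mem_iota|]; lia.
  - by rewrite mem_iota => hj ->; lia.
  - by rewrite mem_iota => hj ->; lia.
by rewrite big_cons big_cat !big_map /index_iota subn1 /= addrA.
Qed.

End Sums.

Lemma sum_zrange_pred1 (V : pzSemiRingType) m (y : int) :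
  \sum_(x <- zrange m) (x == y)%:R = (`|y| <= m)%:R :> V.
Proof.
rewrite -mem_zrange; elim: (zrange m) (zrange_uniq m) => [|x s IH] /= => [_|/andP[xs us]].
  by rewrite big_nil.
rewrite big_cons IH // inE [y == x]eq_sym.
have [e|] := eqVneq x y; last by rewrite add0r.
by rewrite -e (negbTE xs) addr0.
Qed.

End IntRange.

Section ResidueCount.
Variable R : realType.

(** This makes the count of a residue class telescope. *)
Lemma dvdz_floor_diff (q : nat) (x : int) : (0 < q)%N ->
  ((q%:Z %| x)%Z : nat)%:Z = (x %/ q%:Z)%Z - ((x - 1) %/ q%:Z)%Z.
Proof.
move=> q0; have q0' : q%:Z != 0 by lia.
have e := divz_eq x q%:Z; have := modz_ge0 x q0'; have := ltz_mod x q0'.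
have dv : (q%:Z %| x)%Z = ((x %% q%:Z)%Z == 0) by apply/dvdz_mod0P/eqP.
move: e dv; move: (x %/ q%:Z)%Z (x %% q%:Z)%Z => y s e -> s1 s0.
have {}s1 : s < q%:Z by lia.
have [s00|sn] := eqVneq s 0.
  have -> : x - 1 = (y - 1) * q%:Z + (q%:Z - 1) by rewrite e s00; ring.
  by rewrite divzMDl // divz_small ?addr0; lia.
have -> : x - 1 = y * q%:Z + (s - 1) by rewrite e; ring.
by rewrite divzMDl // divz_small; lia.
Qed.

Lemma divz_bounds (q : nat) (x : int) : (0 < q)%N ->
  (x%:~R / q%:R - 1 < ((x %/ q%:Z)%Z)%:~R :> R) && (((x %/ q%:Z)%Z)%:~R <= x%:~R / q%:R :> R).
Proof.
move=> q0; have q0' : q%:Z != 0 by lia.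
have qR : (0 : R) < q%:R by rewrite ltr0n.
have e := divz_eq x q%:Z; have := modz_ge0 x q0'; have := ltz_mod x q0'.
move: e; move: (x %/ q%:Z)%Z (x %% q%:Z)%Z => y s e s1 s0; have {}s1 : s < q%:Z by lia.
have eR : x%:~R = y%:~R * q%:R + s%:~R :> R by rewrite {1}e rmorphD rmorphM.
have h0 : (0 : R) <= s%:~R by rewrite ler0z.
have h1 : s%:~R < q%:R :> R by rewrite -[q%:R]/(q%:Z%:~R) ltr_int.
rewrite ler_pdivlMr // ltrBlDr ltr_pdivrMr // eR mulrDl mul1r ltrD2l h1 /=.
by rewrite lerDl.
Qed.

Lemma residue_count (q : nat) (r A : int) (n : nat) : (0 < q)%N ->
  `|\sum_(j < n) ((q%:Z %| A + j%:Z - r)%Z : nat)%:R - n%:R / q%:R| <= 1 :> R.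
Proof.
move=> q0; pose h (j : nat) : R := (((A + j%:Z - r - 1) %/ q%:Z)%Z)%:~R.
have -> : \sum_(j < n) ((q%:Z %| A + j%:Z - r)%Z : nat)%:R = h n - h 0%N.
  rewrite -(big_mkord xpredT (fun j => ((q%:Z %| A + j%:Z - r)%Z : nat)%:R)).
  rewrite -(telescope_sumr h) //; apply: eq_bigr => j _.
  rewrite -[LHS]/(_%:Z%:~R) dvdz_floor_diff // rmorphB /h; congr (_%:~R - _).
  by congr (_ %/ _)%Z; lia.
have := divz_bounds (A + n%:Z - r - 1) q0; have := divz_bounds (A + 0%:Z - r - 1) q0.
rewrite -/(h n) -/(h 0%N).
have -> : (A + n%:Z - r - 1)%:~R / q%:R = (A + 0%:Z - r - 1)%:~R / q%:R + n%:R / q%:R :> R.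
  by rewrite -mulrDl -[n%:R]/(n%:Z%:~R) -rmorphD; congr (_%:~R / _); lia.
move: (_ / q%:R) (n%:R / q%:R) => u v /andP[? ?] /andP[? ?].
by rewrite ler_norml; lra.
Qed.

Lemma residue_count_interval (q m : nat) (r : int) (lo hi : R) : (0 < q)%N ->
  - m%:R <= lo -> hi <= m%:R ->
  `|\sum_(d <- zrange m) ([&& lo <= d%:~R, d%:~R <= hi & (q%:Z %| d - r)%Z] : nat)%:R
    - Num.max 0 (hi - lo) / q%:R| <= 2 :> R.
Proof.
move=> q0 hlo hhi; have [hl|lh] := ltP hi lo.
  rewrite max_l ?mul0r ?subr0; last by rewrite subr_le0 ltW.
  rewrite big1 ?normr0 // => d _; case: (boolP (lo <= d%:~R)) => //= h.
  by rewrite leNgt (lt_le_trans hl h).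
rewrite max_r ?subr_ge0 //.
pose A := Num.ceil lo; pose B := Num.floor hi.
have /andP[hA1 hA2] := ceil_itv lo; have /andP[hB1 hB2] := floor_itv hi.
rewrite -/A -/B rmorphB /= in hA1 hA2; rewrite -/B rmorphD /= in hB1 hB2.
have AB : A <= B + 1.
  suff : A - 1 < B + 1 by lia.
  by rewrite -(ltr_int R) rmorphB rmorphD /=; lra.
have mA : - m%:Z <= A by rewrite -(ler_int R) rmorphN /=; lra.
have mB : B <= m%:Z by rewrite -(ler_int R) /=; lra.
have -> : \sum_(d <- zrange m) ([&& lo <= d%:~R, d%:~R <= hi & (q%:Z %| d - r)%Z] : nat)%:R =
    \sum_(j < `|B - A + 1|) ((q%:Z %| A + j%:Z - r)%Z : nat)%:R :> R.
  rewrite -(@big_zrange_interval R (fun d => ((q%:Z %| d - r)%Z : nat)%:R) m) // [RHS]big_mkcond.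
  apply: eq_bigr => d _; rewrite -ceil_le_int -floor_ge_int -/A -/B.
  by case: (A <= d); case: (d <= B).
have := residue_count r A `|B - A + 1| q0.
have nE : (`|B - A + 1|)%:R = B%:~R - A%:~R + 1 :> R.
  have e1 : (absz (B - A + 1))%:Z = B - A + 1 by lia.
  by rewrite -[LHS]/((absz (B - A + 1))%:Z%:~R) e1 rmorphD rmorphB.
rewrite nE; move: (\sum_(_ < _) _) => S hS.
have q1 : (1 : R) <= q%:R by rewrite ler1n.
have qR : (0 : R) < q%:R by lra.
have e : `|(B%:~R - A%:~R + 1) / q%:R - (hi - lo) / q%:R| <= 1 :> R.
  rewrite -mulrBl normrM (gtr0_norm (_ : 0 < q%:R^-1)) ?invr_gt0 // ler_pdivrMr // mul1r.
  by apply: le_trans q1; rewrite ler_norml; lra.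
by move: hS e; rewrite !ler_norml; lra.
Qed.

Lemma residue_count_le (q m : nat) (r : int) : (0 < q)%N ->
  \sum_(d <- zrange m) ((q%:Z %| d - r)%Z : nat)%:R <= (2 * m).+1%:R / q%:R + 1 :> R.
Proof.
move=> q0; have := @residue_count q r (- m%:Z) (2 * m).+1 q0.
rewrite ler_norml => /andP[_]; rewrite lerBlDr [1 + _]addrC; apply: le_trans.
rewrite /zrange big_map -(big_mkord xpredT (fun j => ((q%:Z %| - m%:Z + j%:Z - r)%Z : nat)%:R)).
rewrite /index_iota subn0; apply: ler_sum => j _.
by rewrite [- _ + _]addrC.
Qed.

End ResidueCount.

(** * Lattice points on a line *)

Section LineCount.
Variable R : realType.

Definition line_count (m : nat) (a c n : int) : R :=
  \sum_(b <- zrange m) \sum_(d <- zrange m) (a * d - b * c == n)%:R.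

Lemma line_count_ge0 m (a c n : int) : 0 <= line_count m a c n.
Proof. by apply: sumr_ge0 => b _; apply: sumr_ge0. Qed.

Lemma line_count_swap m (a c n : int) : line_count m a c n = line_count m c a (- n).
Proof.
rewrite /line_count exchange_big; apply: eq_bigr => d _; apply: eq_bigr => b _.
by rewrite -(inj_eq (@oppr_inj int)) opprB [a * d]mulrC [b * c]mulrC.
Qed.

Lemma line_count_d m (a c n : int) : c != 0 ->
  line_count m a c n =
  \sum_(d <- zrange m) ((c %| a * d - n)%Z && (absz (a * d - n)%R <= m * absz c)%N)%:R.
Proof.
move=> c0; rewrite /line_count exchange_big; apply: eq_bigr => d _ /=.
have [/dvdzP[y e]|h] := boolP (c %| a * d - n)%Z; last first.
  rewrite big1 // => b _; case: eqP => // e; case/negP: h.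
  by rewrite -e; apply/dvdzP; exists b; ring.
rewrite e abszM leq_pmul2r ?absz_gt0 //= -sum_zrange_pred1; apply: eq_bigr => b _.
congr (_%:R); congr nat_of_bool; apply/eqP/eqP => [e1|->].
  by apply: (mulIf c0); rewrite -e -e1; ring.
by rewrite -e; ring.
Qed.

Lemma gcdn_absz_gt0 (a c : int) : c != 0 -> (0 < gcdn `|a| `|c|)%N.
Proof. by move=> c0; rewrite gcdn_gt0 orbC absz_gt0 c0. Qed.

(** Dividing by g = gcd(a, c), the congruence a d = n mod c becomes d = r
    modulo |c| / g when g divides n, and has no solution otherwise. *)
Lemma congruence_class (a c n : int) : c != 0 ->
  let g := gcdn `|a| `|c| in exists r : int, forall d : int,
    (c %| a * d - n)%Z = (g %| `|n|)%N && ((`|c| %/ g)%N%:Z %| d - r)%Z.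
Proof.
move=> c0 g; have g0 : (0 < g)%N by exact: gcdn_absz_gt0.
have [h|h] := boolP (g %| `|n|)%N; last first.
  exists 0 => d; apply/negbTE/negP => hd; case/negP: h.
  have : (g%:Z %| a * d - (a * d - n))%Z.
    apply: rpredB; first by apply: dvdz_mulr; rewrite dvdzE /= dvdn_gcdl.
    by apply: dvdz_trans hd; rewrite dvdzE /= dvdn_gcdr.
  by rewrite opprB addrC subrK dvdzE.
have [a1 ea] : exists a1, a = a1 * g%:Z by apply/dvdzP; rewrite dvdzE /= dvdn_gcdl.
have [c1 ec] : exists c1, c = c1 * g%:Z by apply/dvdzP; rewrite dvdzE /= dvdn_gcdr.
have [n1 en] : exists n1, n = n1 * g%:Z by apply/dvdzP; rewrite dvdzE.
have gz : g%:Z != 0 by lia.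
have qE : (`|c| %/ g)%N = `|c1|%N by rewrite ec abszM mulnK.
have cop : coprimez c1 a1.
  rewrite coprimezE /coprime -(eqn_pmul2r g0) muln_gcdl mul1n.
  by rewrite -[X in gcdn (_ * X) _](absz_nat g) -[X in gcdn _ (_ * X)](absz_nat g) -!abszM -ea -ec gcdnC.
have [[u v] /= uv] := coprimezP _ _ cop.
exists (v * n1) => d; rewrite qE /= !dvdzE absz_nat -!dvdzE.
have -> : a * d - n = (a1 * d - n1) * g%:Z by rewrite ea en; ring.
rewrite {1}ec dvdz_mul2r // -(Gauss_dvdzr (d - v * n1) cop).
have -> : a1 * (d - v * n1) = (a1 * d - n1) + (n1 * u) * c1.
  transitivity (a1 * d - n1 * (u * c1 + v * a1) + n1 * u * c1); first by ring.
  by rewrite uv; ring.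
have hh : (c1 %| n1 * u * c1)%Z by exact: dvdz_mull.
by rewrite [RHS]rpredDr.
Qed.

Lemma line_count_le_c m (a c n : int) : c != 0 ->
  line_count m a c n <= (gcdn `|a| `|c| %| `|n|)%N%:R *
    ((2 * m).+1%:R * (gcdn `|a| `|c|)%:R / `|c|%N%:R + 1).
Proof.
move=> c0; rewrite line_count_d //; have g0 := gcdn_absz_gt0 a c0.
have [r hr] := congruence_class a n c0; set g := gcdn _ _ in hr g0 *.
have qg : ((`|c| %/ g) * g = `|c|)%N by rewrite divnK // dvdn_gcdr.
have q0 : (0 < `|c| %/ g)%N by rewrite divn_gt0 // dvdn_leq ?dvdn_gcdr // absz_gt0.
have [h|h] := boolP (g %| `|n|)%N; last first.
  by rewrite mul0r big1 // => d _; rewrite hr (negbTE h).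
rewrite mul1r; have -> : (2 * m).+1%:R * g%:R / `|c|%N%:R = (2 * m).+1%:R / (`|c| %/ g)%N%:R :> R.
  have gR : (0 : R) < g%:R by rewrite ltr0n.
  have qR : (0 : R) < (`|c| %/ g)%N%:R by rewrite ltr0n.
  by rewrite -{1}qg natrM; field; rewrite !gt_eqF.
apply: le_trans (residue_count_le R m r q0); apply: ler_sum => d _.
by rewrite hr h /=; case: (_ %| _)%Z => //; case: (_ <= _)%N.
Qed.

Lemma line_count_le_a m (a c n : int) : a != 0 ->
  line_count m a c n <= (gcdn `|a| `|c| %| `|n|)%N%:R *
    ((2 * m).+1%:R * (gcdn `|a| `|c|)%:R / `|a|%N%:R + 1).
Proof. by move=> a0; rewrite line_count_swap gcdnC -(abszN n); exact: line_count_le_c. Qed.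

Lemma natr_absz (x : int) : (`|x|%N)%:R = `|x%:~R| :> R.
Proof. by rewrite -[LHS]/(`|x|%N%:Z%:~R) abszE intr_norm. Qed.

(** Each d admits at most one b, so the points on the line form a residue
    class of d modulo |c| / g in the interval whose length ell measures. *)
Lemma line_count_approx m (a c n : int) : (0 < m)%N -> a != 0 -> c != 0 ->
  `|line_count m a c n - (gcdn `|a| `|c| %| `|n|)%N%:R *
     ((gcdn `|a| `|c|)%:R * m%:R * ell `|a|%N%:R `|c|%N%:R (`|n|%N%:R / m%:R))| <= 2.
Proof.
move=> m0 a0 c0; rewrite line_count_d //; have g0 := gcdn_absz_gt0 a c0.
have [r hr] := congruence_class a n c0; set g := gcdn _ _ in hr g0 *.
have qg : ((`|c| %/ g) * g = `|c|)%N by rewrite divnK // dvdn_gcdr.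
have q0 : (0 < `|c| %/ g)%N by rewrite divn_gt0 // dvdn_leq ?dvdn_gcdr // absz_gt0.
have [h|h] := boolP (g %| `|n|)%N; last first.
  rewrite mul0r subr0 big1 ?normr0 // => d _; by rewrite hr (negbTE h).
rewrite mul1r; have mR : (0 : R) < m%:R by rewrite ltr0n.
pose x : R := `|a|%N%:R; pose y : R := `|c|%N%:R; pose s : R := Num.sg a%:~R.
have x0 : 0 < x by rewrite ltr0n absz_gt0.
have y0 : 0 < y by rewrite ltr0n absz_gt0.
pose t := s * n%:~R / m%:R.
have s1 : `|s| = 1 by rewrite normr_sg intr_eq0 a0.
have tE : `|t| = `|n|%N%:R / m%:R.
  by rewrite /t !normrM s1 mul1r normfV (gtr0_norm mR) natr_absz.
pose lo := m%:R * Num.max (- x) (t - y) / x; pose hi := m%:R * Num.min x (t + y) / x.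
have lo_ge : - m%:R <= lo.
  by rewrite ler_pdivlMr // mulNr -mulrN ler_pM2l // le_max lexx.
have hi_le : hi <= m%:R by rewrite ler_pdivrMr // ler_pM2l // ge_min lexx.
have key (d : int) : (`|d| <= m)%N ->
    ((absz (a * d - n)%R <= m * absz c)%N = (lo <= d%:~R) && (d%:~R <= hi)).
  move=> dm; have dR : `|d%:~R| <= m%:R :> R by rewrite -natr_absz ler_nat.
  rewrite -(ler_nat R) natrM natr_absz -/y.
  have -> : `|(a * d - n)%:~R| = `|x * d%:~R - m%:R * t|.
    have -> : x * d%:~R - m%:R * t = s * (a * d - n)%:~R.
      rewrite /t /x natr_absz normrEsg -/s rmorphB rmorphM /=.
      by field; rewrite gt_eqF.
    by rewrite normrM s1 mul1r.
  rewrite ler_pdivrMr // ler_pdivlMr //.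
  rewrite maxr_pMr ?(ltW mR) // minr_pMr ?(ltW mR) // ge_max le_min.
  have /andP[d1 d2] : (- m%:R <= d%:~R :> R) && (d%:~R <= m%:R :> R) by rewrite -ler_norml.
  have -> : m%:R * - x <= d%:~R * x by rewrite mulrN -mulNr ler_pM2r.
  have -> : d%:~R * x <= m%:R * x by rewrite ler_pM2r.
  rewrite ler_norml mulrBr mulrDr /= lerBrDl lerBlDl [x * _]mulrC.
  by rewrite !lerBlDl.
have := residue_count_interval r q0 lo_ge hi_le.
have -> : Num.max 0 (hi - lo) / (`|c| %/ g)%N%:R = g%:R * m%:R * ell x y (`|n|%N%:R / m%:R).
  rewrite /ell -tE -overlap_section // /hi /lo.
  rewrite [m%:R * _ / x]mulrAC [m%:R * Num.max _ _ / x]mulrAC -mulrBr.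
  have -> : Num.max 0 (m%:R / x * (Num.min x (t + y) - Num.max (- x) (t - y))) =
      m%:R / x * Num.max 0 (Num.min x (t + y) - Num.max (- x) (t - y)).
    by rewrite maxr_pMr ?divr_ge0 ?ltW // mulr0.
  have yE : y = (`|c| %/ g)%N%:R * g%:R by rewrite /y -{1}qg natrM.
  move: (Num.max _ _) => w; rewrite yE.
  have gR : (0 : R) < g%:R by rewrite ltr0n.
  have qR : (0 : R) < (`|c| %/ g)%N%:R by rewrite ltr0n.
  by field; rewrite !gt_eqF.
apply: le_trans; rewrite le_eqVlt; apply/orP; left; apply/eqP; congr (`|_ - _|).
apply: eq_big_seq => d; rewrite mem_zrange => dm; rewrite hr h key //=.
by rewrite andbC andbA.
Qed.

End LineCount.

(** * Fibres of the torsor over (a, c, z) *)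

Section Fibers.
Variable R : realType.

Definition maxsq (x y t : nat) : nat := maxn (x * x) (maxn (y * y) (t * t)).

Definition coprime3 (x y t : nat) : bool := gcdn (gcdn x y) t == 1%N.

Lemma maxsq_ge x y t : [/\ (x * x <= maxsq x y t)%N, (y * y <= maxsq x y t)%N
  & (t * t <= maxsq x y t)%N].
Proof. by rewrite /maxsq !leq_max !leqnn !orbT. Qed.

Lemma maxsq_gt0 x y t : coprime3 x y t -> (0 < maxsq x y t)%N.
Proof.
move=> /eqP h; rewrite lt0n; apply/eqP => e.
have [h1 h2 h3] := maxsq_ge x y t; rewrite e !leqn0 !muln_eq0 !orbb in h1 h2 h3.
by move: h; rewrite (eqP h1) (eqP h2) (eqP h3).
Qed.

(** The integral points (b, d, w) above (a, c, z) on the universal torsor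
    whose height is at most m^2. *)
Definition fiber_count (m : nat) (a c z : int) : R :=
  \sum_(1 <= w < m.+1 | (maxsq `|a| `|c| `|z| * w <= m)%N) line_count R m a c (z ^+ 3 * w%:Z).

Lemma sum_bounded_multiples (V : nmodType) (F : nat -> V) (q m : nat) : (0 < q)%N ->
  \sum_(1 <= w < m.+1 | (q * w <= m)%N) F w = \sum_(1 <= w < (m %/ q).+1) F w.
Proof.
move=> q0; rewrite (@big_nat_shrink V F (fun w => q * w <= m)%N (m %/ q)) ?leq_div //.
  rewrite big_nat_cond [RHS]big_nat_cond; apply: eq_bigl => w.
  by rewrite ltnS mulnC -leq_divRL //; case: (w <= _)%N; rewrite ?andbF ?andbT.
by move=> k /andP[h1 h2]; rewrite mulnC -leq_divRL // leqNgt h1.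
Qed.

Lemma le_sqrt (x y : R) : 0 <= x -> x * x <= y -> x <= Num.sqrt y.
Proof. by move=> x0 h; rewrite -[x]ger0_norm // -sqrtr_sqr ler_wsqrtr. Qed.

(** A multiple of g, weighted by g, stands for a block of g consecutive terms,
    with an error of at most one block: g B. As both sums are at most W B, the
    error is at most the geometric mean of these bounds. *)
Lemma sum_multiples_antitone (phi : nat -> R) (B : R) (g W : nat) : (0 < g)%N ->
  (forall w, (0 < w)%N -> 0 <= phi w <= B) ->
  (forall w w', (0 < w <= w')%N -> phi w' <= phi w) ->
  `|\sum_(1 <= j < (W %/ g).+1) g%:R * phi (g * j)%N - \sum_(1 <= w < W.+1) phi w|
    <= Num.sqrt (g%:R * W%:R) * B.
Proof.
move=> g0 hB anti; have B0 : 0 <= B by have /andP[h1 h2] := hB 1%N isT; exact: le_trans h2.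
pose S n := \sum_(1 <= w < n.+1) phi w.
have S0 : S 0%N = 0 by rewrite /S big_geq.
have Smono n k : (n <= k)%N -> S n <= S k.
  move=> nk; rewrite /S [leRHS](@big_cat_nat _ _ _ n.+1) //= lerDl big_nat_cond.
  by apply: sumr_ge0 => w /andP[/andP[h _] _]; have /andP[] := hB w (leq_trans (ltn0Sn n) h).
have block n : S (g * n.+1)%N = S (g * n)%N + \sum_(g * n <= i < g * n + g) phi i.+1.
  rewrite /S (@big_cat_nat _ _ _ (g * n).+1) //=; last by rewrite ltnS leq_pmul2l.
  by congr (_ + _); rewrite big_add1 /= mulnSr.
have cstsum (x : R) n : \sum_(g * n <= i < g * n + g) x = g%:R * x.
  by rewrite sumr_const_nat addnC addnK mulr_natl.
pose J n := \sum_(1 <= j < n.+1) g%:R * phi (g * j)%N.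
have JS n : J n.+1 = J n + g%:R * phi (g * n.+1)%N by rewrite /J big_nat_recr.
have J0 : J 0%N = 0 by rewrite /J big_geq.
have low n : J n <= S (g * n)%N.
  elim: n => [|n IH]; first by rewrite J0 muln0 S0.
  rewrite JS block lerD // -(cstsum _ n) big_nat [leRHS]big_nat.
  apply: ler_sum => i /andP[h1 h2]; apply: anti; rewrite mulnSr; lia.
have up n : S (g * n.+1)%N <= g%:R * B + J n.
  elim: n => [|n IH].
    rewrite block muln0 S0 add0r J0 addr0 -{2}(muln0 g) -(cstsum _ 0%N) muln0 add0n.
    by apply: ler_sum => i _; have /andP[] := hB i.+1 isT.
  rewrite block JS addrA lerD // -(cstsum _ n.+1) big_nat [leRHS]big_nat.
  by apply: ler_sum => i /andP[h1 h2]; apply: anti; lia.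
set n := (W %/ g)%N; have nW : (g * n <= W)%N by rewrite mulnC leq_trunc_div.
have Wn : (W <= g * n.+1)%N by rewrite mulnC ltnW // ltn_ceil.
have WB : S W <= W%:R * B.
  apply: (@le_trans _ _ (\sum_(1 <= w < W.+1) B)); last by rewrite sumr_const_nat subn1 mulr_natl.
  by rewrite /S !big_nat; apply: ler_sum => w /andP[h _]; have /andP[] := hB w h.
have h1 : J n <= S W by apply: le_trans (low n) (Smono _ _ nW).
have h2 : S W <= g%:R * B + J n by apply: le_trans (Smono _ _ Wn) (up n).
have Jn0 : 0 <= J n.
  rewrite /J big_nat; apply: sumr_ge0 => j /andP[hj _]; rewrite mulr_ge0 //.
  by have /andP[] := hB (g * j)%N (ltac:(by rewrite muln_gt0 g0)).
rewrite -/(J n) -/(S W) distrC ger0_norm ?subr_ge0 //.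
have [gW|Wg] := leP (g%:R : R) W%:R.
  apply: (@le_trans _ _ (g%:R * B)); first by lra.
  by rewrite ler_wpM2r // le_sqrt // ler_wpM2l.
apply: (@le_trans _ _ (W%:R * B)); first by lra.
by rewrite ler_wpM2r // le_sqrt // ler_wpM2r // ltW.
Qed.

Lemma gcd_dvd_cube (a c z : int) (w : nat) : coprime3 `|a| `|c| `|z| ->
  (gcdn `|a| `|c| %| absz (z ^+ 3 * w%:Z)%R)%N = (gcdn `|a| `|c| %| w)%N.
Proof.
move=> /eqP cop; rewrite abszM abszX /= Gauss_dvdr //.
by rewrite coprimeXr // /coprime cop.
Qed.

Section OneFiber.
Variables (m : nat) (a c z : int).
Hypothesis cop : coprime3 `|a| `|c| `|z|.
Let g := gcdn `|a| `|c|.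
Let N := maxn `|a| `|c|.
Let W := (m %/ maxsq `|a| `|c| `|z|)%N.

Lemma fiber_countE : fiber_count m a c z = \sum_(1 <= w < W.+1) line_count R m a c (z ^+ 3 * w%:Z).
Proof. by rewrite /fiber_count sum_bounded_multiples // maxsq_gt0. Qed.

Lemma line_count_le (w : nat) : (0 < N)%N -> (0 < w)%N ->
  line_count R m a c (z ^+ 3 * w%:Z) <= (g %| w)%N%:R * ((2 * m).+1%:R * g%:R / N%:R + 1).
Proof.
move=> N0 w0; rewrite -(gcd_dvd_cube w cop).
have [h|h] := leqP `|a| `|c|.
  have -> : N = `|c|%N by exact/maxn_idPr.
  by apply: line_count_le_c; rewrite -absz_gt0 (leq_trans N0) // geq_max h leqnn.
have -> : N = `|a|%N by exact/maxn_idPl/ltnW.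
by apply: line_count_le_a; rewrite -absz_gt0 (leq_ltn_trans _ h).
Qed.

(** Only multiples w of g contribute, and each of these lines carries O(g m /
    N) points. *)
Lemma fiber_count_le : (0 < N)%N -> fiber_count m a c z <= 4 * m%:R * W%:R / N%:R.
Proof.
move=> N0; rewrite fiber_countE; have NR : (0 : R) < N%:R by rewrite ltr0n.
have g0 : (0 < g)%N by move: N0; rewrite /g gcdn_gt0 leq_max.
have gR : (0 : R) < g%:R by rewrite ltr0n.
have [->|W0] := posnP W; first by rewrite big_geq // mulr0 mul0r.
have Nm : (N <= m)%N.
  have : (N * N <= m)%N.
    have : (maxsq `|a| `|c| `|z| * W <= m)%N by rewrite mulnC leq_trunc_div.
    have [h1 h2 _] := maxsq_ge `|a| `|c| `|z|.
    have hN : (N * N <= maxsq `|a| `|c| `|z|)%N by rewrite /N; case: (leqP `|a| `|c|) => _.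
    by apply: leq_trans; apply: leq_trans hN _; exact: leq_pmulr.
  by apply: leq_trans; exact: leq_pmulr.
set D := (2 * m).+1%:R * g%:R / N%:R + 1 : R.
have D0 : 0 <= D by rewrite addr_ge0 // divr_ge0 // mulr_ge0.
apply: (@le_trans _ _ (\sum_(1 <= w < W.+1) (g %| w)%N%:R * D)).
  by rewrite !big_nat; apply: ler_sum => w /andP[w0 _]; exact: line_count_le.
rewrite -mulr_suml.
have -> : \sum_(1 <= w < W.+1) (g %| w)%N%:R = (W %/ g)%N%:R :> R.
  have := @big_nat_multiples R (fun=> 1) g W g0; rewrite big_mkcond /= sumr_const_nat subn1 /= => <-.
  by apply: eq_bigr => w _; case: ifP.
have h1 : (W %/ g)%N%:R * g%:R <= W%:R :> R by rewrite -natrM ler_nat leq_trunc_div.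
have h2 : (W %/ g)%N%:R <= W%:R :> R by rewrite ler_nat leq_div.
have m1 : (1 : R) <= m%:R by rewrite ler1n (leq_trans N0).
have NmR : N%:R <= m%:R :> R by rewrite ler_nat.
have mE : (2 * m).+1%:R = 2 * m%:R + 1 :> R by rewrite -addn1 natrD natrM.
rewrite /D mulrDr mulr1 ler_pdivlMr // mulrDl.
have -> : (W %/ g)%N%:R * ((2 * m).+1%:R * g%:R / N%:R) * N%:R =
    ((W %/ g)%N%:R * g%:R) * (2 * m).+1%:R :> R by field; rewrite gt_eqF.
rewrite mE; have W0' : (0 : R) <= W%:R by [].
have e1 : (W %/ g)%N%:R * g%:R * (2 * m%:R + 1) <= W%:R * (3 * m%:R) :> R.
  by apply: ler_pM => //; lra.
have e2 : (W %/ g)%N%:R * N%:R <= W%:R * m%:R :> R by exact: ler_pM.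
lra.
Qed.

(** The expected number of points divided by m. It does not involve gcd(a, c),
    since only one line in gcd(a, c) is occupied, by gcd(a, c) times as many
    points. *)
Definition fiber_main : R :=
  \sum_(1 <= w < W.+1) ell `|a|%N%:R `|c|%N%:R (`|z|%N%:R ^+ 3 * w%:R / m%:R).

Lemma fiber_count_approx : (0 < m)%N -> a != 0 -> c != 0 ->
  `|fiber_count m a c z - m%:R * fiber_main| <=
    2 * W%:R + 2 * m%:R * Num.sqrt (g%:R * W%:R) / N%:R.
Proof.
move=> m0 a0 c0; have g0 : (0 < g)%N by exact: gcdn_absz_gt0.
have mR : (0 : R) < m%:R by rewrite ltr0n.
have xR : (0 : R) < `|a|%N%:R by rewrite ltr0n absz_gt0.
have yR : (0 : R) < `|c|%N%:R by rewrite ltr0n absz_gt0.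
pose phi (w : nat) : R := ell `|a|%N%:R `|c|%N%:R (`|z|%N%:R ^+ 3 * w%:R / m%:R).
have NR : (0 : R) < N%:R by rewrite ltr0n leq_max absz_gt0 a0.
have phiB w : 0 <= phi w <= 2 / N%:R.
  rewrite ell_ge0 //= /N; case: (leqP `|a| `|c|) => _; [exact: ell_le_r|exact: ell_le_l].
have anti w w' : (0 < w <= w')%N -> phi w' <= phi w.
  move=> /andP[_ ww]; apply: ell_antitone => //.
  by rewrite ler_pM2r ?invr_gt0 // ler_wpM2l ?exprn_ge0 // ler_nat.
have h1 := sum_multiples_antitone W g0 (fun w _ => phiB w) anti.
pose A := \sum_(1 <= w < W.+1) (g %| w)%N%:R * (g%:R * m%:R * phi w).
have AE : A = m%:R * \sum_(1 <= j < (W %/ g).+1) g%:R * phi (g * j)%N.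
  rewrite -(@big_nat_multiples R (fun w => g%:R * phi w) g W g0) mulr_sumr [RHS]big_mkcond.
  apply: eq_bigr => w _; case: ifP => _; rewrite ?mul0r ?mul1r //; ring.
have h2 : `|fiber_count m a c z - A| <= 2 * W%:R.
  rewrite fiber_countE /A -sumrB; apply: le_trans (ler_norm_sum _ _ _) _.
  apply: (@le_trans _ _ (\sum_(1 <= w < W.+1) 2)); last first.
    by rewrite sumr_const_nat subn1 /= mulr_natr.
  apply: ler_sum => w _; rewrite /phi -(gcd_dvd_cube w cop).
  have := line_count_approx R (z ^+ 3 * w%:Z) m0 a0 c0.
  by rewrite abszM abszX /= natrM natrX.
rewrite -(subrK A (fiber_count _ _ _ _)) -addrA; apply: le_trans (ler_normD _ _) _.
apply: lerD => //; rewrite AE /fiber_main -mulrBr normrM (gtr0_norm mR).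
apply: le_trans (ler_wpM2l (ltW mR) h1) _; rewrite le_eqVlt; apply/orP; left; apply/eqP.
by field; rewrite gt_eqF.
Qed.

(** Over (0, 0, 1) and (0, 0, -1) the equation forces w = 0. *)
Lemma fiber_count_vertical : N = 0%N -> fiber_count m a c z = 0.
Proof.
move=> /eqP; rewrite /N -leqn0 geq_max !leqn0 !absz_eq0 => /andP[/eqP a0 /eqP c0].
have z0 : z != 0.
  by move: cop; rewrite a0 c0 /coprime3 /= gcd0n; apply: contraTneq => ->.
rewrite fiber_countE big_nat big1 // => w /andP[w0 _].
rewrite /line_count big1 // => b _; rewrite big1 // => d _.
rewrite a0 c0 mul0r mulr0 subr0 eq_sym mulf_eq0 expf_eq0 (negbTE z0) /=.
by have -> : (w%:Z == 0) = false by lia.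
Qed.

End OneFiber.
End Fibers.

(** * Summation of the error terms *)

Section ErrorSums.
Variable R : realType.

Definition pow34 (k : nat) : R := Num.sqrt (Num.sqrt k%:R) ^+ 3.

Lemma pow34M j k : pow34 (j * k) = pow34 j * pow34 k.
Proof. by rewrite /pow34 natrM !sqrtrM ?sqrtr_ge0 // exprMn. Qed.

Lemma pow34_ge0 k : 0 <= pow34 k.
Proof. by rewrite exprn_ge0 // sqrtr_ge0. Qed.

Lemma pow34_sqr k : pow34 k * pow34 k = k%:R * Num.sqrt k%:R.
Proof.
rewrite -expr2 -exprM (exprM _ 2 3) sqr_sqrtr ?sqrtr_ge0 // exprS mulrC.
by rewrite sqr_sqrtr.
Qed.

(** Bound the square root of gcd(x, y) by the sum of the square roots of all
    common divisors d; for fixed d the double sum is a square. *)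
Lemma sum_sqrt_gcd (K : nat) :
  \sum_(1 <= x < K.+1) \sum_(1 <= y < K.+1) Num.sqrt (gcdn x y)%:R * ((pow34 x)^-1 * (pow34 y)^-1)
    <= 48 * Num.sqrt K%:R :> R.
Proof.
have pos x y : 0 <= (pow34 x)^-1 * (pow34 y)^-1 by rewrite mulr_ge0 // invr_ge0 pow34_ge0.
pose S d := \sum_(1 <= x < K.+1 | (d %| x)%N) (pow34 x)^-1.
apply: (@le_trans _ _ (\sum_(1 <= d < K.+1) Num.sqrt d%:R * (S d * S d))).
  apply: (@le_trans _ _ (\sum_(1 <= x < K.+1) \sum_(1 <= y < K.+1) \sum_(1 <= d < K.+1)
     (if (d %| x)%N then (if (d %| y)%N then Num.sqrt d%:R * ((pow34 x)^-1 * (pow34 y)^-1) else 0) else 0))).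
    rewrite !big_nat; apply: ler_sum => x /andP[x0 xK]; rewrite !big_nat.
    apply: ler_sum => y /andP[y0 yK].
    have g0 : (0 < gcdn x y)%N by rewrite gcdn_gt0 x0.
    have gK : (gcdn x y < K.+1)%N by apply: leq_ltn_trans xK; rewrite dvdn_leq ?dvdn_gcdl.
    rewrite (bigD1_seq (gcdn x y)) ?mem_index_iota ?g0 ?iota_uniq //= dvdn_gcdl dvdn_gcdr lerDl.
    by apply: sumr_ge0 => d _; case: ifP => // _; case: ifP => // _; rewrite mulr_ge0 ?sqrtr_ge0.
  rewrite le_eqVlt; apply/orP; left; apply/eqP.
  under eq_bigr do rewrite exchange_big /=.
  rewrite exchange_big /=; apply: eq_bigr => d _.
  rewrite /S mulr_suml mulr_sumr big_mkcond [RHS]big_mkcond /= -[RHS]big_mkcond /= [RHS]big_mkcond.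
  apply: eq_bigr => x _; case: ifP => _; last by rewrite big1.
  by rewrite mulr_sumr mulr_sumr [RHS]big_mkcond.
apply: (@le_trans _ _ (\sum_(1 <= d < K.+1) 16 * Num.sqrt K%:R * (d%:R * Num.sqrt d%:R)^-1)); last first.
  rewrite -mulr_sumr; have := sum_inv_3half R K; have := sqrtr_ge0 (K%:R : R).
  by move: (Num.sqrt _) (\sum_(_ <= _ < _) _) => u v u0 v3; nra.
rewrite !big_nat; apply: ler_sum => d /andP[d0 _].
have sd := sqrt_nat_gt0 R d0; have qd : 0 < pow34 d by rewrite exprn_gt0 // sqrtr_gt0.
have SE : S d = (pow34 d)^-1 * \sum_(1 <= k < (K %/ d).+1) (pow34 k)^-1.
  rewrite /S big_nat_multiples // mulr_sumr; apply: eq_bigr => k _.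
  by rewrite pow34M invfM.
have : \sum_(1 <= k < (K %/ d).+1) (pow34 k)^-1 <= 4 * Num.sqrt (Num.sqrt (K %/ d)%N%:R) by exact: sum_inv_sqrt4.
have : 0 <= \sum_(1 <= k < (K %/ d).+1) (pow34 k)^-1 :> R.
  by apply: sumr_ge0 => k _; rewrite invr_ge0 pow34_ge0.
rewrite SE; move: (\sum_(_ <= _ < _) _) => s s0 s4.
have ss : s * s <= 16 * Num.sqrt (K %/ d)%N%:R.
  have -> : 16 * Num.sqrt (K %/ d)%N%:R = (4 * Num.sqrt (Num.sqrt (K %/ d)%N%:R)) * (4 * Num.sqrt (Num.sqrt (K %/ d)%N%:R)) :> R.
    by rewrite mulrACA -[Num.sqrt (Num.sqrt _) * _]expr2 sqr_sqrtr ?sqrtr_ge0 // -natrM.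
  exact: ler_pM.
have sK : Num.sqrt (K %/ d)%N%:R * Num.sqrt d%:R <= Num.sqrt K%:R :> R.
  by rewrite -sqrtrM // ler_wsqrtr // -natrM ler_nat leq_trunc_div.
have -> : Num.sqrt d%:R * ((pow34 d)^-1 * s * ((pow34 d)^-1 * s)) =
    (Num.sqrt d%:R * (s * s)) / (pow34 d * pow34 d) by field; rewrite gt_eqF.
rewrite pow34_sqr ler_wpM2r //.
apply: le_trans (ler_wpM2l (ltW sd) ss) _; nra.
Qed.

Lemma sum3_prod (P Q S : nat -> R) n :
  \sum_(0 <= x < n) \sum_(0 <= y < n) \sum_(0 <= t < n) P x * Q y * S t =
  (\sum_(0 <= x < n) P x) * (\sum_(0 <= y < n) Q y) * (\sum_(0 <= t < n) S t).
Proof.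
rewrite !mulr_suml; apply: eq_bigr => x _.
rewrite [X in _ = X * _]mulr_sumr mulr_suml; apply: eq_bigr => y _.
by rewrite mulr_sumr.
Qed.

(** k^(-3/2), except for the value 1 at k = 0, which stands for a vanishing
    coordinate. *)
Definition inv32 (k : nat) : R := if k is 0%N then 1 else (k%:R * Num.sqrt k%:R)^-1.

Lemma sum_inv32 n : \sum_(0 <= k < n.+1) inv32 k <= 4.
Proof.
rewrite big_ltn //; have := sum_inv_3half R n.
have -> : \sum_(1 <= i < n.+1) inv32 i = \sum_(1 <= k < n.+1) (k%:R * Num.sqrt k%:R)^-1.
  by rewrite !big_add1; apply: eq_bigr.
by rewrite /=; lra.
Qed.

(** The contribution of a fibre over (a, c, z) with absolute values x, y, t
    that is not accounted for by the section lengths. *)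
Definition fiber_error (m x y t : nat) : R :=
  let W := (m %/ maxsq x y t)%N in let N := maxn x y in
  if (x * y * t == 0)%N then 4 * m%:R * W%:R / N%:R
  else 2 * W%:R + 2 * m%:R * Num.sqrt ((gcdn x y)%:R * W%:R) / N%:R.

Lemma fiber_error_ge0 m x y t : 0 <= fiber_error m x y t.
Proof.
rewrite /fiber_error; case: ifP => _; first by rewrite divr_ge0 // !mulr_ge0.
by rewrite addr_ge0 ?mulr_ge0 ?invr_ge0 ?sqrtr_ge0.
Qed.

Lemma sqrt_le_maxsq x y t (k : nat) : (k * k <= maxsq x y t)%N -> k%:R <= Num.sqrt (maxsq x y t)%:R :> R.
Proof. by move=> h; rewrite le_sqrt // -natrM ler_nat. Qed.

Lemma natr_sqrt (k : nat) : Num.sqrt k%:R * Num.sqrt k%:R = k%:R :> R.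
Proof. by rewrite -expr2 sqr_sqrtr. Qed.

Lemma sqrt_sqrt4 (k : nat) : Num.sqrt (Num.sqrt k%:R) * Num.sqrt (Num.sqrt k%:R) = Num.sqrt k%:R :> R.
Proof. by rewrite -expr2 sqr_sqrtr ?sqrtr_ge0. Qed.

(** With M = maxsq x y t and N = max(x, y) > 0, the product M N is at least
    the power 3/2 of the product of the nonzero coordinates: there is at most
    one besides N, and both are at most sqrt M. *)
Lemma degenerate_error (m x y t : nat) : (x * y * t == 0)%N ->
  fiber_error m x y t <= 4 * m%:R ^+ 2 * (inv32 x * inv32 y * inv32 t).
Proof.
move=> e; rewrite /fiber_error e; set N := maxn x y; set M := maxsq x y t.
have i0 k : 0 <= inv32 k by case: k => // k; rewrite invr_ge0 mulr_ge0 ?sqrtr_ge0.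
have rhs0 : 0 <= inv32 x * inv32 y * inv32 t by rewrite !mulr_ge0.
have [->|N0] := posnP N; first by rewrite invr0 mulr0 !mulr_ge0.
have [M1 M2 M3] := maxsq_ge x y t; rewrite -/M in M1 M2 M3.
have NM : (N * N <= M)%N by rewrite /N; case: (leqP x y).
have M0 : (0 < M)%N by apply: leq_trans NM; rewrite muln_gt0 N0.
have MR : (0 : R) < M%:R by rewrite ltr0n.
have NR : (0 : R) < N%:R by rewrite ltr0n.
have WM : (m %/ M)%N%:R <= m%:R / M%:R :> R.
  by rewrite ler_pdivlMr // -natrM ler_nat leq_trunc_div.
suff key : (M%:R * N%:R)^-1 <= inv32 x * inv32 y * inv32 t.
  apply: (@le_trans _ _ (4 * m%:R ^+ 2 * (M%:R * N%:R)^-1)); last first.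
    by rewrite ler_wpM2l // mulr_ge0 // exprn_ge0.
  have -> : 4 * m%:R ^+ 2 / (M%:R * N%:R) = 4 * m%:R * (m%:R / M%:R / N%:R) :> R.
    by field; rewrite !gt_eqF.
  by rewrite -[leLHS]mulrA ler_wpM2l ?mulr_ge0 // ler_wpM2r // invr_ge0 ltW.
have sN : (1 : R) <= N%:R by rewrite ler1n.
pose T (k : nat) : R := if k is 0%N then 1 else k%:R * Num.sqrt k%:R.
have iE k : inv32 k = (T k)^-1 by case: k => //=; rewrite invr1.
have T0 k : 0 < T k by case: k => //= k; rewrite mulr_gt0 ?ltr0n // sqrt_nat_gt0.
rewrite !iE -!invfM lef_pV2 ?posrE ?mulr_gt0 //.
have Tmono (k n : nat) : (0 < n)%N -> (k <= n)%N -> T k <= n%:R * Num.sqrt n%:R.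
  case: k => [|k] n0 kn /=.
    by apply: mulr_ege1; [rewrite ler1n|exact: sqrt_nat_ge1].
  by apply: ler_pM; rewrite ?sqrtr_ge0 ?ler_nat // ler_wsqrtr // ler_nat.
pose r := Num.sqrt M%:R : R; have rr : r * r = M%:R by exact: natr_sqrt.
have r0 : 0 <= r by exact: sqrtr_ge0.
have Nr : N%:R <= r by exact: sqrt_le_maxsq.
have tr : t%:R <= r by exact: sqrt_le_maxsq.
have r1 : 1 <= r by exact: le_trans Nr.
(* one of x, y vanishes: the other one is N *)
have case0 (u v : R) : u = 1 -> v = N%:R * Num.sqrt N%:R -> u * v * T t <= M%:R * N%:R.
  move=> -> ->; rewrite mul1r -mulrA [M%:R * _]mulrC ler_pM2l //.
  have h : T t <= r * Num.sqrt r.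
    case: (t) tr => [|k] tr /=.
      by apply: mulr_ege1 => //; rewrite -[1]sqrtr1 ler_wsqrtr.
    by apply: ler_pM; rewrite ?sqrtr_ge0 // ler_wsqrtr.
  have h2 : Num.sqrt N%:R <= Num.sqrt r by rewrite ler_wsqrtr.
  apply: le_trans (ler_pM _ _ h2 h) _; rewrite ?sqrtr_ge0 ?(ltW (T0 _)) //.
  by rewrite mulrCA -[Num.sqrt r * _]expr2 sqr_sqrtr // rr.
move: e; rewrite !muln_eq0 => /orP[/orP[/eqP x0|/eqP y0]|/eqP t0].
- apply: case0; first by rewrite x0.
  have <- : y = N by rewrite /N x0 max0n.
  by move: N0; rewrite /N x0 max0n; case: (y).
- rewrite [T x * _]mulrC; apply: case0; first by rewrite y0.
  have <- : x = N by rewrite /N y0 maxn0.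
  by move: N0; rewrite /N y0 maxn0; case: (x).
rewrite t0 /= mulr1.
have xN : (x <= N)%N by rewrite leq_maxl. have yN : (y <= N)%N by rewrite leq_maxr.
apply: (le_trans (ler_pM (ltW (T0 _)) (ltW (T0 _)) (Tmono _ _ N0 xN) (Tmono _ _ N0 yN))).
by rewrite mulrACA natr_sqrt ler_wpM2r // -natrM ler_nat.
Qed.

(** Use M >= x y for the first term; for the second one sqrt M >= sqrt N sqrt
    t and N sqrt N >= (x y)^(3/4). *)
Lemma generic_error (m x y t : nat) : (x * y * t != 0)%N ->
  fiber_error m x y t <= 2 * m%:R / (x%:R * y%:R) +
    2 * m%:R * Num.sqrt m%:R *
     (Num.sqrt (gcdn x y)%:R * ((pow34 x)^-1 * (pow34 y)^-1) * (Num.sqrt t%:R)^-1).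
Proof.
move=> e; rewrite /fiber_error (negbTE e); set N := maxn x y; set M := maxsq x y t.
move: e; rewrite -lt0n !muln_gt0 => /andP[/andP[x0 y0] t0].
have [M1 M2 M3] := maxsq_ge x y t; rewrite -/M in M1 M2 M3.
have NM : (N * N <= M)%N by rewrite /N; case: (leqP x y).
have N0 : (0 < N)%N by rewrite leq_max x0.
have M0 : (0 < M)%N by apply: leq_trans M1; rewrite muln_gt0 x0.
have MR : (0 : R) < M%:R by rewrite ltr0n.
have NR : (0 : R) < N%:R by rewrite ltr0n.
have xR : (0 : R) < x%:R by rewrite ltr0n. have yR : (0 : R) < y%:R by rewrite ltr0n.
have WM : (m %/ M)%N%:R <= m%:R / M%:R :> R.
  by rewrite ler_pdivlMr // -natrM ler_nat leq_trunc_div.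
pose r := Num.sqrt M%:R : R; have rr : r * r = M%:R by exact: natr_sqrt.
have r0 : 0 < r by rewrite sqrtr_gt0.
have Nr : N%:R <= r by exact: sqrt_le_maxsq.
have tr : t%:R <= r by exact: sqrt_le_maxsq.
have xN : x%:R <= N%:R :> R by rewrite ler_nat leq_maxl.
have yN : y%:R <= N%:R :> R by rewrite ler_nat leq_maxr.
apply: lerD.
  rewrite -mulrA ler_wpM2l //; apply: le_trans WM _.
  rewrite ler_wpM2l // lef_pV2 ?posrE ?mulr_gt0 // -rr.
  by apply: ler_pM; rewrite ?(ltW xR) ?(ltW yR) ?(le_trans xN) ?(le_trans yN).
have sW : Num.sqrt (m %/ M)%N%:R <= Num.sqrt m%:R / r.
  by rewrite ler_pdivlMr // -sqrtrM // ler_wsqrtr // -natrM ler_nat leq_trunc_div.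
rewrite sqrtrM // -!mulrA ler_wpM2l // ler_wpM2l //.
rewrite [leRHS]mulrCA ler_wpM2l ?sqrtr_ge0 //.
apply: (@le_trans _ _ (Num.sqrt m%:R / r / N%:R)); first by rewrite ler_wpM2r // invr_ge0 ltW.
rewrite -mulrA ler_wpM2l ?sqrtr_ge0 // -!invfM lef_pV2 ?posrE; last 2 first.
- by rewrite mulr_gt0.
- by rewrite !mulr_gt0 ?exprn_gt0 ?sqrtr_gt0 ?ltr0n.
have q k : 0 <= Num.sqrt k :> R by exact: sqrtr_ge0.
have hN : pow34 x * pow34 y <= N%:R * Num.sqrt N%:R.
  rewrite -pow34_sqr; apply: ler_pM; rewrite ?pow34_ge0 //;
  by rewrite lerXn2r ?nnegrE // ler_wsqrtr // ler_wsqrtr // ler_nat (leq_maxl, leq_maxr).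
rewrite mulrA; apply: (@le_trans _ _ (N%:R * Num.sqrt N%:R * Num.sqrt t%:R)).
  by rewrite ler_wpM2r.
rewrite -mulrA [leRHS]mulrC ler_pM2l //.
apply: (@le_trans _ _ (Num.sqrt r * Num.sqrt r)); last by rewrite -expr2 sqr_sqrtr // ltW.
by apply: ler_pM => //; rewrite ler_wsqrtr.
Qed.

Lemma sum_fiber_error (m K : nat) : (K * K <= m)%N ->
  \sum_(0 <= x < K.+1) \sum_(0 <= y < K.+1) \sum_(0 <= t < K.+1) fiber_error m x y t
   <= 512 * m%:R ^+ 2.
Proof.
move=> Km.
pose A x y t : R := inv32 x * inv32 y * inv32 t.
pose B x y (t : nat) : R := x%:R^-1 * y%:R^-1 * (t != 0)%N%:R.
pose C x y t : R := Num.sqrt (gcdn x y)%:R * ((pow34 x)^-1 * (pow34 y)^-1) * (Num.sqrt t%:R)^-1.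
have A0 x y t : 0 <= A x y t.
  have i0 k : 0 <= inv32 k by case: k => // k; rewrite invr_ge0 mulr_ge0 ?sqrtr_ge0.
  by rewrite !mulr_ge0.
have B0 x y t : 0 <= B x y t by rewrite !mulr_ge0 ?invr_ge0.
have C0 x y t : 0 <= C x y t by rewrite !mulr_ge0 ?invr_ge0 ?pow34_ge0 ?sqrtr_ge0.
pose D : R := 2 * m%:R * Num.sqrt m%:R.
have D0 : 0 <= D by rewrite !mulr_ge0 ?sqrtr_ge0.
have m2 : 0 <= 4 * m%:R ^+ 2 :> R by rewrite mulr_ge0 // exprn_ge0.
have mB : 0 <= 2 * m%:R :> R by rewrite mulr_ge0.
have pw x y t : fiber_error m x y t <= 4 * m%:R ^+ 2 * A x y t + 2 * m%:R * B x y t + D * C x y t.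
  have [e|e] := boolP (x * y * t == 0)%N.
    apply: le_trans (degenerate_error m e) _; rewrite -addrA lerDl addr_ge0 // mulr_ge0 //.
  apply: le_trans (generic_error m e) _; rewrite -addrA; apply: (le_trans _ (lerD (mulr_ge0 m2 (A0 x y t)) (lexx _))).
  rewrite add0r /D -!mulrA lerD2r /B.
  by move: e; rewrite !muln_eq0 !negb_or => /andP[_ ->]; rewrite mulr1 invfM.
have sumE (F : nat -> nat -> nat -> R) (k : R) :
   \sum_(0 <= x < K.+1) \sum_(0 <= y < K.+1) \sum_(0 <= t < K.+1) k * F x y t =
   k * \sum_(0 <= x < K.+1) \sum_(0 <= y < K.+1) \sum_(0 <= t < K.+1) F x y t.
  by rewrite mulr_sumr; apply: eq_bigr => x _; rewrite mulr_sumr; apply: eq_bigr => y _; rewrite mulr_sumr.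
apply: (@le_trans _ _ (\sum_(0 <= x < K.+1) \sum_(0 <= y < K.+1) \sum_(0 <= t < K.+1)
   (4 * m%:R ^+ 2 * A x y t + 2 * m%:R * B x y t + D * C x y t))).
  by apply: ler_sum => x _; apply: ler_sum => y _; apply: ler_sum => t _; exact: pw.
under eq_bigr do under eq_bigr do rewrite !big_split /=.
under eq_bigr do rewrite !big_split /=.
rewrite !big_split /= !sumE.
have hA : \sum_(0 <= x < K.+1) \sum_(0 <= y < K.+1) \sum_(0 <= t < K.+1) A x y t <= 64.
  rewrite sum3_prod; have := sum_inv32 K.
  have : 0 <= \sum_(0 <= k < K.+1) inv32 k.
    by apply: sumr_ge0 => k _; case: k => // k; rewrite invr_ge0 mulr_ge0 ?sqrtr_ge0.
  move: (\sum_(_ <= _ < _) _) => s s0 s4.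
  have s16 : s * s <= 16 by nra.
  have := mulr_ge0 s0 s0; nra.
have KR : (K%:R * K%:R <= m%:R :> R) by rewrite -natrM ler_nat.
have hB : \sum_(0 <= x < K.+1) \sum_(0 <= y < K.+1) \sum_(0 <= t < K.+1) B x y t <= 16 * m%:R.
  rewrite sum3_prod.
  have -> : \sum_(0 <= x < K.+1) x%:R^-1 = \sum_(k < K) (k.+1%:R)^-1 :> R.
    by rewrite big_ltn // invr0 add0r big_add1 big_mkord.
  have -> : \sum_(0 <= t < K.+1) (t != 0)%N%:R = K%:R :> R.
    by rewrite big_ltn // add0r big_add1 /= sumr_const_nat subn0.
  rewrite -expr2; apply: le_trans (ler_wpM2r _ (harmonic_sqr_le R K)) _ => //.
  rewrite -mulrA ler_wpM2l //; case: (posnP K) => [->|K0]; first by rewrite mulr0.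
  apply: le_trans KR; rewrite ler_wpM2r //.
  by rewrite -[leRHS]natr_sqrt ler_peMr ?sqrtr_ge0 // sqrt_nat_ge1.
have hC : \sum_(0 <= x < K.+1) \sum_(0 <= y < K.+1) \sum_(0 <= t < K.+1) C x y t <= 96 * K%:R.
  have -> : \sum_(0 <= x < K.+1) \sum_(0 <= y < K.+1) \sum_(0 <= t < K.+1) C x y t =
    (\sum_(1 <= x < K.+1) \sum_(1 <= y < K.+1) Num.sqrt (gcdn x y)%:R * ((pow34 x)^-1 * (pow34 y)^-1)) *
    \sum_(1 <= t < K.+1) (Num.sqrt t%:R)^-1.
    have p0 : (pow34 0)^-1 = 0 by rewrite /pow34 !sqrtr0 expr0n invr0.
    rewrite big_ltn // [X in X + _]big1 ?add0r; last first.
      by move=> y _; rewrite big1 // => t _; rewrite /C p0 mul0r mulr0 mul0r.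
    rewrite mulr_suml; apply: eq_bigr => x _.
    rewrite big_ltn // [X in X + _]big1 ?add0r; last first.
      by move=> t _; rewrite /C p0 mulr0 mulr0 mul0r.
    rewrite mulr_suml; apply: eq_bigr => y _.
    by rewrite big_ltn // {1}/C sqrtr0 invr0 mulr0 add0r mulr_sumr.
  have h1 := sum_sqrt_gcd K; have h2 := sum_inv_sqrt R K.
  have p1 : 0 <= \sum_(1 <= t < K.+1) (Num.sqrt t%:R)^-1 :> R.
    by apply: sumr_ge0 => t _; rewrite invr_ge0 sqrtr_ge0.
  have p2 : 0 <= \sum_(1 <= x < K.+1) \sum_(1 <= y < K.+1) Num.sqrt (gcdn x y)%:R * ((pow34 x)^-1 * (pow34 y)^-1) :> R.
    apply: sumr_ge0 => x _; apply: sumr_ge0 => y _.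
    by rewrite !mulr_ge0 ?invr_ge0 ?pow34_ge0 ?sqrtr_ge0.
  apply: le_trans (ler_pM p2 p1 h1 h2) _.
  by rewrite mulrACA natr_sqrt; lra.
have hK : Num.sqrt m%:R * K%:R <= m%:R :> R.
  rewrite -[leRHS]natr_sqrt ler_wpM2l ?sqrtr_ge0 // le_sqrt //.
have hDC : D * (96 * K%:R) <= 192 * m%:R ^+ 2.
  have -> : D * (96 * K%:R) = 192 * (m%:R * (Num.sqrt m%:R * K%:R)) by rewrite /D; ring.
  by rewrite ler_wpM2l // expr2 ler_wpM2l.
have e1 := ler_wpM2l m2 hA. have e2 := ler_wpM2l mB hB. have e3 := ler_wpM2l D0 hC.
have : 2 * m%:R * (16 * m%:R) = 32 * m%:R ^+ 2 :> R by ring.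
have : 4 * m%:R ^+ 2 * 64 = 256 * m%:R ^+ 2 :> R by ring.
have : 0 <= m%:R ^+ 2 :> R by rewrite exprn_ge0.
lra.
Qed.

End ErrorSums.

(** * Torsor points with (a, c, z) primitive *)

Section TorsorSum.
Variable R : realType.

Definition torsor_sum (X m : nat) : R :=
  \sum_(a <- zrange X) \sum_(c <- zrange X) \sum_(z <- zrange X)
    (coprime3 `|a| `|c| `|z|)%:R * fiber_count R m a c z.

Lemma fiber_count_large (m : nat) (a c z : int) :
  (m < maxsq `|a| `|c| `|z|)%N -> fiber_count R m a c z = 0.
Proof.
move=> h; rewrite /fiber_count big_nat_cond big1 // => w /andP[/andP[w0 _]].
by rewrite leqNgt (leq_trans h) // leq_pmulr.
Qed.

(** Heights force the squares of a, c and z to be at most m. *)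
Lemma torsor_sum_shrink (X K m : nat) : (K <= X)%N -> (m < K.+1 * K.+1)%N ->
  torsor_sum X m = torsor_sum K m.
Proof.
move=> KX mK; have big x y t : (K < x)%N || (K < y)%N || (K < t)%N -> (m < maxsq x y t)%N.
  move=> h; apply: leq_trans mK _; have [h1 h2 h3] := maxsq_ge x y t.
  by case/orP: h => [/orP[]|] h; [apply: leq_trans h1|apply: leq_trans h2|apply: leq_trans h3];
    exact: leq_mul.
rewrite /torsor_sum (@big_zrange_shrink _ _ X K) //; last first.
  move=> a ha; rewrite big1 // => c _; rewrite big1 // => z _.
  by rewrite fiber_count_large ?mulr0 // big // ha.
apply: eq_bigr => a _; rewrite (@big_zrange_shrink _ _ X K) //; last first.
  move=> c hc; rewrite big1 // => z _.
  by rewrite fiber_count_large ?mulr0 // big // hc orbT.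
apply: eq_bigr => c _; rewrite (@big_zrange_shrink _ _ X K) // => z hz.
by rewrite fiber_count_large ?mulr0 // big // hz orbT.
Qed.

Lemma zrange_abs (F : nat -> R) K :
  \sum_(x <- zrange K) F `|x|%N = F 0%N + 2 * \sum_(1 <= k < K.+1) F k.
Proof.
rewrite (@big_zrange_sign _ (fun x => F `|x|%N)) absz0 mulr_sumr; congr (_ + _).
by apply: eq_bigr => k _; rewrite abszN absz_nat mulr_natl mulr2n.
Qed.

Lemma zrange_abs_le (F : nat -> R) K : (forall k, 0 <= F k) ->
  \sum_(x <- zrange K) F `|x|%N <= 2 * \sum_(0 <= k < K.+1) F k.
Proof.
move=> F0; rewrite zrange_abs [in leRHS]big_ltn // mulrDr lerD2r.
by rewrite ler_peMl // ler1n.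
Qed.

Definition lattice_sum (K m : nat) : R :=
  \sum_(1 <= x < K.+1) \sum_(1 <= y < K.+1) \sum_(1 <= t < K.+1)
    (coprime3 x y t)%:R * fiber_main R m x y t.

Lemma fiber_deviation (m : nat) (a c z : int) : (0 < m)%N ->
  `|(coprime3 `|a| `|c| `|z|)%:R * fiber_count R m a c z -
    m%:R * ((`|a| * `|c| * `|z| != 0)%N%:R * ((coprime3 `|a| `|c| `|z|)%:R * fiber_main R m `|a|%N `|c|%N `|z|%N))|
  <= fiber_error R m `|a| `|c| `|z|.
Proof.
move=> m0; case: (boolP (coprime3 _ _ _)) => cop; last first.
  by rewrite !mul0r !mulr0 subrr normr0 fiber_error_ge0.
rewrite !mul1r; have [e|e] := boolP (`|a| * `|c| * `|z| == 0)%N; last first.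
  rewrite mul1r /fiber_error (negbTE e).
  have /andP[a0 c0] : (a != 0) && (c != 0).
    by move: e; rewrite -lt0n !muln_gt0 !absz_gt0 => /andP[].
  exact: fiber_count_approx.
rewrite mul0r mulr0 subr0 /fiber_error e.
rewrite ger0_norm; last by apply: sumr_ge0 => w _; exact: line_count_ge0.
have [N0|N0] := posnP (maxn `|a| `|c|).
  by rewrite fiber_count_vertical // N0 invr0 mulr0.
exact: fiber_count_le.
Qed.

Lemma torsor_sum_lattice : exists2 E : R, 0 <= E & forall K m : nat,
  (0 < m)%N -> (K * K <= m)%N ->
  `|torsor_sum K m - 8 * m%:R * lattice_sum K m| <= E * m%:R ^+ 2.
Proof.
have [E E0 hE] : exists2 E : R, 0 <= E & forall K m : nat, (K * K <= m)%N ->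
   \sum_(0 <= x < K.+1) \sum_(0 <= y < K.+1) \sum_(0 <= t < K.+1) fiber_error R m x y t
   <= E * m%:R ^+ 2.
  by exists 512; [exact: ler0n|exact: (fun K m h => sum_fiber_error R h)].
exists (8 * E) => [|K m m0 Km]; first by rewrite mulr_ge0.
pose F x y t : R := (x * y * t != 0)%N%:R * ((coprime3 x y t)%:R * fiber_main R m x y t).
have -> : 8 * m%:R * lattice_sum K m =
   \sum_(a <- zrange K) \sum_(c <- zrange K) \sum_(z <- zrange K) m%:R * F `|a|%N `|c|%N `|z|%N.
  transitivity (m%:R * \sum_(a <- zrange K) \sum_(c <- zrange K) \sum_(z <- zrange K) F `|a|%N `|c|%N `|z|%N); last first.
    rewrite mulr_sumr; apply: eq_bigr => a _; rewrite mulr_sumr; apply: eq_bigr => c _.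
    by rewrite mulr_sumr.
  rewrite [8 * _]mulrC -mulrA; congr (_ * _).
  rewrite (zrange_abs (fun x => \sum_(c <- zrange K) \sum_(z <- zrange K) F x `|c|%N `|z|%N)).
  rewrite big1 ?add0r; last by move=> c _; rewrite big1 // => z _; rewrite /F mul0n mul0r.
  rewrite (_ : 8 = 2 * (2 * 2)); last by ring.
  rewrite -!mulrA; congr (_ * _); rewrite /lattice_sum !mulr_sumr big_nat [RHS]big_nat.
  apply: eq_bigr => x /andP[x0 _].
  rewrite (zrange_abs (fun y => \sum_(z <- zrange K) F x y `|z|%N)).
  have -> : \sum_(z <- zrange K) F x 0%N `|z|%N = 0.
    by rewrite big1 // => z _; rewrite /F muln0 mul0n mul0r.
  rewrite add0r.
  congr (_ * _); rewrite !mulr_sumr big_nat [RHS]big_nat; apply: eq_bigr => y /andP[y0 _].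
  rewrite (zrange_abs (fun t => F x y t)) {1}/F muln0 mul0r add0r.
  congr (_ * _); rewrite big_nat [RHS]big_nat; apply: eq_bigr => t /andP[t0 _].
  by rewrite /F -lt0n !muln_gt0 x0 y0 t0 mul1r.
rewrite /torsor_sum -sumrB; apply: le_trans (ler_norm_sum _ _ _) _.
apply: (@le_trans _ _ (\sum_(a <- zrange K) \sum_(c <- zrange K) \sum_(z <- zrange K) fiber_error R m `|a| `|c| `|z|)).
  apply: ler_sum => a _; rewrite -sumrB; apply: le_trans (ler_norm_sum _ _ _) _.
  apply: ler_sum => c _; rewrite -sumrB; apply: le_trans (ler_norm_sum _ _ _) _.
  apply: ler_sum => z _; exact: fiber_deviation.
have e0 x y t := fiber_error_ge0 R m x y t.
apply: le_trans (zrange_abs_le (F := fun x => \sum_(c <- zrange K) \sum_(z <- zrange K) fiber_error R m x `|c| `|z|) K _) _.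
  by move=> x; apply: sumr_ge0 => c _; apply: sumr_ge0.
apply: (@le_trans _ _ (2 * \sum_(0 <= x < K.+1) (2 * \sum_(0 <= y < K.+1) (2 * \sum_(0 <= t < K.+1) fiber_error R m x y t)))).
  rewrite ler_pM2l //; apply: ler_sum => x _.
  apply: le_trans (zrange_abs_le (F := fun y => \sum_(z <- zrange K) fiber_error R m x y `|z|) K _) _.
    by move=> y; apply: sumr_ge0.
  rewrite ler_pM2l //; apply: ler_sum => y _.
  by apply: zrange_abs_le.
under eq_bigr do rewrite -mulr_sumr.
rewrite -!mulr_sumr; have := hE K m Km.
move: (\sum_(_ <= _ < _) _) => S hS.
have -> : 2 * (2 * (2 * S)) = 8 * S by ring.
by rewrite -mulrA ler_pM2l.
Qed.

Lemma sum_le_indicator (V : nmodType) (G : nat -> V) (k L : nat) : (k <= L)%N ->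
  \sum_(1 <= x < L.+1 | (x <= k)%N) G x = \sum_(1 <= x < k.+1) G x.
Proof.
move=> kL; rewrite (@big_nat_shrink V G (fun x => x <= k)%N k) //.
  by rewrite big_nat_cond [RHS]big_nat_cond; apply: eq_bigl => w; rewrite ltnS; case: (w <= k)%N; rewrite ?andbF.
by move=> j /andP[h1 _]; rewrite leqNgt h1.
Qed.

Lemma natr_le_trunc_sqrt (x : nat) (r : R) : 0 <= r ->
  ((x * x)%N%:R <= r) = (x <= Num.truncn (Num.sqrt r))%N.
Proof.
move=> r0; rewrite truncn_ge_nat ?sqrtr_ge0 // natrM.
by rewrite -[in LHS](sqrtK_ge0 r0) -!expr2 ler_sqr ?nnegrE ?sqrtr_ge0.
Qed.

Lemma octant_sum_maxsq (r : R) (L : nat) : 0 <= r -> (Num.truncn (Num.sqrt r) <= L)%N ->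
  octant_sum r = \sum_(1 <= x < L.+1) \sum_(1 <= y < L.+1) \sum_(1 <= t < L.+1)
    (if (maxsq x y t)%:R <= r then ell x%:R y%:R (t%:R ^+ 3 / r) else 0).
Proof.
move=> r0; rewrite /octant_sum; set k := Num.truncn _ => kL.
have cond x y t : ((maxsq x y t)%:R <= r) = [&& (x <= k)%N, (y <= k)%N & (t <= k)%N].
  rewrite -!natr_le_trunc_sqrt // /maxsq.
  have mx a b : ((maxn a b)%:R <= r) = (a%:R <= r) && (b%:R <= r).
    rewrite /maxn; case: ltnP => h; first by rewrite andb_idl // => /(le_trans _); apply; rewrite ler_nat ltnW.
    by rewrite andb_idr // => /(le_trans _); apply; rewrite ler_nat.
  by rewrite !mx.
transitivity (\sum_(1 <= x < L.+1 | (x <= k)%N) \sum_(1 <= y < L.+1 | (y <= k)%N)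
    \sum_(1 <= t < L.+1 | (t <= k)%N) ell x%:R y%:R (t%:R ^+ 3 / r)); last first.
  rewrite big_mkcond; apply: eq_bigr => x _; case: ifP => xk; last first.
    by rewrite big1 // => y _; rewrite big1 // => t _; rewrite cond xk.
  rewrite big_mkcond; apply: eq_bigr => y _; case: ifP => yk; last first.
    by rewrite big1 // => t _; rewrite cond yk andbF.
  by rewrite big_mkcond; apply: eq_bigr => t _; rewrite cond xk yk.
rewrite sum_le_indicator // big_add1 big_mkord; apply: eq_bigr => x _.
rewrite sum_le_indicator // big_add1 big_mkord; apply: eq_bigr => y _.
by rewrite sum_le_indicator // big_add1 big_mkord.
Qed.

Lemma maxsqZ e x y t : maxsq (e * x) (e * y) (e * t) = (e * e * maxsq x y t)%N.
Proof. by rewrite /maxsq !maxnMr; congr maxn; [|congr maxn]; rewrite mulnACA. Qed.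

(** Moebius inversion removes the coprimality condition on (a, c, z); the
    multiples of e contribute a rescaled copy of the octant sum. *)
Lemma lattice_sum_octant (K m : nat) : (0 < m)%N -> (K * K <= m < K.+1 * K.+1)%N ->
  lattice_sum K m = \sum_(1 <= w < m.+1) \sum_(1 <= e < m.+1)
    (mobius e)%:~R / e%:R * octant_sum (m%:R / (e%:R ^+ 2 * w%:R)).
Proof.
move=> m0 /andP[Km mK].
have mR : (0 : R) < m%:R by rewrite ltr0n.
have Klem : (K <= m)%N by case: (posnP K) => [->//|K0]; apply: leq_trans Km; exact: leq_pmulr.
pose f w x y t : R := if (maxsq x y t * w <= m)%N then ell x%:R y%:R (t%:R ^+ 3 * w%:R / m%:R) else 0.
transitivity (\sum_(1 <= w < m.+1) \sum_(1 <= x < K.+1) \sum_(1 <= y < K.+1) \sum_(1 <= t < K.+1)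
   (coprime3 x y t)%:R * f w x y t).
  rewrite [RHS]exchange_big /=; apply: eq_bigr => x _.
  rewrite [RHS]exchange_big /=; apply: eq_bigr => y _.
  rewrite [RHS]exchange_big /=; apply: eq_bigr => t _.
  rewrite -mulr_sumr; case: (boolP (coprime3 x y t)) => cop; last by rewrite !mul0r.
  rewrite !mul1r /fiber_main -(@sum_bounded_multiples _ _ (maxsq x y t)) ?maxsq_gt0 //.
  by rewrite big_mkcond.
rewrite big_nat [RHS]big_nat; apply: eq_bigr => w /andP[w0 wm].
have wR : (0 : R) < w%:R by rewrite ltr0n.
transitivity (\sum_(1 <= x < K.+1) \sum_(1 <= y < K.+1) \sum_(1 <= t < K.+1) \sum_(1 <= e < m.+1)
   (if (e %| x)%N then if (e %| y)%N then if (e %| t)%N then (mobius e)%:~R * f w x y t else 0 else 0 else 0)).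
  rewrite big_nat [RHS]big_nat; apply: eq_bigr => x /andP[x0 xK].
  apply: eq_bigr => y _; apply: eq_bigr => t _.
  have h : (0 < gcdn (gcdn x y) t <= m)%N.
    rewrite !gcdn_gt0 x0 /= (leq_trans _ Klem) //; apply: leq_trans (_ : x <= K)%N => //.
    by rewrite dvdn_leq // (dvdn_trans (dvdn_gcdl _ _)) // dvdn_gcdl.
  rewrite /coprime3 -(mobius_sum R h) mulr_suml big_mkcond; apply: eq_bigr => e _.
  by rewrite !dvdn_gcd; do 3!case: (e %| _)%N.
under eq_bigr do under eq_bigr do rewrite exchange_big /=.
under eq_bigr do rewrite exchange_big /=.
rewrite exchange_big /= big_nat [RHS]big_nat; apply: eq_bigr => e /andP[e0 _].
have eR : (0 : R) < e%:R by rewrite ltr0n.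
set r := m%:R / (e%:R ^+ 2 * w%:R).
have r0 : 0 < r by rewrite divr_gt0 // mulr_gt0 // exprn_gt0.
rewrite (@octant_sum_maxsq r (K %/ e)) ?ltW //; last first.
  rewrite leq_divRL //; set k := Num.truncn _.
  have : ((k * k)%N%:R <= r) by rewrite natr_le_trunc_sqrt // ltW.
  rewrite /r ler_pdivlMr ?mulr_gt0 ?exprn_gt0 // -natrX -!natrM ler_nat => h.
  rewrite -ltnS; apply: contraTT mK; rewrite -!leqNgt => h2.
  apply: leq_trans (leq_mul h2 h2) _; apply: leq_trans h.
  by rewrite mulnACA -mulnn leq_mul // leq_pmulr.
pose A x y t : R := (mobius e)%:~R * f w x y t.
transitivity (\sum_(1 <= x < (K %/ e).+1) \sum_(1 <= y < (K %/ e).+1) \sum_(1 <= t < (K %/ e).+1)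
   A (e * x)%N (e * y)%N (e * t)%N).
  rewrite -(@big_nat_multiples _ (fun x => \sum_(1 <= y < (K %/ e).+1) \sum_(1 <= t < (K %/ e).+1)
     A x (e * y)%N (e * t)%N)) // [RHS]big_mkcond; apply: eq_bigr => x _.
  case: ifP => _; last by rewrite big1 // => y _; rewrite big1.
  rewrite -(@big_nat_multiples _ (fun y => \sum_(1 <= t < (K %/ e).+1) A x y (e * t)%N)) //.
  rewrite [RHS]big_mkcond; apply: eq_bigr => y _.
  case: ifP => _; last by rewrite big1.
  by rewrite -(@big_nat_multiples _ (fun t => A x y t)) // [RHS]big_mkcond.
rewrite !mulr_sumr; apply: eq_bigr => x _; rewrite mulr_sumr; apply: eq_bigr => y _.
rewrite mulr_sumr; apply: eq_bigr => t _; rewrite /A -mulrA; congr (_ * _).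
rewrite /f maxsqZ.
have -> : (e * e * maxsq x y t * w <= m)%N = ((maxsq x y t)%:R <= r).
  rewrite /r ler_pdivlMr ?mulr_gt0 ?exprn_gt0 // -natrX -!natrM ler_nat.
  by rewrite -mulnn mulnAC mulnC.
case: ifP => _; last by rewrite mulr0.
rewrite !natrM; have -> : (e%:R * t%:R) ^+ 3 * w%:R / m%:R = e%:R * (t%:R ^+ 3 / r).
  by rewrite /r; field; rewrite !gt_eqF.
by rewrite ellZ // mulrC.
Qed.
Lemma octant_sum_all : exists2 C : R, 0 <= C & forall r, 0 < r ->
  `|octant_sum r - r * (fine (box_integral R) / 8)| <= C * (Num.sqrt r * root4 r).
Proof.
have [C C0 hC] := octant_sum_approx R; set b := fine (box_integral R) / 8 in hC *.
exists (C + `|b|) => [|r r0]; first by rewrite addr_ge0.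
have s0 : 0 <= Num.sqrt r * root4 r by rewrite mulr_ge0 ?sqrtr_ge0.
have [r1|r1] := leP 1 r.
  by apply: le_trans (hC _ r1) _; rewrite ler_wpM2r // lerDl.
have s1 : Num.sqrt r < 1 by rewrite -[X in _ < X]sqrtr1 ltr_sqrt.
have -> : octant_sum r = 0.
  rewrite /octant_sum (_ : Num.truncn (Num.sqrt r) = 0%N) ?big_ord0 //.
  by apply/eqP; rewrite -leqn0 -ltnS truncn_lt_nat ?sqrtr_ge0.
have h : r <= Num.sqrt r * root4 r.
  rewrite -[leLHS](sqrtK_ge0 (ltW r0)) ler_wpM2l ?sqrtr_ge0 // le_sqrt ?sqrtr_ge0 //.
  by rewrite ler_piMr ?sqrtr_ge0 // ltW.
rewrite sub0r normrN normrM (gtr0_norm r0).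
have := ler_wpM2r (normr_ge0 b) h; have := mulr_ge0 C0 s0; lra.
Qed.

Lemma ln_nat_ge0 (m : nat) : 0 <= ln m%:R :> R.
Proof.
case: m => [|m]; first by rewrite ln0.
by rewrite ln_ge0 // ler1n.
Qed.

(** The octant sum at m / (e^2 w) is this argument times an eighth of the box
    integral, up to its power 3/4. The sum over w is harmonic and produces the
    logarithm, the sum over e produces 1 / zeta 3, and the sum of the errors
    is O(m). *)
Lemma lattice_sum_asymp : exists2 C : R, 0 <= C & forall K m : nat, (0 < m)%N ->
  (K * K <= m < K.+1 * K.+1)%N ->
  `|lattice_sum K m - fine (box_integral R) / 8 * (zeta R 3)^-1 * m%:R * ln m%:R| <= C * m%:R.
Proof.
have [C C0 hC] := octant_sum_all; set b := fine (box_integral R) / 8 in hC *.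
exists (12 * C + 13 * `|b|) => [|K m m0 Km]; first by rewrite addr_ge0 ?mulr_ge0.
have mR : (0 : R) < m%:R by rewrite ltr0n.
rewrite (lattice_sum_octant m0 Km).
pose H : R := \sum_(1 <= w < m.+1) (w%:R)^-1.
have mainE : \sum_(1 <= w < m.+1) \sum_(1 <= e < m.+1)
    (mobius e)%:~R / e%:R * (m%:R / (e%:R ^+ 2 * w%:R) * b) = b * m%:R * H * mobius_zeta_sum R 3 m.
  rewrite /H [X in _ = X * _]mulr_sumr [RHS]mulr_suml /mobius_zeta_sum big_nat [RHS]big_nat.
  apply: eq_bigr => w /andP[w0 _]; rewrite mulr_sumr big_nat [RHS]big_nat; apply: eq_bigr => e /andP[e0 _].
  by field; rewrite !pnatr_eq0 -!lt0n w0 e0.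
set S := \sum_(1 <= w < m.+1) _.
have step1 : `|S - b * m%:R * H * mobius_zeta_sum R 3 m| <= 12 * C * m%:R.
  rewrite -mainE /S -sumrB.
  apply: (@le_trans _ _ (\sum_(1 <= w < m.+1) \sum_(1 <= e < m.+1)
      C * pow34 R m * ((pow34 R w)^-1 * (e%:R * Num.sqrt e%:R)^-1))).
    apply: le_trans (ler_norm_sum _ _ _) _; rewrite !big_nat; apply: ler_sum => w /andP[w0 _].
    rewrite -sumrB; apply: le_trans (ler_norm_sum _ _ _) _; rewrite !big_nat.
    apply: ler_sum => e /andP[e0 _].
    have wR : (0 : R) < w%:R by rewrite ltr0n.
    have eR : (0 : R) < e%:R by rewrite ltr0n.
    rewrite -mulrBr normrM; set r := m%:R / _.
    have r0 : 0 < r by rewrite divr_gt0 // mulr_gt0 // exprn_gt0.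
    have := hC _ r0; have h1 : `|(mobius e)%:~R / e%:R| <= 1 :> R.
      rewrite normrM normfV (gtr0_norm eR) ler_pdivrMr // mul1r.
      by apply: le_trans (mobius_norm R e) _; rewrite ler1n.
    move=> h2; apply: le_trans (ler_pM _ _ h1 h2) _ => //; rewrite mul1r.
    have sE : Num.sqrt r = Num.sqrt m%:R / (e%:R * Num.sqrt w%:R).
      by rewrite /r sqrtrM // sqrtrV ?mulr_ge0 ?exprn_ge0 // sqrtrM ?exprn_ge0 // sqrtr_sqr (gtr0_norm eR).
    have qE : root4 r = root4 m%:R / (Num.sqrt e%:R * root4 w%:R).
      by rewrite /root4 sE sqrtrM ?sqrtr_ge0 // sqrtrV ?mulr_ge0 ?sqrtr_ge0 // sqrtrM.
    have p34 k : pow34 R k = Num.sqrt k%:R * root4 k%:R.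
      by rewrite /pow34 exprSr expr2 sqrt_sqrt4.
    rewrite sE qE !p34 -[leRHS]mulrA ler_wpM2l // le_eqVlt; apply/orP; left; apply/eqP.
    have s1 := sqrt_nat_gt0 R w0; have s2 := sqrt_nat_gt0 R e0.
    have s3 : 0 < root4 w%:R :> R by rewrite sqrtr_gt0.
    by field; rewrite !gt_eqF.
  under eq_bigr do rewrite -mulr_sumr -mulr_sumr.
  rewrite -mulr_sumr -mulr_suml.
  have h1 : \sum_(1 <= w < m.+1) (pow34 R w)^-1 <= 4 * root4 m%:R by exact: sum_inv_sqrt4.
  have h2 := sum_inv_3half R m.
  have n1 : 0 <= \sum_(1 <= w < m.+1) (pow34 R w)^-1.
    by apply: sumr_ge0 => w _; rewrite invr_ge0 pow34_ge0.
  have n2 : 0 <= \sum_(1 <= k < m.+1) (k%:R * Num.sqrt k%:R)^-1 :> R.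
    by apply: sumr_ge0 => w _; rewrite invr_ge0 mulr_ge0 ?sqrtr_ge0.
  apply: le_trans (ler_wpM2l _ (ler_pM n1 n2 h1 h2)) _; first by rewrite mulr_ge0 ?pow34_ge0.
  have e4 : pow34 R m * root4 m%:R = m%:R.
    by rewrite /pow34 /root4 -exprSr (exprM _ 2 2) sqr_sqrtr ?sqrtr_ge0 // sqr_sqrtr.
  rewrite le_eqVlt; apply/orP; left; apply/eqP; rewrite -[in RHS]e4; ring.
have [H1 H2] := harmonic_ln R m0; rewrite -/H in H1 H2.
have lnm : ln m%:R <= ln m.+1%:R :> R by rewrite ler_ln ?posrE ?ltr0n // ler_nat.
have ln0 := ln_nat_ge0 m.
have hz := @mobius_zeta_sum_approx R 3 m isT m0.
have z1 := @zeta_ge1 R 3 isT.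
have zi : (zeta R 3)^-1 <= 1 by rewrite invf_le1 // (lt_le_trans ltr01).
have zi0 : 0 <= (zeta R 3)^-1 by rewrite invr_ge0 (le_trans ler01).
have sm := sqrt_nat_ge1 R m0; have l2 := ln_le_2sqrt R m0.
have e1 : `|H * mobius_zeta_sum R 3 m - (zeta R 3)^-1 * ln m%:R| <= 13.
  have -> : H * mobius_zeta_sum R 3 m - (zeta R 3)^-1 * ln m%:R =
     H * (mobius_zeta_sum R 3 m - (zeta R 3)^-1) + (zeta R 3)^-1 * (H - ln m%:R) by ring.
  apply: le_trans (ler_normD _ _) _.
  have -> : 13 = 12 + 1 :> R by ring.
  apply: lerD; rewrite normrM.
    rewrite ger0_norm; last by lra.
    apply: (@le_trans _ _ (H * (4 / Num.sqrt m%:R))); first by rewrite ler_wpM2l //; lra.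
    by rewrite mulrA ler_pdivrMr; lra.
  rewrite (ger0_norm zi0) (ger0_norm (_ : 0 <= H - _)); last by lra.
  by apply: mulr_ile1 => //; lra.
have -> : S - b * (zeta R 3)^-1 * m%:R * ln m%:R = (S - b * m%:R * H * mobius_zeta_sum R 3 m) +
   b * m%:R * (H * mobius_zeta_sum R 3 m - (zeta R 3)^-1 * ln m%:R) by ring.
apply: le_trans (ler_normD _ _) _; rewrite mulrDl; apply: lerD => //.
rewrite normrM (normrM b) (gtr0_norm mR); apply: le_trans (ler_wpM2l _ e1) _.
  by rewrite mulr_ge0 // ltW.
by rewrite le_eqVlt; apply/orP; left; apply/eqP; ring.
Qed.

Lemma torsor_sum_asymp : exists2 C : R, 0 <= C & forall X m : nat, (0 < m)%N -> (m <= X)%N ->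
  `|torsor_sum X m - fine (box_integral R) * (zeta R 3)^-1 * m%:R ^+ 2 * ln m%:R| <= C * m%:R ^+ 2.
Proof.
have [E E0 hE] := torsor_sum_lattice.
have [C C0 hC] := lattice_sum_asymp; exists (E + 8 * C) => [|X m m0 mX].
  by rewrite addr_ge0 ?mulr_ge0.
have mR : (0 : R) < m%:R by rewrite ltr0n.
have [K /andP[K1 K2]] : exists K, (K * K <= m < K.+1 * K.+1)%N.
  exists (Num.truncn (Num.sqrt (m%:R : R))).
  by rewrite -(ler_nat R) natr_le_trunc_sqrt // leqnn /= ltnNge -(ler_nat R) natr_le_trunc_sqrt // ltnn.
have KX : (K <= X)%N.
  by case: (posnP K) => [->//|K0]; apply: leq_trans mX; apply: leq_trans K1; exact: leq_pmulr.
rewrite (torsor_sum_shrink KX K2); have h1 := hE K m m0 K1.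
have h2 := hC K m m0 (ltac:(by rewrite K1 K2)).
have h3 : `|8 * m%:R * lattice_sum K m - fine (box_integral R) / zeta R 3 * m%:R ^+ 2 * ln m%:R| <=
    8 * C * m%:R ^+ 2.
  have -> : 8 * m%:R * lattice_sum K m - fine (box_integral R) / zeta R 3 * m%:R ^+ 2 * ln m%:R =
    8 * m%:R * (lattice_sum K m - fine (box_integral R) / 8 / zeta R 3 * m%:R * ln m%:R).
    by field; rewrite gt_eqF // (lt_le_trans ltr01) // zeta_ge1.
  rewrite normrM ger0_norm ?mulr_ge0 //; apply: le_trans (ler_wpM2l _ h2) _; first by rewrite mulr_ge0.
  by rewrite le_eqVlt; apply/orP; left; apply/eqP; ring.
by move: h1 h3; rewrite !ler_norml; lra.
Qed.

End TorsorSum.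

(** * Torsor points with both triples primitive *)

Section PrimitiveCount.
Variable R : realType.

(** The integral points of height at most m^2 on the universal torsor of the
    resolution: the primitivity of (a, c, z) and (b, d, w) says that they
    avoid the two removed loci modulo every prime. *)
Definition primitive_count (m : nat) : R :=
  \sum_(a <- zrange m) \sum_(c <- zrange m) \sum_(z <- zrange m)
    (coprime3 `|a| `|c| `|z|)%:R *
    \sum_(1 <= w < m.+1 | (maxsq `|a| `|c| `|z| * w <= m)%N)
      \sum_(b <- zrange m) \sum_(d <- zrange m)
         (coprime3 `|b| `|d| w && (a * d - b * c == z ^+ 3 * w%:Z))%:R.

(** Moebius inversion over the common divisors f of (b, d, w); dividing b, d
    and w by f replaces m by m / f. *)
Lemma primitive_count_fiber (m : nat) (a c z : int) :
  \sum_(1 <= w < m.+1 | (maxsq `|a| `|c| `|z| * w <= m)%N)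
      \sum_(b <- zrange m) \sum_(d <- zrange m)
         (coprime3 `|b| `|d| w && (a * d - b * c == z ^+ 3 * w%:Z))%:R =
  \sum_(1 <= f < m.+1) (mobius f)%:~R * fiber_count R (m %/ f) a c z.
Proof.
set M := maxsq _ _ _.
transitivity (\sum_(1 <= w < m.+1) \sum_(b <- zrange m) \sum_(d <- zrange m) \sum_(1 <= f < m.+1)
   (if (f %| w)%N then if (f%:Z %| b)%Z then if (f%:Z %| d)%Z then
      (mobius f)%:~R * ((M * w <= m)%N && (a * d - b * c == z ^+ 3 * w%:Z))%:R else 0 else 0 else 0 : R)).
  rewrite big_mkcond big_nat [RHS]big_nat; apply: eq_bigr => w /andP[w0 wm].
  case: ifP => Mw; last first.
    rewrite big1 // => b _; rewrite big1 // => d _; rewrite big1 // => f _.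
    by rewrite mulr0; do 3!case: ifP => //.
  apply: eq_bigr => b _; apply: eq_bigr => d _.
  have h : (0 < gcdn (gcdn `|b| `|d|) w <= m)%N.
    by rewrite gcdn_gt0 w0 orbT /= -ltnS (leq_ltn_trans _ wm) // dvdn_leq // dvdn_gcdr.
  rewrite /coprime3 -mulnb natrM -(mobius_sum R h) mulr_suml big_mkcond; apply: eq_bigr => f _.
  by rewrite !dvdn_gcd !dvdzE /=; do 3!case: (f %| _)%N.
under eq_bigr do under eq_bigr do rewrite exchange_big /=.
under eq_bigr do rewrite exchange_big /=.
rewrite exchange_big /= big_nat [RHS]big_nat; apply: eq_bigr => f /andP[f0 _].
have fz : f%:Z != 0 by lia.
rewrite /fiber_count [X in _ * X]big_mkcond mulr_sumr.
pose G (w : nat) : R := \sum_(b <- zrange (m %/ f)) \sum_(d <- zrange (m %/ f))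
   (mobius f)%:~R * ((M * w <= m)%N && (a * (f%:Z * d) - (f%:Z * b) * c == z ^+ 3 * w%:Z))%:R.
transitivity (\sum_(1 <= w < m.+1 | (f %| w)%N) G w).
  rewrite [RHS]big_mkcond; apply: eq_bigr => w _; case: ifP => _; last by rewrite big1 // => b _; rewrite big1.
  rewrite /G -(@big_zrange_multiples _ (fun b => \sum_(d <- zrange (m %/ f)) (mobius f)%:~R *
     ((M * w <= m)%N && (a * (f%:Z * d) - b * c == z ^+ 3 * w%:Z))%:R)) // [RHS]big_mkcond.
  apply: eq_bigr => b _; case: ifP => _; last by rewrite big1.
  by rewrite -(@big_zrange_multiples _ (fun d => (mobius f)%:~R *
     ((M * w <= m)%N && (a * d - b * c == z ^+ 3 * w%:Z))%:R)) // [RHS]big_mkcond.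
rewrite big_nat_multiples //; apply: eq_bigr => w _.
have -> : (M * w <= m %/ f)%N = (M * (f * w) <= m)%N by rewrite leq_divRL // mulnCA mulnC.
rewrite /G; case: (M * (f * w) <= m)%N; last by rewrite [RHS]mulr0 big1 // => b _; rewrite big1 // => d _; rewrite mulr0.
rewrite /line_count mulr_sumr; apply: eq_bigr => b _; rewrite mulr_sumr; apply: eq_bigr => d _.
rewrite /= PoszM; have -> : a * (f%:Z * d) - f%:Z * b * c = f%:Z * (a * d - b * c) by ring.
by rewrite [z ^+ 3 * _]mulrCA (inj_eq (mulfI fz)).
Qed.

Lemma primitive_count_mobius (m : nat) :
  primitive_count m = \sum_(1 <= f < m.+1) (mobius f)%:~R * torsor_sum R m (m %/ f).
Proof.
rewrite /primitive_count.
under eq_bigr do under eq_bigr do under eq_bigr do rewrite primitive_count_fiber mulr_sumr.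
under eq_bigr do under eq_bigr do rewrite exchange_big /=.
under eq_bigr do rewrite exchange_big /=.
rewrite exchange_big /=; apply: eq_bigr => f _; rewrite /torsor_sum mulr_sumr.
apply: eq_bigr => a _; rewrite mulr_sumr; apply: eq_bigr => c _; rewrite mulr_sumr.
by apply: eq_bigr => z _; rewrite mulrCA.
Qed.

Lemma sqr_ln_floor (n : nat) (y : R) : (0 < n)%N -> n%:R <= y -> y <= n%:R + 1 ->
  `|n%:R ^+ 2 * ln n%:R - y ^+ 2 * ln y| <= 3 * y ^+ 2.
Proof.
move=> n0 ny yn; have n1 : (1 : R) <= n%:R by rewrite ler1n.
have nR : (0 : R) < n%:R by lra. have y0 : 0 < y by lra.
have ln0 : 0 <= ln n%:R :> R by exact: ln_nat_ge0.
have lny : ln n%:R <= ln y by rewrite ler_ln ?posrE.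
have ly : ln y <= y - 1 by exact: ln_le_sub1.
have dl : n%:R * (ln y - ln n%:R) <= y - n%:R.
  rewrite -ln_div ?posrE //; have := ln_le_sub1 (divr_gt0 y0 nR).
  rewrite -(ler_pM2l nR) => /le_trans; apply.
  by rewrite mulrBr mulrCA divff ?gt_eqF // !mulr1.
rewrite distrC ger0_norm; last first.
  by rewrite subr_ge0; apply: ler_pM => //; rewrite ?exprn_ge0 ?(ltW nR) // lerXn2r ?nnegrE ?(ltW nR) ?(ltW y0).
have -> : y ^+ 2 * ln y - n%:R ^+ 2 * ln n%:R =
  (y ^+ 2 - n%:R ^+ 2) * ln y + n%:R * (n%:R * (ln y - ln n%:R)) by ring.
have h1 : (y ^+ 2 - n%:R ^+ 2) * ln y <= (2 * y) * y.
  have d0 : 0 <= y ^+ 2 - n%:R ^+ 2 by rewrite subr_ge0 lerXn2r ?nnegrE ?(ltW nR) ?(ltW y0).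
  have d2 : y ^+ 2 - n%:R ^+ 2 <= 2 * y by nra.
  by apply: ler_pM => //; lra.
have h2 : n%:R * (n%:R * (ln y - ln n%:R)) <= y * y.
  apply: (@le_trans _ _ (n%:R * (y - n%:R))); first by rewrite ler_pM2l.
  by apply: ler_pM; lra.
by rewrite expr2; lra.
Qed.

(** Rounding m / f down costs O((m / f)^2), and the part ln f of ln (m / f)
    contributes O(m^2) after summation against mu(f) / f^2. *)
Lemma primitive_count_asymp : exists2 C : R, 0 <= C & forall m : nat, (0 < m)%N ->
  `|primitive_count m - fine (box_integral R) / (zeta R 2 * zeta R 3) * m%:R ^+ 2 * ln m%:R|
     <= C * m%:R ^+ 2.
Proof.
have [C C0 hC] := torsor_sum_asymp R; set b := fine (box_integral R).
pose k := b / zeta R 3.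
exists (2 * (C + 3 * `|k|) + 18 * `|k|) => [|m m0]; first by rewrite !addr_ge0 ?mulr_ge0 ?addr_ge0 ?mulr_ge0.
have mR : (0 : R) < m%:R by rewrite ltr0n.
have m2 : (0 : R) < m%:R ^+ 2 by rewrite exprn_gt0.
pose main f : R := k * (m%:R / f%:R) ^+ 2 * (ln m%:R - ln f%:R).
have term f : (0 < f <= m)%N -> `|torsor_sum R m (m %/ f) - main f| <= (C + 3 * `|k|) * m%:R ^+ 2 * (f%:R ^+ 2)^-1.
  move=> /andP[f0 fm]; have fR : (0 : R) < f%:R by rewrite ltr0n.
  have q0 : (0 < m %/ f)%N by rewrite divn_gt0.
  set n := (m %/ f)%N in q0 *; pose y : R := m%:R / f%:R.
  have ny : n%:R <= y by rewrite ler_pdivlMr // -natrM ler_nat leq_trunc_div.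
  have yn : y <= n%:R + 1.
    by rewrite ler_pdivrMr // natr1 -natrM ler_nat ltnW // ltn_ceil.
  have -> : main f = k * (y ^+ 2 * ln y) by rewrite /main /y ln_div ?posrE // mulrA.
  have h1 := hC m n q0 (leq_div _ _); have h2 := sqr_ln_floor q0 ny yn.
  have ny2 : n%:R ^+ 2 <= y ^+ 2 by rewrite lerXn2r ?nnegrE ?(le_trans _ ny).
  have -> : (C + 3 * `|k|) * m%:R ^+ 2 / f%:R ^+ 2 = C * y ^+ 2 + `|k| * (3 * y ^+ 2).
    by rewrite /y; field; rewrite gt_eqF.
  have -> : torsor_sum R m n - k * (y ^+ 2 * ln y) =
    (torsor_sum R m n - b / zeta R 3 * n%:R ^+ 2 * ln n%:R) + k * (n%:R ^+ 2 * ln n%:R - y ^+ 2 * ln y).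
    by rewrite /k; ring.
  apply: le_trans (ler_normD _ _) _; rewrite normrM; apply: lerD; last exact: ler_wpM2l.
  by apply: le_trans h1 _; exact: ler_wpM2l.
rewrite primitive_count_mobius.
set S := \sum_(1 <= f < m.+1) _.
have s1 : `|S - \sum_(1 <= f < m.+1) (mobius f)%:~R * main f| <= 2 * (C + 3 * `|k|) * m%:R ^+ 2.
  rewrite /S -sumrB; apply: le_trans (ler_norm_sum _ _ _) _.
  apply: (@le_trans _ _ (\sum_(1 <= f < m.+1) (C + 3 * `|k|) * m%:R ^+ 2 * (f%:R ^+ 2)^-1)).
    rewrite !big_nat; apply: ler_sum => f hf; rewrite -mulrBr normrM.
    by rewrite -[leRHS]mul1r; apply: ler_pM => //; [exact: mobius_norm|exact: term].
  rewrite -mulr_sumr; have := @zeta_sum_le2 R 2 m isT; rewrite /zeta_sum => h.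
  have c0 : 0 <= (C + 3 * `|k|) * m%:R ^+ 2 by rewrite mulr_ge0 ?addr_ge0 ?mulr_ge0 // ltW.
  by have := ler_wpM2l c0 h; lra.
have hz := @mobius_zeta_sum_approx R 2 m isT m0.
have z1 := @zeta_ge1 R 2 isT.
have z3 := @zeta_ge1 R 3 isT.
have sm := sqrt_nat_ge1 R m0; have l2 := ln_le_2sqrt R m0; have ln0 := ln_nat_ge0 R m.
pose L : R := \sum_(1 <= f < m.+1) (mobius f)%:~R * (ln f%:R / f%:R ^+ 2).
have L6 : `|L| <= 6.
  apply: le_trans (sum_ln_inv_sqr R m); apply: le_trans (ler_norm_sum _ _ _) _.
  apply: ler_sum => f _; rewrite normrM -[leRHS]mul1r; apply: ler_pM => //; first exact: mobius_norm.
  by rewrite ger0_norm // divr_ge0 ?exprn_ge0 ?ln_nat_ge0.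
have mainE : \sum_(1 <= f < m.+1) (mobius f)%:~R * main f =
    k * m%:R ^+ 2 * (mobius_zeta_sum R 2 m * ln m%:R - L).
  rewrite /mobius_zeta_sum mulr_suml /L -sumrB mulr_sumr big_nat [RHS]big_nat.
  apply: eq_bigr => f /andP[f0 _]; rewrite /main.
  by field; rewrite pnatr_eq0 -lt0n.
rewrite mainE in s1.
have s2 : `|(mobius_zeta_sum R 2 m * ln m%:R - L) - (zeta R 2)^-1 * ln m%:R| <= 18.
  have -> : (mobius_zeta_sum R 2 m * ln m%:R - L) - (zeta R 2)^-1 * ln m%:R =
    (mobius_zeta_sum R 2 m - (zeta R 2)^-1) * ln m%:R - L by ring.
  apply: le_trans (ler_normB _ _) _; rewrite normrM (ger0_norm ln0).
  have e : `|mobius_zeta_sum R 2 m - (zeta R 2)^-1| * ln m%:R <= 8.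
    apply: le_trans (ler_pM _ ln0 hz l2) _ => //.
    have -> : 4 / Num.sqrt m%:R * (2 * Num.sqrt m%:R) = 8 :> R by field; rewrite gt_eqF //; lra.
    by [].
  lra.
have s3 : `|k * m%:R ^+ 2 * (mobius_zeta_sum R 2 m * ln m%:R - L) -
    b / (zeta R 2 * zeta R 3) * m%:R ^+ 2 * ln m%:R| <= 18 * `|k| * m%:R ^+ 2.
  have -> : k * m%:R ^+ 2 * (mobius_zeta_sum R 2 m * ln m%:R - L) -
      b / (zeta R 2 * zeta R 3) * m%:R ^+ 2 * ln m%:R =
      k * m%:R ^+ 2 * ((mobius_zeta_sum R 2 m * ln m%:R - L) - (zeta R 2)^-1 * ln m%:R).
    by rewrite /k; field; rewrite !gt_eqF //; lra.
  rewrite normrM (normrM k) (gtr0_norm m2); apply: le_trans (ler_wpM2l _ s2) _.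
    by rewrite mulr_ge0 // ltW.
  by rewrite le_eqVlt; apply/orP; left; apply/eqP; ring.
by move: s1 s3; rewrite !ler_norml mulrDl; lra.
Qed.

End PrimitiveCount.

(** * Rational points and their heights *)

Section PointsAndHeights.

Definition class_of (x : coords rat) : set (coords rat) := [set y | wproj_eq x y].

Lemma wproj_refl x : wproj_eq x x.
Proof. by case: x => [[[[a b] c] d] z]; exists 1; rewrite ?oner_eq0 // expr1n !mul1r. Qed.

Lemma wproj_sym x y : wproj_eq x y -> wproj_eq y x.
Proof.
case: x => [[[[a b] c] d] z]; case: y => [[[[a' b'] c'] d'] z'] [l l0 [ea eb ec ed ez]].
exists l^-1; rewrite ?invr_eq0 //; rewrite ea eb ec ed ez.
by split; field.
Qed.

Lemma wproj_trans x y t : wproj_eq x y -> wproj_eq y t -> wproj_eq x t.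
Proof.
case: x => [[[[a b] c] d] z]; case: y => [[[[a' b'] c'] d'] z'].
case: t => [[[[a2 b2] c2] d2] z2] [l l0 [ea eb ec ed ez]] [k k0 [fa fb fc fd fz]].
exists (k * l); first by rewrite mulf_neq0.
by rewrite fa fb fc fd fz ea eb ec ed ez !exprMn !mulrA.
Qed.

Lemma class_of_eqP x y : class_of x = class_of y <-> wproj_eq x y.
Proof.
split=> [h|h]; first by have : class_of y y := wproj_refl y; rewrite -h.
apply/seteqP; split=> t /= ht; last exact: wproj_trans ht.
exact: wproj_trans (wproj_sym h) ht.
Qed.

Lemma wproj_scale (l a b c d z : rat) : l != 0 ->
  wproj_eq (a, b, c, d, z) (l * a, l ^+ 2 * b, l * c, l ^+ 2 * d, l * z).
Proof.
by move=> l0; exists (ratr l); [rewrite fmorph_eq0|split; rewrite rmorphM // rmorphXn].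
Qed.

Definition monomials (x : coords int) : seq nat :=
  let: (a, b, c, d, z) := x in [seq `|t|%N | t <- [:: a ^+ 4; b ^+ 2; c ^+ 4; d ^+ 2; z ^+ 4]].

Section Ratio.
Variable R : realType.

Definition max_gcd_ratio (s : seq nat) : R := (\max_(k <- s) k)%:R / (\big[gcdn/0%N]_(k <- s) k)%:R.

Lemma height_coordsE x : height_coords R x = max_gcd_ratio (monomials x).
Proof. by case: x => [[[[a b] c] d] z]. Qed.

Lemma max_gcd_ratio_scale (p q : nat) (s s' : seq nat) : (0 < p)%N -> (0 < q)%N ->
  [seq (p * k)%N | k <- s'] = [seq (q * k)%N | k <- s] -> max_gcd_ratio s' = max_gcd_ratio s.
Proof.
have sc r t : (0 < r)%N -> max_gcd_ratio [seq (r * k)%N | k <- t] = max_gcd_ratio t.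
  move=> r0; rewrite /max_gcd_ratio !big_map.
  rewrite -(big_morph (muln r) (maxnMr r) (muln0 r)) -(big_morph (muln r) (muln_gcdr r) (muln0 r)).
  by rewrite !natrM -mulf_div divff ?mul1r // pnatr_eq0 -lt0n.
by move=> p0 q0 h; rewrite -(sc p s') // h sc.
Qed.

(** The factor l is rational, as a quotient of two natural numbers, unless all
    entries vanish. *)
Lemma max_gcd_ratio_proportional (l : algC) (s s' : seq nat) : l != 0 ->
  [seq (k%:R : algC) | k <- s'] = [seq l * k%:R | k <- s] -> max_gcd_ratio s' = max_gcd_ratio s.
Proof.
move=> l0 h; have inj : injective (fun k : nat => k%:R : algC).
  by move=> i j /eqP; rewrite eqr_nat => /eqP.
have [a0|] := boolP (all (eq_op 0%N) s).
  apply: (@max_gcd_ratio_scale 1 1) => //; under eq_map do rewrite mul1n.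
  under [RHS]eq_map do rewrite mul1n; rewrite !map_id; apply: (inj_map inj); rewrite h.
  by apply/eq_in_map => k /(allP a0)/eqP <-; rewrite mulr0.
case/allPn => k0 ks k00.
have : l * k0%:R \in [seq (k%:R : algC) | k <- s'] by rewrite h; apply/mapP; exists k0.
case/mapP => k1 k1s e1.
have p0 : (0 < k0)%N by rewrite lt0n eq_sym.
have q0 : (0 < k1)%N.
  rewrite lt0n; apply: contra_eq_neq e1 => ->; rewrite mulf_neq0 // pnatr_eq0 -lt0n //.
apply: (@max_gcd_ratio_scale k0 k1) => //; apply: (inj_map inj); rewrite -!map_comp.
have -> : [seq ((fun k => k%:R : algC) \o muln k0) k | k <- s'] = [seq k0%:R * x | x <- [seq (k%:R : algC) | k <- s']].
  by rewrite -map_comp; apply: eq_map => k /=; rewrite natrM.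
rewrite h -map_comp; apply: eq_map => k /=; rewrite natrM -e1; ring.
Qed.

(** The five monomials of the height have degree 4 and hence are multiplied by
    l^4. *)
Lemma height_coords_wproj (x y : coords int) :
  wproj_eq (int_coords x) (int_coords y) -> height_coords R y = height_coords R x.
Proof.
case: x => [[[[a b] c] d] z]; case: y => [[[[a' b'] c'] d'] z'] [l l0 [ea eb ec ed ez]].
rewrite !height_coordsE; apply: (@max_gcd_ratio_proportional (l ^+ 4)); first by rewrite expf_neq0.
have even_norm (t : int) k : (`|t ^+ (2 * k)|%N)%:R = t%:~R ^+ (2 * k) :> algC.
  rewrite -[LHS]/(`|t ^+ (2 * k)|%N%:Z%:~R) abszE ger0_norm ?rmorphXn //.
  by rewrite exprM exprn_ge0 // sqr_ge0.
rewrite !ratr_int in ea eb ec ed ez.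
rewrite /= (even_norm a' 2) (even_norm b' 1) (even_norm c' 2) (even_norm d' 1) (even_norm z' 2).
rewrite (even_norm a 2) (even_norm b 1) (even_norm c 2) (even_norm d 1) (even_norm z 2).
by rewrite ea eb ec ed ez; congr [:: _; _; _; _; _]; ring.
Qed.

Lemma height_class (x : coords rat) (y : coords int) :
  wproj_eq x (int_coords y) -> height R (class_of x) = height_coords R y.
Proof.
move=> h; apply: xget_unique; first by exists y.
move=> _ [t ht <-]; apply: height_coords_wproj.
exact: wproj_trans (wproj_sym h) ht.
Qed.

End Ratio.

(** Clear denominators and divide by the greatest common divisor. *)
Lemma primitive_rep (x y z : rat) : ~ [/\ x = 0, y = 0 & z = 0] ->
  exists l : rat, exists p q r : int, [/\ l != 0, coprime3 `|p| `|q| `|r|,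
     l * x = p%:~R, l * y = q%:~R & l * z = r%:~R].
Proof.
move=> nz; pose D := denq x * denq y * denq z.
pose X := numq x * denq y * denq z; pose Y := numq y * denq x * denq z.
pose Z := numq z * denq x * denq y.
have D0 : D%:~R != 0 :> rat by rewrite intr_eq0 !mulf_neq0 ?denq_eq0.
have dn (t : rat) : (denq t)%:~R * t = (numq t)%:~R.
  by rewrite numqE mulrC.
have eX : D%:~R * x = X%:~R by rewrite /D /X !rmorphM /= -dn; ring.
have eY : D%:~R * y = Y%:~R by rewrite /D /Y !rmorphM /= -dn; ring.
have eZ : D%:~R * z = Z%:~R by rewrite /D /Z !rmorphM /= -dn; ring.
pose g := gcdn (gcdn `|X| `|Y|) `|Z|.
have g0 : (0 < g)%N.
  rewrite lt0n; apply/negP => /eqP g0; apply: nz.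
  have [hX hY hZ] : [/\ X = 0, Y = 0 & Z = 0].
    have gz := dvdnn g; rewrite {2}/g !dvdn_gcd g0 !dvd0n !absz_eq0 in gz.
    by case/andP: gz => /andP[/eqP -> /eqP ->] /eqP ->.
  by split; apply: (mulfI D0); rewrite mulr0 ?eX ?eY ?eZ ?hX ?hY ?hZ.
have gz : g%:~R != 0 :> rat by rewrite intr_eq0; lia.
have [p ep] : exists p, X = p * g%:Z by apply/dvdzP; rewrite dvdzE /= (dvdn_trans (dvdn_gcdl _ _)) ?dvdn_gcdl.
have [q eq] : exists q, Y = q * g%:Z by apply/dvdzP; rewrite dvdzE /= (dvdn_trans (dvdn_gcdl _ _)) ?dvdn_gcdr.
have [r er] : exists r, Z = r * g%:Z by apply/dvdzP; rewrite dvdzE /= dvdn_gcdr.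
exists (D%:~R / g%:~R); exists p; exists q; exists r; split.
- by rewrite mulf_neq0 ?invr_eq0.
- rewrite /coprime3 -(eqn_pmul2r g0) mul1n !muln_gcdl.
  have ab (t u : int) : u = t * g%:Z -> (`|t| * g = `|u|)%N by move=> ->; rewrite abszM.
  by rewrite (ab _ _ ep) (ab _ _ eq) (ab _ _ er).
- by rewrite mulrAC eX ep rmorphM /= mulfK.
- by rewrite mulrAC eY eq rmorphM /= mulfK.
- by rewrite mulrAC eZ er rmorphM /= mulfK.
Qed.

Lemma proportional_primitive (u v : nat) (x y z x' y' z' : nat) :
  coprime3 x y z -> coprime3 x' y' z' ->
  (u * x = v * x')%N -> (u * y = v * y')%N -> (u * z = v * z')%N -> u = v.
Proof.
move=> /eqP h /eqP h' e1 e2 e3.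
by rewrite -[u]muln1 -h !muln_gcdr e1 e2 e3 -!muln_gcdr h' muln1.
Qed.

End PointsAndHeights.

(** * The parametrization by torsor points *)

Section TorsorPoints.
Variable R : realType.

Definition torsor_tuple : Type := ((int * int * int) * (nat * int * int))%type.

Definition cube (s : seq int) : seq (int * int * int) :=
  allpairs pair (allpairs pair s s) s.

Definition torsor_box (m : nat) : seq torsor_tuple :=
  allpairs pair (cube (zrange m))
    (allpairs pair (allpairs pair (index_iota 1 m.+1) (zrange m)) (zrange m)).

Definition torsor_pt (t : torsor_tuple) : bool :=
  let: ((a, c, z), (w, b, d)) := t in
  [&& coprime3 `|a| `|c| `|z|, coprime3 `|b| `|d| w & a * d - b * c == z ^+ 3 * w%:Z].

Definition torsor_height (m : nat) (t : torsor_tuple) : bool :=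
  let: ((a, c, z), (w, b, d)) := t in (maxsq `|a| `|c| `|z| * w <= m)%N.

Lemma mem_pairs (S T : eqType) (s : seq S) (t : seq T) p :
  (p \in allpairs pair s t) = (p.1 \in s) && (p.2 \in t).
Proof.
apply/allpairsP/andP => [[q [h1 h2 ->]]//|[h1 h2]].
by exists p; split=> //; case: p {h1 h2}.
Qed.

Lemma pairs_uniq (S T : eqType) (s : seq S) (t : seq T) :
  uniq s -> uniq t -> uniq (allpairs pair s t).
Proof. by move=> us ut; apply: allpairs_uniq => // -[x y] [x' y']. Qed.

Lemma torsor_box_uniq m : uniq (torsor_box m).
Proof. by rewrite !pairs_uniq ?zrange_uniq ?iota_uniq. Qed.

Definition torsor_list (m : nat) : seq torsor_tuple :=
  [seq t <- torsor_box m | torsor_pt t && torsor_height m t].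

Lemma primitive_count_size (m : nat) : primitive_count R m = (size (torsor_list m))%:R.
Proof.
rewrite size_filter -sum1_count natr_sum big_mkcond /torsor_box big_allpairs.
rewrite /cube !big_allpairs; apply: eq_bigr => a _; apply: eq_bigr => c _; apply: eq_bigr => z _.
rewrite !big_allpairs /=.
case: (boolP (coprime3 _ _ _)) => cop /=; last first.
  by rewrite mul0r big1 // => w _; rewrite big1 // => b _; rewrite big1.
rewrite mul1r [LHS]big_mkcond; apply: eq_bigr => w _; case: ifP => h; last first.
  by rewrite big1 // => b _; rewrite big1 // => d _; rewrite andbF.
by apply: eq_bigr => b _; apply: eq_bigr => d _; rewrite andbT; case: ifP.
Qed.

(** Selects one of the two torsor points (a, c, z), (w, b, d) and (- a, - c, -
    z), (w, b, d) over a rational point. *)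
Definition sign_normal (t : torsor_tuple) : bool :=
  let: ((a, c, z), _) := t in
  if a != 0 then 0 < a else if c != 0 then 0 < c else 0 < z.

Definition torsor_neg (t : torsor_tuple) : torsor_tuple :=
  let: ((a, c, z), u) := t in ((- a, - c, - z), u).

Lemma torsor_negK : involutive torsor_neg.
Proof. by case=> -[[a c] z] u; rewrite /= !opprK. Qed.

Lemma torsor_list_neg m t : (torsor_neg t \in torsor_list m) = (t \in torsor_list m).
Proof.
case: t => -[[a c] z] [[w b] d]; rewrite !mem_filter !mem_pairs /= !mem_zrange !abszN.
congr (_ && _); congr (_ && _); congr [&& _, _ & _].
have -> : - a * d - b * - c = - (a * d - b * c) by ring.
have -> : (- z) ^+ 3 * w%:Z = - (z ^+ 3 * w%:Z) by ring.
by rewrite (inj_eq oppr_inj).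
Qed.

Lemma coprime3_neq0 (a c z : int) : coprime3 `|a| `|c| `|z| -> ~~ [&& a == 0, c == 0 & z == 0].
Proof. by apply: contraL => /and3P[/eqP-> /eqP-> /eqP->]. Qed.

Lemma sign_normal_neg t : torsor_pt t -> sign_normal (torsor_neg t) = ~~ sign_normal t.
Proof.
case: t => -[[a c] z] [[w b] d] /and3P[/coprime3_neq0 h _ _] /=.
rewrite !oppr_eq0 !oppr_gt0; move: h.
have sg (x : int) : x != 0 -> (x < 0) = ~~ (0 < x) by lia.
by do 3 (case: eqVneq => //= ?; try by move=> _; exact: sg).
Qed.

Definition normal_list m := [seq t <- torsor_list m | sign_normal t].

Lemma size_normal_list m : (size (torsor_list m) = 2 * size (normal_list m))%N.
Proof.
rewrite -(count_predC sign_normal) mul2n -addnn -!size_filter; congr addn.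
rewrite -[RHS](size_map torsor_neg); apply: perm_size; apply: uniq_perm.
- by rewrite !filter_uniq ?torsor_box_uniq.
- by rewrite map_inj_uniq ?filter_uniq ?torsor_box_uniq //; exact: (inv_inj torsor_negK).
move=> t; rewrite -[t in RHS]torsor_negK mem_map; last exact: (inv_inj torsor_negK).
rewrite (mem_filter (predC sign_normal) t) (mem_filter sign_normal (torsor_neg t)) torsor_list_neg.
have [h|h] := boolP (t \in torsor_list m); last by rewrite !andbF.
by rewrite /= sign_normal_neg //; move: h; rewrite mem_filter => /andP[/andP[]].
Qed.

(** The point (a : b/w : c : d/w : z) below a torsor point, and the integral
    coordinates (wa : wb : wc : wd : wz) of the same point. *)
Definition torsor_proj (t : torsor_tuple) : coords rat :=
  let: ((a, c, z), (w, b, d)) := t in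
  (a%:~R, b%:~R / w%:R, c%:~R, d%:~R / w%:R, z%:~R).

Definition torsor_int (t : torsor_tuple) : coords int :=
  let: ((a, c, z), (w, b, d)) := t in
  (w%:Z * a, w%:Z * b, w%:Z * c, w%:Z * d, w%:Z * z).

Definition torsor_w (t : torsor_tuple) : nat := t.2.1.1.

Lemma wproj_torsor_int t : (0 < torsor_w t)%N ->
  wproj_eq (torsor_proj t) (int_coords (torsor_int t)).
Proof.
case: t => -[[a c] z] [[w b] d]; rewrite /torsor_w /= => w0.
have wn : w%:R != 0 :> algC by rewrite pnatr_eq0 -lt0n.
exists w%:R => //; rewrite !fmorph_div /= !ratr_int !ratr_nat !rmorphM /=.
by split=> //; field.
Qed.

Definition torsor_monomials (t : torsor_tuple) : seq nat :=
  let: ((a, c, z), (w, b, d)) := t in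
  [:: ((`|a| ^ 2 * w) ^ 2)%N; (`|b| ^ 2)%N; ((`|c| ^ 2 * w) ^ 2)%N; (`|d| ^ 2)%N; ((`|z| ^ 2 * w) ^ 2)%N].

Lemma prime_common_dvd (n : nat) : (forall p, prime p -> ~~ (p %| n)%N) -> n = 1%N.
Proof.
move=> h; apply/eqP; rewrite eqn_leq; apply/andP; split.
  by rewrite leqNgt; apply/negP => n1; have := h _ (pdiv_prime n1); rewrite pdiv_dvd.
by rewrite lt0n; apply/eqP => n0; have := h 2%N isT; rewrite n0 dvdn0.
Qed.

(** A prime dividing all five monomials divides b and d, and then w or all of
    a, c, z; both cases contradict primitivity. *)
Lemma torsor_monomials_gcd t : torsor_pt t -> \big[gcdn/0%N]_(k <- torsor_monomials t) k = 1%N.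
Proof.
case: t => -[[a c] z] [[w b] d] /and3P[/eqP cop1 /eqP cop2 _].
apply: prime_common_dvd => p pp; apply/negP; rewrite /torsor_monomials !big_cons big_nil.
have sqd k : (p %| k ^ 2)%N = (p %| k)%N by rewrite Euclid_dvdX // andbT.
rewrite !dvdn_gcd !sqd !Euclid_dvdM // !orbb.
case/and5P => ha hb hc hd; rewrite dvdn0 andbT => hz.
have [pw|pw] := boolP (p %| w)%N.
  have : (p %| gcdn (gcdn `|b| `|d|) w)%N by rewrite !dvdn_gcd hb hd pw.
  by rewrite cop2 dvdn1 => /eqP p1; rewrite p1 in pp.
rewrite (negbTE pw) !orbF in ha hc hz.
have : (p %| gcdn (gcdn `|a| `|c|) `|z|)%N by rewrite !dvdn_gcd ha hc hz.
by rewrite cop1 dvdn1 => /eqP p1; rewrite p1 in pp.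
Qed.

(** The monomials of the integral coordinates are w^2 times the torsor
    monomials, which are coprime. *)
Lemma height_torsor t : torsor_pt t -> (0 < torsor_w t)%N ->
  height R (class_of (torsor_proj t)) = (\max_(k <- torsor_monomials t) k)%:R.
Proof.
move=> tp w0; rewrite (height_class R (wproj_torsor_int w0)) height_coordsE.
have -> : (\max_(k <- torsor_monomials t) k)%:R = max_gcd_ratio R (torsor_monomials t).
  by rewrite /max_gcd_ratio torsor_monomials_gcd // divr1.
apply: (@max_gcd_ratio_scale R 1 (torsor_w t ^ 2)) => //; first by rewrite expn_gt0 w0.
clear tp w0; case: t => -[[a c] z] [[w b] d] /=; rewrite !mul1n !abszX !abszM /torsor_w /=.
by congr [:: _; _; _; _; _]; rewrite ?expnMn -?expnM -?expnD //; ring.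
Qed.

Lemma natr_sqr_le (B : R) (n : nat) : 0 <= B ->
  ((n ^ 2)%N%:R <= B) = (n <= Num.truncn (Num.sqrt B))%N.
Proof. by move=> B0; rewrite -natr_le_trunc_sqrt. Qed.

Lemma natr_max_le (B : R) (s : seq nat) : 0 <= B ->
  ((\max_(k <- s) k)%:R <= B) = all (fun k => k%:R <= B) s.
Proof.
move=> B0; elim: s => [|k s IH]; first by rewrite big_nil.
rewrite big_cons /= -IH /maxn; case: ltnP => h.
  by rewrite andb_idl // => /(le_trans _); apply; rewrite ler_nat ltnW.
by rewrite andb_idr // => /(le_trans _); apply; rewrite ler_nat.
Qed.

Lemma height_torsor_le (B : R) t : 0 <= B -> torsor_pt t -> (0 < torsor_w t)%N ->
  (height R (class_of (torsor_proj t)) <= B) = (t \in torsor_list (Num.truncn (Num.sqrt B))).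
Proof.
move=> B0 tp w0; rewrite height_torsor // natr_max_le // mem_filter tp.
case: t tp w0 => -[[a c] z] [[w b] d] /and3P[cop1 _ _]; rewrite /torsor_w /= => w0.
rewrite !natr_sqr_le //; set m := Num.truncn _.
rewrite !mem_pairs /= !mem_zrange mem_index_iota w0 ltnS andbT.
have M0 := maxsq_gt0 cop1.
have hM : (maxsq `|a| `|c| `|z| * w <= m)%N =
   [&& (`|a| ^ 2 * w <= m)%N, (`|c| ^ 2 * w <= m)%N & (`|z| ^ 2 * w <= m)%N].
  by rewrite /maxsq !maxnMl !geq_max !mulnn.
have self (x : nat) : (x ^ 2 * w <= m)%N -> (x <= m)%N.
  case: x => // x; apply: leq_trans; rewrite -mulnn -mulnA; apply: leq_pmulr; rewrite muln_gt0 //.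
rewrite hM.
apply/and5P/andP => [[h1 h2 h3 h4 h5]|[/and3P[h1 h2 h3] /andP[_ /andP[/andP[_ h4] h5]]]]; last by split.
have wm : (w <= m)%N.
  have : (maxsq `|a| `|c| `|z| * w <= m)%N by rewrite hM h1 h3 h5.
  by apply: leq_trans; exact: leq_pmull.
rewrite h1 h3 h5; split=> //.
by rewrite (self _ h1) (self _ h3) (self _ h5) h2 h4 wm.
Qed.

Lemma torsor_list_pt m t : t \in torsor_list m -> torsor_pt t /\ (0 < torsor_w t)%N.
Proof.
case: t => -[[a c] z] [[w b] d]; rewrite mem_filter => /andP[/andP[tp _]].
by rewrite !mem_pairs /= mem_index_iota => /andP[_ /andP[/andP[/andP[w0 _] _] _]].
Qed.

Lemma torsor_proj_on_X2 t : torsor_pt t -> (0 < torsor_w t)%N -> on_X2 (torsor_proj t).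
Proof.
case: t => -[[a c] z] [[w b] d] /and3P[/coprime3_neq0 nz _ /eqP e]; rewrite /torsor_w /= => w0.
have wn : w%:R != 0 :> rat by rewrite pnatr_eq0 -lt0n.
split.
  case=> /eqP ha _ /eqP hc _ /eqP hz; move: ha hc hz; rewrite !intr_eq0 => ha hc hz.
  by rewrite ha hc hz in nz.
have eQ : a%:~R * d%:~R - b%:~R * c%:~R = z%:~R ^+ 3 * w%:R :> rat.
  by rewrite -[w%:R]/(w%:Z%:~R) -rmorphXn -!rmorphM -rmorphB /= e.
have -> : a%:~R * (d%:~R / w%:R) - b%:~R / w%:R * c%:~R = (a%:~R * d%:~R - b%:~R * c%:~R) / w%:R :> rat by ring.
by rewrite eQ mulfK // subrr.
Qed.
(** The scalar relates two primitive triples (a, c, z), so it is 1 or -1, and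
    the normalisation of signs excludes -1. Then (b, d, w) are reduced
    fractions with a common denominator, which are unique. *)
Lemma torsor_proj_inj t t' : torsor_pt t -> torsor_pt t' ->
  (0 < torsor_w t)%N -> (0 < torsor_w t')%N -> sign_normal t -> sign_normal t' ->
  class_of (torsor_proj t) = class_of (torsor_proj t') -> t = t'.
Proof.
case: t => -[[a c] z] [[w b] d] tp; case/and3P: (tp) => cop1 cop2 _.
case: t' => -[[a' c'] z'] [[w' b'] d'] /and3P[cop1' cop2' _].
rewrite /torsor_w /= => w0 w0' sg sg' /class_of_eqP[l l0 []].
rewrite !fmorph_div /= !ratr_int !ratr_nat => ea eb ec ed ez.
have wn : w%:R != 0 :> algC by rewrite pnatr_eq0 -lt0n.
have wn' : w'%:R != 0 :> algC by rewrite pnatr_eq0 -lt0n.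
(* the scalar is a ratio x' / x of two corresponding nonzero coordinates *)
have [x [x' [x0 ex]]] : exists x x' : int, x != 0 /\ x'%:~R = l * x%:~R.
  have := coprime3_neq0 cop1; case: (eqVneq a 0) => [_|a0 _]; last by exists a, a'.
  case: (eqVneq c 0) => [_|c0 _]; last by exists c, c'.
  by case: (eqVneq z 0) => // z0 _; exists z, z'.
have prop (u u' : int) : u'%:~R = l * u%:~R -> x * u' = x' * u.
  by move=> eu; apply: (@intr_inj algC); rewrite !rmorphM /= eu ex; ring.
have abs (u u' : int) : u'%:~R = l * u%:~R -> (`|x| * `|u'| = `|x'| * `|u|)%N.
  by move=> /prop e; rewrite -!abszM e.
have xx : `|x|%N = `|x'|%N by apply: (proportional_primitive cop1' cop1); exact: abs.
have l1 : l = 1 \/ l = -1.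
  have xR : x%:~R != 0 :> algC by rewrite intr_eq0.
  have [e|e] : x' = x \/ x' = - x by clear -xx; lia.
    by left; apply: (mulIf xR); rewrite -ex e mul1r.
  by right; apply: (mulIf xR); rewrite -ex e rmorphN mulN1r.
have {}l1 : l = 1.
  case: l1 => // l1; move: ea ec ez; rewrite l1 !mulN1r -!rmorphN => /(@intr_inj algC) ea.
  move=> /(@intr_inj algC) ec /(@intr_inj algC) ez.
  by move: (sign_normal_neg tp) sg'; rewrite /= sg ea ec ez => ->.
have ea' : a' = a by apply: (@intr_inj algC); rewrite ea l1 mul1r.
have ec' : c' = c by apply: (@intr_inj algC); rewrite ec l1 mul1r.
have ez' : z' = z by apply: (@intr_inj algC); rewrite ez l1 mul1r.
rewrite l1 expr1n !mul1r in eb ed.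
have cross (u u' : int) : u'%:~R / w'%:R = u%:~R / w%:R :> algC -> w%:Z * u' = w'%:Z * u.
  move=> e; apply: (@intr_inj algC); rewrite !rmorphM /=.
  by rewrite -[u'%:~R](divfK wn') e; field.
have crossN (u u' : int) : u'%:~R / w'%:R = u%:~R / w%:R :> algC -> (w * `|u'| = w' * `|u|)%N.
  by move=> /cross e; rewrite -[X in (X * _)%N](absz_nat w) -[X in (_ = X * _)%N](absz_nat w') -!abszM e.
have ww : w = w'.
  apply: (proportional_primitive cop2' cop2); [exact: crossN|exact: crossN|exact: mulnC].
have wz : w'%:Z != 0 by rewrite eqz_nat -lt0n.
have eb' : b' = b by have := cross _ _ eb; rewrite ww; exact: mulfI.
have ed' : d' = d by have := cross _ _ ed; rewrite ww; exact: mulfI.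
by rewrite ea' ec' ez' ww eb' ed'.
Qed.

(** Scale so that (a, c, z) becomes a primitive integral triple, write b and d
    over their least common denominator w, and normalise the signs. *)
Lemma torsor_proj_surj (a b c d z : rat) : on_X2 (a, b, c, d, z) ->
  ~ [/\ a = 0, c = 0 & z = 0] -> exists t, [/\ torsor_pt t, (0 < torsor_w t)%N, sign_normal t &
    wproj_eq (a, b, c, d, z) (torsor_proj t)].
Proof.
move=> [_ eX] nz; have [l [p [q [r [l0 cop ep eq er]]]]] := primitive_rep nz.
have [k [u [v [w [k0 cop2 eu ev]]]]] : exists k : rat, exists u v w : int,
    [/\ k != 0, coprime3 `|u| `|v| `|w|, k * (l ^+ 2 * b) = u%:~R, k * (l ^+ 2 * d) = v%:~R & k * 1 = w%:~R].
  by apply: primitive_rep => -[_ _ /eqP]; rewrite oner_eq0.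
rewrite mulr1 => ew.
have w0 : w != 0 by rewrite -(intr_eq0 rat) -ew.
pose s : int := Num.sg w; pose W := `|w|%N.
have sw : s * w = W%:Z by rewrite /s /W abszE normrEsg.
have wE : w = s * W%:Z by rewrite -sw mulrA -expr2 sqr_sg w0 mul1r.
have W0 : (0 < W)%N by rewrite /W absz_gt0.
have sn : s != 0 by rewrite sgr_eq0.
have bE : l ^+ 2 * b = (s * u)%:~R / W%:R.
  rewrite -[W%:R]/(W%:Z%:~R) -sw !rmorphM /= -eu -ew; field.
  by rewrite k0 intr_eq0 sn.
have dE : l ^+ 2 * d = (s * v)%:~R / W%:R.
  rewrite -[W%:R]/(W%:Z%:~R) -sw !rmorphM /= -ev -ew; field.
  by rewrite k0 intr_eq0 sn.
have s1 : `|s|%N = 1%N by rewrite /s; case: (sgrP w) w0 => // ->.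
pose t : torsor_tuple := ((p, q, r), (W, s * u, s * v)).
have tp : torsor_pt t.
  rewrite /t /torsor_pt cop !abszM s1 !mul1n cop2 /=; apply/eqP/(@intr_inj rat).
  have Wn : W%:R != 0 :> rat by rewrite pnatr_eq0 -lt0n.
  rewrite rmorphB !rmorphM /= -ep -eq -er.
  have -> : s%:~R * v%:~R = W%:R * (l ^+ 2 * d) by rewrite dE rmorphM /= [RHS]mulrC divfK.
  have -> : s%:~R * u%:~R = W%:R * (l ^+ 2 * b) by rewrite bE rmorphM /= [RHS]mulrC divfK.
  have : W%:R * l ^+ 3 * (a * d - b * c - z ^+ 3) = 0 by rewrite eX mulr0.
  by move=> h; apply/eqP; rewrite -subr_eq0 -h; apply/eqP; rewrite -[W%:~R]/(W%:R); ring.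
have wpr : wproj_eq (a, b, c, d, z) (torsor_proj t).
  by rewrite /= -ep -eq -er -bE -dE; exact: wproj_scale.
have [sg|sg] := boolP (sign_normal t); first by exists t.
exists (torsor_neg t); split.
- case/and3P: tp => h1 h2 /eqP h3; rewrite /torsor_pt /= !abszN h1 h2 /=; apply/eqP.
  have -> : - p * (s * v) - s * u * - q = - (p * (s * v) - s * u * q) by ring.
  by rewrite h3; ring.
- by [].
- by rewrite sign_normal_neg.
apply: wproj_trans wpr _; exists (-1); first by rewrite oppr_eq0 oner_eq0.
by rewrite sqrrN expr1n !mul1r !mulN1r -!rmorphN.
Qed.

End TorsorPoints.

(** * The counting function *)

Section Counting.
Variable R : realType.

(** The points (0 : b : 0 : d : 0) form the singular locus, a projective
    line; here the scalar of weighted projective space is a square root. *)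
Lemma singular_rep (b d : rat) : on_X2 (0, b, 0, d, 0) ->
  exists p q : int, coprime `|p| `|q| /\
    wproj_eq (0, b, 0, d, 0) (int_coords (0, p, 0, q, 0)).
Proof.
move=> [nz _]; have [|l [p [q [r [l0 cop ep eq er]]]]] := @primitive_rep b d 0.
  by move=> [b0 d0 _]; apply: nz; rewrite b0 d0.
have r0 : r = 0 by apply: (@intr_inj rat); rewrite -er mulr0.
exists p, q; split; first by move: cop; rewrite r0 /coprime3 gcdn0.
exists (sqrtC (ratr l)); first by rewrite sqrtC_eq0 fmorph_eq0.
by rewrite sqrtCK !rmorph0 !mulr0 /= -ep -eq !rmorphM.
Qed.

Lemma height_singular (p q : int) : coprime `|p| `|q| ->
  height_coords R (0, p, 0, q, 0) = (maxn (`|p| ^ 2) (`|q| ^ 2))%:R.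
Proof.
move=> cop; rewrite height_coordsE /max_gcd_ratio.
have -> : monomials (0, p, 0, q, 0) = [:: 0; `|p| ^ 2; 0; `|q| ^ 2; 0]%N.
  by rewrite /monomials /= !abszX.
rewrite !big_cons !big_nil !gcd0n !gcdn0 !max0n !maxn0.
have -> : gcdn (`|p| ^ 2) (`|q| ^ 2) = 1%N.
  by apply/eqP; rewrite -/(coprime _ _) coprimeXl // coprimeXr.
by rewrite divr1.
Qed.

Definition small_points (B : R) : set (set (coords rat)) :=
  [set P | X2_rat_points P /\ height R P <= B].

Definition general_points (m : nat) : seq (set (coords rat)) :=
  [seq class_of (torsor_proj t) | t <- normal_list m].

Definition singular_points (m : nat) : seq (set (coords rat)) :=
  [seq class_of (int_coords (0, x.1, 0, x.2, 0)) | x <- allpairs pair (zrange m) (zrange m)].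

Lemma normal_listP m t : t \in normal_list m ->
  [/\ torsor_pt t, (0 < torsor_w t)%N, sign_normal t & t \in torsor_list m].
Proof.
by rewrite mem_filter => /andP[sg tl]; have [h1 h2] := torsor_list_pt tl; split.
Qed.

Lemma general_points_uniq m : uniq (general_points m).
Proof.
rewrite map_inj_in_uniq; first by rewrite !filter_uniq ?torsor_box_uniq.
by move=> t t' /normal_listP[h1 h2 h3 _] /normal_listP[k1 k2 k3 _]; exact: torsor_proj_inj.
Qed.

Section Bounds.
Variable B : R.
Hypothesis B0 : 0 <= B.
Let m := Num.truncn (Num.sqrt B).

Lemma general_points_small P : P \in general_points m -> small_points B P.
Proof.
case/mapP => t /normal_listP[h1 h2 h3 h4] ->; split.
  by exists (torsor_proj t) => //; exact: torsor_proj_on_X2.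
by rewrite height_torsor_le.
Qed.

(** A general point comes from a torsor point; a point of the singular line
    has coprime integral coordinates (p, q), of size at most the square root
    of B. *)
Lemma small_points_listed P : small_points B P ->
  P \in general_points m \/ P \in singular_points m.
Proof.
case=> -[[[[[a b] c] d] z] onX <-] hB.
have [[a0 c0 z0]|nz] := pselect [/\ a = 0, c = 0 & z = 0]; last first.
  left; have [t [h1 h2 h3 h4]] := torsor_proj_surj onX nz.
  have e : class_of (a, b, c, d, z) = class_of (torsor_proj t) by exact/class_of_eqP.
  rewrite -/(class_of _) e; apply/mapP; exists t => //.
  rewrite mem_filter h3 -height_torsor_le // -e //.
right; subst a c z; have [p [q [cop h]]] := singular_rep onX.
have e : class_of (0, b, 0, d, 0) = class_of (int_coords (0, p, 0, q, 0)) by exact/class_of_eqP.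
rewrite -/(class_of _) e; apply/mapP; exists (p, q) => //.
move: hB; rewrite -/(class_of _) (height_class R h) height_singular //.
rewrite mem_pairs /= !mem_zrange -!natr_sqr_le // => hB.
by rewrite !(le_trans _ hB) // ler_nat (leq_maxl, leq_maxr).
Qed.

Lemma counting_function_bounds :
  (size (normal_list m) <= counting_function B <= size (normal_list m) + (2 * m).+1 * (2 * m).+1)%N.
Proof.
have sub : small_points B `<=` [set` general_points m ++ singular_points m].
  by move=> P /small_points_listed h; rewrite /= mem_cat; apply/orP.
have fin : finite_set (small_points B) by exact: sub_finite_set sub (finite_seq _).
have nN : size (normal_list m) = #|` [fset P in general_points m]%fset|.
  by rewrite card_fseq undup_id ?general_points_uniq // size_map.
rewrite /counting_function -/(small_points B); apply/andP; split.
  rewrite nN; apply: fsubset_leq_card; apply/fsubsetP => P.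
  by rewrite in_fset_set // !inE => h; apply/mem_set; exact: general_points_small.
apply: (@leq_trans #|` [fset P in general_points m ++ singular_points m]%fset|).
  apply: fsubset_leq_card; apply/fsubsetP => P.
  by rewrite in_fset_set // => /set_mem /sub; rewrite /= !inE mem_cat.
rewrite card_fseq; apply: leq_trans (size_undup _) _.
by rewrite size_cat !size_map size_allpairs !size_map !size_iota.
Qed.

Lemma counting_function_approx :
  `|(counting_function B)%:R - primitive_count R m / 2| <= (2 * m%:R + 1) ^+ 2 :> R.
Proof.
have /andP[h1 h2] := counting_function_bounds.
rewrite primitive_count_size size_normal_list natrM mulrAC divff ?mul1r //.
have e : ((2 * m).+1 * (2 * m).+1)%N%:R = (2 * m%:R + 1) ^+ 2 :> R.
  by rewrite natrM (_ : (2 * m).+1%:R = 2 * m%:R + 1) ?expr2 // -natr1 natrM.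
rewrite -e ger0_norm; last by rewrite subr_ge0 ler_nat.
by rewrite lerBlDl -natrD ler_nat.
Qed.

End Bounds.

(** Insert m = floor(sqrt B) in the asymptotic formula for primitive torsor
    points; the (2 m + 1)^2 singular points are absorbed in the error term. *)
Lemma counting_function_asymp : exists C : R, forall B : R, 1 <= B ->
  `|(counting_function B)%:R - leading_constant R * B * ln B| <= C * B.
Proof.
have [C C0 hC] := primitive_count_asymp R.
set k := fine (box_integral R) / (zeta R 2 * zeta R 3) in hC *.
exists (9 + C / 2 + 3 / 2 * `|k|) => B B1.
have B0 : 0 <= B by lra.
set y := Num.sqrt B; have yy : y * y = B by exact: sqrtK_ge0.
have y1 : 1 <= y by rewrite -[1]sqrtr1 ler_wsqrtr.
set m := Num.truncn y.
have /andP[my ym] : m%:R <= y < m.+1%:R by rewrite truncn_itv //; lra.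
have m0 : (0 < m)%N.
  by rewrite lt0n; apply: contraTneq ym => ->; rewrite -leNgt.
have m1 : (1 : R) <= m%:R by rewrite ler1n.
have ym' : y <= m%:R + 1 by rewrite natr1 ltW.
have h1 := counting_function_approx B0; rewrite -/y -/m in h1.
have h2 := hC m m0; have h3 := sqr_ln_floor m0 my ym'.
have lB : ln B = 2 * ln y by rewrite -yy lnM ?posrE; lra.
have cE : leading_constant R * B * ln B = k * (y ^+ 2 * ln y) / 2.
  rewrite /leading_constant lB /k expr2 yy; field.
  by rewrite !gt_eqF // (lt_le_trans ltr01) // zeta_ge1.
rewrite cE.
have m2 : m%:R ^+ 2 <= B by rewrite -yy expr2; apply: ler_pM; lra.
have e1 : (2 * m%:R + 1) ^+ 2 <= 9 * B by nra.
have e2 : `|primitive_count R m / 2 - k * (m%:R ^+ 2 * ln m%:R) / 2| <= C / 2 * B.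
  rewrite -mulrBl normrM (ger0_norm (_ : 0 <= 2^-1)) // mulrA [C / 2 * B]mulrAC ler_pM2r //.
  by apply: le_trans h2 _; exact: ler_wpM2l.
have e3 : `|k * (m%:R ^+ 2 * ln m%:R) / 2 - k * (y ^+ 2 * ln y) / 2| <= 3 / 2 * `|k| * B.
  rewrite -mulrBl -mulrBr normrM (normrM k) (ger0_norm (_ : 0 <= 2^-1)) //.
  have -> : 3 / 2 * `|k| * B = `|k| * (3 * B) / 2 by ring.
  by rewrite ler_pM2r // ler_wpM2l // -yy -expr2.
by move: h1 e1 e2 e3; rewrite !ler_norml !mulrDl; lra.
Qed.

End Counting.

(** * The asymptotic formula and Peyre's constant *)

Unset Implicit Arguments.

Theorem theorem1p1 (R : realType) :
  (exists C : R, \forall B \near +oo,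
     `|(counting_function B)%:R - leading_constant R * B * ln B| <= C * B) /\
  (forall mu : forall p : nat, {measure set (Qp_borel R p) -> \bar R},
     (forall p, prime p -> is_haar (mu p)) ->
     cvgn (tau_partial mu) /\
     leading_constant R = peyre_alpha R * (peyre_beta)%:R * peyre_tau mu).
Proof.
split.
  have [C hC] := counting_function_asymp R; exists C.
  by near=> B; apply: hC; near: B; apply: nbhs_pinfty_ge; rewrite num_real.
move=> mu hmu; have h := tau_partialE hmu; split; first by apply/cvg_ex; eexists; exact: h.
rewrite /peyre_tau (cvg_lim _ h) // peyre_alphaE peyre_betaE omega_inftyE mulr1.
rewrite fineM ?box_fin // /leading_constant /= invfM.
ring.
Unshelve. all: by end_near.
Qed.
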